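(* Let $H\in(\frac12,1)$, $T>0$, let $U,V$ be real separable Hilbert spaces, and let $Z$ be the infinite dimensional Rosenblatt process $Z(t)=\sum_j z_j(t)e_j$, where $(e_j)_j$ is an orthonormal basis of $U$ and $(z_j)_j$ are independent real Rosenblatt processes with parameter $H$. Let $\Phi\in\mathcal L(U;V)$ and let $A:\mathrm{Dom}(A)\subset V\to V$ be a negative self-adjoint operator. Then there exists a mild solution $X$ of the equation $$dX(t)=AX(t)\,dt+\Phi\,dZ(t),\qquad X(0)=x\in V,\quad t\in[0,T],$$ if and only if $\Phi^{\star}G_H(-A)\Phi$ is a trace class operator, where $$G_H(\lambda)=(\max(\lambda,1))^{-2H}.$$
   Context: Real Rosenblatt process with parameter $H$: $z(t)=d(H)\int_0^t\int_0^t\big[\int_{y_1\vee y_2}^t \frac{\partial K^{H'}}{\partial u}(u,y_1)\frac{\partial K^{H'}}{\partial u}(u,y_2)du\big]dB(y_1)dB(y_2)$ (double Wiener-Itô integral with respect to a standard Brownian motion $B$), where $H'=\frac{H+1}{2}$, $d(H)=\frac{1}{H+1}\left(\frac{H}{2(2H-1)}\right)^{-1/2}$, $\frac{\partial K^{h}}{\partial u}(u,y)=c_h\,y^{\frac12-h}u^{h-\frac12}(u-y)^{h-\frac32}$ for $0<y<u$ and $c_h=\left(\frac{h(2h-1)}{\beta(2-2h,h-\frac12)}\right)^{1/2}$. It has covariance $\frac12(t^{2H}+s^{2H}-|t-s|^{2H})$. The Wiener integral of a deterministic function $f$ with respect to $z$ extends by linearity and isometry the map $1_{(a,b]}\mapsto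 z(b)-z(a)$, with $\mathbf E\big[(\int_0^T f\,dz)^2\big]=H(2H-1)\int_0^T\int_0^T f(u)f(v)|u-v|^{2H-2}du\,dv$; for $V$-valued deterministic integrands it is defined analogously, with the product $f(u)f(v)$ replaced by $\langle f(u),f(v)\rangle_V$. The series defining $Z$ need not converge in $U$; it is understood in a larger Hilbert space $U_1\supset U$ such that the inclusion $U\subset U_1$ is nuclear. For a deterministic operator-valued function $(\Phi_s)_{s\in[0,T]}$ with values in $\mathcal L(U,V)$, $\int_0^t\Phi_s\,dZ(s):=\sum_j\int_0^t\Phi_s e_j\,dz_j(s)$, and the integral exists if this series converges in $L^2(\Omega;V)$. $(e^{tA})_{t\in[0,T]}$ is the strongly continuous semigroup generated by $A$. A mild solution is the process $$X(t)=e^{tA}x+\int_0^t e^{(t-s)A}\Phi\,dZ(s),\quad t\in[0,T],$$ when it exists, i.e. when the stochastic integral exists (in $L^2(\Omega;V)$) for every $t\in[0,T]$. $G_H(-A)$ is defined by functional calculus. *)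

(* Defs.v *)
From HB Require Import structures.
From mathcomp Require Import all_boot all_order all_algebra.
From mathcomp Require Import all_classical all_reals all_analysis.

Set Implicit Arguments.
Unset Strict Implicit.
Unset Printing Implicit Defensive.
Import Order.TTheory GRing.Theory Num.Theory.
Import numFieldNormedType.Exports.

Local Open Scope classical_set_scope.
Local Open Scope ring_scope.

HB.mixin Record NormedModule_isHilbert (R : realType) V
    of CompleteNormedModule R V := {
  ip : V -> V -> R ;
  ipC : forall x y, ip x y = ip y x ;
  ipDl : forall x y z, ip (x + y) z = ip x z + ip y z ;
  ipZl : forall (a : R) x y, ip (a *: x) y = a * ip x y ;
  ipxx : forall x, ip x x = `|x| ^+ 2
}.

#[short(type="hilbertType")]
HB.structure Definition Hilbert (R : realType) :=
  { V of CompleteNormedModule R V & NormedModule_isHilbert R V }.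

Section hilbert.
Context {R : realType}.

Definition separable (V : hilbertType R) : Prop :=
  exists Q : set V, countable Q /\ dense Q.

(* The index set [J] is an arbitrary set of natural numbers, so that
   finite-dimensional spaces are covered; [e j] is irrelevant off [J]. *)
Definition orthonormal_basis (U : hilbertType R) (J : set nat)
    (e : nat -> U) : Prop :=
  (forall i j, J i -> J j -> ip (e i) (e j) = (i == j)%:R) /\
  (forall u, (forall j, J j -> ip u (e j) = 0) -> u = 0).

(* The value is the unique such vector when [L] is bounded and linear (Riesz). *)
Definition adjoint (U V : hilbertType R) (L : U -> V) (v : V) : U :=
  xget 0 [set u : U | forall w : U, ip (L w) v = ip w u].

(* Trace class operator in the sense of nuclear operator:
   T = \sum_n <a_n, .> b_n with \sum_n |a_n| |b_n| < oo. *)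
Definition trace_class (U V : hilbertType R) (L : U -> V) : Prop :=
  exists (a : nat -> U) (b : nat -> V),
    cvgn (series (fun n => `|a n| * `|b n|)) /\
    forall u, series (fun n => ip (a n) u *: b n) @ \oo --> L u.

(** An unbounded operator on [V] is a pair of a domain [D : set V] and a total
    function [A : V -> V] whose values outside [D] are irrelevant. *)

(* The last clause says that the graphs of A^* and A coincide. *)
Definition self_adjoint (V : hilbertType R) (D : set V) (A : V -> V) : Prop :=
  [/\ dense D,
      forall (a : R) x y, D x -> D y ->
        D (a *: x + y) /\ A (a *: x + y) = a *: A x + A y &
      forall y w, (D y /\ A y = w) <->
        (forall x, D x -> ip (A x) y = ip x w)].

Definition negative_op (V : hilbertType R) (D : set V) (A : V -> V) : Prop :=
  forall x, D x -> ip (A x) x <= 0.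

Definition c0_semigroup (V : hilbertType R)
    (S : R -> {linear V -> V}) : Prop :=
  [/\ forall t, 0 <= t -> continuous (S t : V -> V),
      forall x, S 0 x = x,
      forall s t x, 0 <= s -> 0 <= t -> S (s + t) x = S s (S t x) &
      forall x, S t x @[t --> 0^'+] --> x].

Definition generated_by (V : hilbertType R) (S : R -> {linear V -> V})
    (D : set V) (A : V -> V) : Prop :=
  forall x y, (D x /\ A x = y) <->
    (h^-1 *: (S h x - x) @[h --> 0^'+] --> y).

Definition orthogonal_projection (V : hilbertType R) (p : V -> V) : Prop :=
  [/\ forall (a : R) x y, p (a *: x + y) = a *: p x + p y,
      forall x, p (p x) = p x &
      forall x y, ip (p x) y = ip x (p y)].

Definition projection_valued_measure (V : hilbertType R)
    (E : set R -> V -> V) : Prop :=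
  [/\ forall B, measurable B -> orthogonal_projection (E B),
      forall x, E setT x = x,
      forall B C x, measurable B -> measurable C ->
        E (B `&` C) x = E B (E C x) &
      forall (F : nat -> set R) x, (forall n, measurable (F n)) ->
        trivIset setT F ->
        series (fun n => E (F n) x) @ \oo --> E (\bigcup_n F n) x].

Definition diag_measure (V : hilbertType R) (E : set R -> V -> V) (x : V)
    (B : set R) : \bar R := (ip (E B x) x)%:E.

(* \int f d<E(.)x, y>; the signed measure <E(.)x, y> is written by polarization
   as (<E(.)(x+y), x+y> - <E(.)(x-y), x-y>) / 4. *)
Definition spectral_form (V : hilbertType R) (E : set R -> V -> V)
    (f : R -> R) (x y : V) : R :=
  4^-1 * (fine (\int[diag_measure E (x + y)%R]_l (f l)%:E)
          - fine (\int[diag_measure E (x - y)%R]_l (f l)%:E)).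

(* A = \int l dE(l), including the description of the domain of A. *)
Definition spectral_measure (V : hilbertType R) (D : set V) (A : V -> V)
    (E : set R -> V -> V) : Prop :=
  [/\ projection_valued_measure E,
      forall x, D x <-> (\int[diag_measure E x]_l (l ^+ 2)%:E < +oo)%E &
      forall x y, D x -> D y -> ip (A x) y = spectral_form E idfun x y].

(* f(A) = \int f dE for E the spectral measure of A and f bounded Borel. *)
Definition spectral_integral (V : hilbertType R) (E : set R -> V -> V)
    (f : R -> R) (x : V) : V :=
  xget 0 [set v : V | forall y : V, ip v y = spectral_form E f x y].

End hilbert.

Section probability.
Context {R : realType} {d : measure_display} {Omega : measurableType d}.
Variable P : probability Omega R.

Local Notation mu := (@lebesgue_measure R).

Definition independent_classes {I : choiceType} (J : set I)
    (F : I -> set (set Omega)) : Prop :=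
  forall (js : seq I) (C : I -> set Omega), uniq js ->
    (forall j, j \in js -> J j /\ F j (C j)) ->
    P (\bigcap_(j in [set` js]) C j) = (\prod_(j <- js) P (C j))%E.

Definition process_sigma_algebra (T : R) (z : R -> Omega -> R) :
    set (set Omega) :=
  <<s [set C | exists t B, [/\ 0 <= t <= T, measurable B & C = z t @^-1` B]] >>.

Definition subdivision (t : R) (n : nat) (tau : nat -> R) : Prop :=
  [/\ 0 <= tau 0, forall i, (i < n)%N -> tau i <= tau i.+1 & tau n <= t].

Definition brownian_motion (T : R) (B : R -> {RV P >-> R}) : Prop :=
  [/\ {ae P, forall w, B 0 w = 0},
      {ae P, forall w, {within `[0, T], continuous (fun t => B t w)}},
      forall s t, 0 <= s -> s < t -> t <= T -> forall C, measurable C ->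
        P [set w | C (B t w - B s w)] = normal_prob 0 (Num.sqrt (t - s)) C &
      forall n tau, subdivision T n tau ->
        independent_classes [set i | (i < n)%N]
          (fun i => [set D | exists2 C, measurable C &
             D = [set w | C (B (tau i.+1) w - B (tau i) w)]])].

(* The diagonal blocks i = j are excluded, as in the Ito multiple integral. *)
Definition offdiag_step (n : nat) (tau : nat -> R) (a : nat -> nat -> R)
    (p : R * R) : R :=
  \sum_(i < n) \sum_(j < n | j != i)
    a i j * \1_(`]tau i, tau i.+1]) p.1 * \1_(`]tau j, tau j.+1]) p.2.

Definition offdiag_integral (B : R -> Omega -> R) (n : nat) (tau : nat -> R)
    (a : nat -> nat -> R) (w : Omega) : R :=
  \sum_(i < n) \sum_(j < n | j != i)
    a i j * (B (tau i.+1) w - B (tau i) w) * (B (tau j.+1) w - B (tau j) w).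

Definition square (t : R) : set (R * R) := `[0, t] `*` `[0, t].

(* [Y] is (a version of) \int_0^t \int_0^t f(y1, y2) dB(y1) dB(y2): the
   continuous extension to L^2([0,t]^2) of the integral of elementary kernels. *)
Definition double_wiener_integral (B : R -> Omega -> R) (t : R)
    (f : R * R -> R) (Y : Omega -> R) : Prop :=
  [/\ measurable_fun (square t) f,
      (\int[mu \x mu]_(p in square t) (f p ^+ 2)%:E < +oo)%E,
      measurable_fun setT Y &
      exists (n : nat -> nat) (tau : nat -> nat -> R)
             (a : nat -> nat -> nat -> R),
      [/\ forall k, subdivision t (n k) (tau k),
          (\int[mu \x mu]_(p in square t)
             ((f p - offdiag_step (n k) (tau k) (a k) p) ^+ 2)%:E
             @[k --> \oo] --> 0)%E &
          (\int[P]_w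
             ((Y w - offdiag_integral B (n k) (tau k) (a k) w) ^+ 2)%:E
             @[k --> \oo] --> 0)%E]].

Definition beta (a b : R) : R :=
  (\int[mu]_(x in `]0, 1[) (x `^ (a - 1) * (1 - x) `^ (b - 1)))%R.

(* The partial derivative in u of the kernel K^h(u, y), for 0 < y < u. *)
Definition dK (h u y : R) : R :=
  Num.sqrt (h * (2 * h - 1) / beta (2 - 2 * h) (h - 2^-1))
  * y `^ (2^-1 - h) * u `^ (h - 2^-1) * (u - y) `^ (h - 3 / 2).

Definition rosenblatt_kernel (H t : R) (p : R * R) : R :=
  let h := (H + 1) / 2 in
  (\int[mu]_(u in `[Num.max p.1 p.2, t]) (dK h u p.1 * dK h u p.2))%R.

Definition rosenblatt_const (H : R) : R :=
  (H + 1)^-1 * (H / (2 * (2 * H - 1))) `^ (- 2^-1).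

Definition rosenblatt_process (H T : R) (z : R -> {RV P >-> R}) : Prop :=
  exists B : R -> {RV P >-> R}, brownian_motion T B /\
    forall t, 0 <= t <= T ->
      exists2 Y : Omega -> R,
        double_wiener_integral B t (rosenblatt_kernel H t) Y &
        {ae P, forall w, z t w = rosenblatt_const H * Y w}.

Section hilbert_valued.
Variable V : hilbertType R.

Definition borel_fun d' (T' : measurableType d') (D : set T') (f : T' -> V) :=
  measurable_fun D (f : T' -> g_sigma_algebraType (@open V)).

Definition L2_rv (Y : Omega -> V) : Prop :=
  borel_fun setT Y /\ (\int[P]_w (`|Y w| ^+ 2)%:E < +oo)%E.

Definition L2_cvg (Yn : nat -> Omega -> V) (Y : Omega -> V) : Prop :=
  (\int[P]_w (`|Yn n w - Y w| ^+ 2)%:E @[n --> \oo] --> 0)%E.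

Definition step_fun (n : nat) (a b : nat -> R) (v : nat -> V) (s : R) : V :=
  \sum_(i < n) (\1_(`]a i, b i]) s : R) *: v i.

Definition step_integral (z : R -> Omega -> R) (n : nat) (a b : nat -> R)
    (v : nat -> V) (w : Omega) : V :=
  \sum_(i < n) (z (b i) w - z (a i) w) *: v i.

Definition wiener_norm2 (H t : R) (f : R -> V) : \bar R :=
  ((H * (2 * H - 1))%:E * \int[mu \x mu]_(p in square t)
     (ip (f p.1) (f p.2) * `|p.1 - p.2| `^ (2 * H - 2))%:E)%E.

Definition wiener_integrand (H t : R) (f : R -> V) : Prop :=
  borel_fun `[0, t] f /\
  (\int[mu \x mu]_(p in square t)
     (`|f p.1| * `|f p.2| * `|p.1 - p.2| `^ (2 * H - 2))%:E < +oo)%E.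

(* [Y] is (a version of) \int_0^t f dz: the extension by linearity and
   isometry of v 1_(a,b] |-> (z(b) - z(a)) v. *)
Definition wiener_integral (H : R) (z : R -> Omega -> R) (t : R) (f : R -> V)
    (Y : Omega -> V) : Prop :=
  [/\ wiener_integrand H t f, L2_rv Y &
      exists (n : nat -> nat) (a b : nat -> nat -> R) (v : nat -> nat -> V),
      [/\ forall k i, (i < n k)%N -> 0 <= a k i <= b k i /\ b k i <= t,
          (wiener_norm2 H t
             (fun s => f s - step_fun (n k) (a k) (b k) (v k) s)%R
             @[k --> \oo] --> 0)%E &
          L2_cvg (fun k => step_integral z (n k) (a k) (b k) (v k)) Y]].

(* \int_0^t Psi_s dZ(s) = \sum_j \int_0^t Psi_s e_j dz_j(s) in L^2(Omega; V),
   for Z = \sum_j z_j e_j *)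
Definition stochastic_integral (U : hilbertType R) (H : R) (J : set nat)
    (e : nat -> U) (z : nat -> R -> Omega -> R) (t : R) (Psi : R -> U -> V)
    (Y : Omega -> V) : Prop :=
  L2_rv Y /\
  exists Yj : nat -> Omega -> V,
    (forall j, J j ->
       wiener_integral H (z j) t (fun s => Psi s (e j)) (Yj j)) /\
    L2_cvg (fun n w => \sum_(0 <= j < n | j \in J) Yj j w) Y.

(* [S] is the semigroup generated by A; the equation is
   dX = A X dt + Phi dZ, X(0) = x, on [0, T]. *)
Definition mild_solution (U : hilbertType R) (H T : R) (J : set nat)
    (e : nat -> U) (z : nat -> R -> Omega -> R) (S : R -> V -> V)
    (Phi : U -> V) (x : V) (X : R -> Omega -> V) : Prop :=
  forall t, 0 <= t <= T ->
    exists2 Y : Omega -> V,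
      stochastic_integral H J e z t (fun s u => S (t - s) (Phi u)) Y &
      {ae P, forall w, X t w = S t x + Y w}.

End hilbert_valued.
End probability.

Definition G_ {R : realType} (H l : R) : R := (Num.max l 1) `^ (- (2 * H)).

(* Main.v *)
(* The covariance of a Rosenblatt process is computed from its kernel, by Wick's
   formula and the beta integral [int_0^v dK(u,y) dK(v,y) dy =
   h (2h - 1) (u - v)^(2h-2)] for [v < u]. Hence a Wiener integral of [f] has
   second moment comparable with
     [H (2H - 1) int int <f(u), f(v)> |u - v|^(2H-2) du dv],
   and integrals with respect to distinct [z_j] are orthogonal: the stochastic
   convolution exists at time t exactly when the energies of [S(t - s) Phi e_j]
   have a finite sum over j. By the spectral theorem the j-th energy is the integral
   of [int_[0,t]^2 e^(-l (2t-u-v)) |u - v|^(2H-2) du dv] against the spectral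
   measure of [Phi e_j]. For t = T this function of l is bounded above and below by
   multiples of [max(l, 1)^(-2H)], so the sum of the energies is comparable with the
   trace of [Phi^* G_H(-A) Phi] in the basis [e_j]. A positive operator with a finite
   trace in one basis is trace class by its Cholesky factorization
   [T = sum_k <c_k, .> c_k], as [sum_k |c_k|^2] is at most this trace. *)

Require Import Defs.
From HB Require Import structures.
From mathcomp Require Import all_boot all_order all_algebra.
From mathcomp Require Import all_classical all_reals all_analysis.
From mathcomp Require Import measurable_realfun.
From mathcomp Require Import ring lra.

Set Implicit Arguments.
Unset Strict Implicit.
Unset Printing Implicit Defensive.
Import Order.TTheory GRing.Theory Num.Theory.
Import numFieldNormedType.Exports.

Local Open Scope classical_set_scope.
Local Open Scope ring_scope.

(** * Hilbert spaces and trace class operators *)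

(** The word comparable hides the main obstacle. Passing from step functions to general integrands
    needs positivity of the quadratic form with kernel |u - v|^(2H-2), which is usually read off a
    Fourier transform. Here it comes from probability: on step functions the form is a second moment
    of the process. Positivity of the form at f - 2s and at f - s/2 then compares f with its
    approximations s up to a factor 2, which does not affect summability over j. The semigroup is
    known only through its generator, so the spectral formula for its inner products has to be
    proved: on the range of E([a, a + d[) the operator -A equals a up to d, hence S(t) equals
    e^(-at) up to O(d). The exponents fit because h = (H + 1)/2: the two variables of the double
    kernel contribute |u - v|^(2h-2) each, and 2(2h - 2) = 2H - 2. The weight l^(-2H) is a scaling
    effect: both times live at distance 1/l from T, which gives the area l^(-2) and the kernel value
    l^(2-2H). *)

Lemma cvg_sumr {R : realType} (T I : Type) (F : set_system T) (FF : Filter F)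
    (r : seq I) (f : I -> T -> R) (l : I -> R) :
  (forall i, f i @ F --> l i) ->
  \sum_(i <- r) f i t @[t --> F] --> \sum_(i <- r) l i.
Proof.
move=> fl; elim: r => [|i r IH].
  by under eq_fun do rewrite big_nil; rewrite big_nil; exact: cvg_cst.
under eq_fun do rewrite big_cons.
by rewrite big_cons; apply: cvgD.
Qed.

Section inner_product.
Context {R : realType} {V : hilbertType R}.
Implicit Types x y z : V.

Lemma ipDr x y z : ip x (y + z) = ip x y + ip x z.
Proof. by rewrite ipC ipDl !(ipC x). Qed.

Lemma ipZr (a : R) x y : ip x (a *: y) = a * ip x y.
Proof. by rewrite ipC ipZl ipC. Qed.

Lemma ip0l x : ip 0 x = 0.
Proof. by rewrite -(scale0r 0) ipZl mul0r. Qed.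

Lemma ip0r x : ip x 0 = 0.
Proof. by rewrite ipC ip0l. Qed.

Lemma ipNl x y : ip (- x) y = - ip x y.
Proof. by rewrite -scaleN1r ipZl mulN1r. Qed.

Lemma ipNr x y : ip x (- y) = - ip x y.
Proof. by rewrite ipC ipNl ipC. Qed.

Lemma ipBl x y z : ip (x - y) z = ip x z - ip y z.
Proof. by rewrite ipDl ipNl. Qed.

Lemma ipBr x y z : ip x (y - z) = ip x y - ip x z.
Proof. by rewrite ipDr ipNr. Qed.

Lemma ip_suml I (r : seq I) (p : pred I) (F : I -> V) y :
  ip (\sum_(i <- r | p i) F i) y = \sum_(i <- r | p i) ip (F i) y.
Proof. by elim/big_rec2: _ => [|i a b _ <-]; rewrite ?ip0l ?ipDl. Qed.

Lemma ip_sumr I (r : seq I) (p : pred I) (F : I -> V) y :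
  ip y (\sum_(i <- r | p i) F i) = \sum_(i <- r | p i) ip y (F i).
Proof. by rewrite ipC ip_suml; apply: eq_bigr => i _; rewrite ipC. Qed.

Lemma ip_ge0 x : 0 <= ip x x.
Proof. by rewrite ipxx sqr_ge0. Qed.

Lemma ip_eq0 x : ip x x = 0 -> x = 0.
Proof. by rewrite ipxx => /eqP; rewrite sqrf_eq0 normr_eq0 => /eqP. Qed.

Lemma ip_inj x y : (forall z, ip x z = ip y z) -> x = y.
Proof.
by move=> xy; apply/subr0_eq/ip_eq0; rewrite ipBl xy subrr.
Qed.

Lemma norm2D x y : `|x + y| ^+ 2 = `|x| ^+ 2 + 2 * ip x y + `|y| ^+ 2.
Proof. by rewrite -!ipxx ipDl !ipDr (ipC y x); ring. Qed.

Lemma norm2B x y : `|x - y| ^+ 2 = `|x| ^+ 2 - 2 * ip x y + `|y| ^+ 2.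
Proof. by rewrite norm2D ipNr normrN; ring. Qed.

Lemma parallelogram x y :
  `|x + y| ^+ 2 + `|x - y| ^+ 2 = 2 * `|x| ^+ 2 + 2 * `|y| ^+ 2.
Proof. by rewrite norm2D norm2B; ring. Qed.

End inner_product.

(** The sign of the discriminant, isolated because every Cauchy-Schwarz inequality below (positive
    operators, spectral forms, L^2, finite sums) is an instance of it. *)
Lemma quadratic_CS {R : realType} (a b c : R) :
  (forall s, 0 <= a + 2 * s * b + s ^+ 2 * c) -> b ^+ 2 <= a * c.
Proof.
move=> h; have [c0|c0] := eqVneq c 0.
  have [->|b0] := eqVneq b 0; first by rewrite c0 mulr0 expr0n.
  (* For c = 0 the polynomial is affine in s and takes the value -1 at this point. *)
  have := h (- (a + 1) / (2 * b)); rewrite c0 mulr0 addr0.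
  have -> : 2 * (- (a + 1) / (2 * b)) * b = - (a + 1) by field.
  by rewrite leNgt; case/negP; lra.
have cp : 0 < c.
  rewrite lt_neqAle eq_sym c0 /=; rewrite leNgt; apply/negP => cn.
  (* For c < 0 this point is far enough out for the quadratic term to dominate, so the polynomial is
     negative there. *)
  have h0 := h 0; have h1 := h ((`|b| + a + 1) / - c * 2 + 1).
  set u := (`|b| + a + 1) / - c in h1.
  have u0 : 0 < u.
    rewrite divr_gt0 ?oppr_gt0//; have := normr_ge0 b; nra.
  have uc : u * - c = `|b| + a + 1 by rewrite /u mulfVK// oppr_eq0.
  have bb := ler_norm b; have nb := normr_ge0 b.
  nra.
have := h (- b / c); have -> : a + 2 * (- b / c) * b + (- b / c) ^+ 2 * c =
  (a * c - b ^+ 2) / c by field.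
by rewrite pmulr_lge0 ?invr_gt0// subr_ge0.
Qed.

Section inner_product_topology.
Context {R : realType} {V : hilbertType R}.
Implicit Types x y z : V.

Lemma cauchy_schwarz2 x y : ip x y ^+ 2 <= `|x| ^+ 2 * `|y| ^+ 2.
Proof.
apply: quadratic_CS => s; have := sqr_ge0 `|x + s *: y|.
by rewrite norm2D ipZr normrZ exprMn real_normK ?num_real// mulrA.
Qed.

Lemma cauchy_schwarz x y : `|ip x y| <= `|x| * `|y|.
Proof.
rewrite -(@ler_pXn2r _ 2)// ?nnegrE ?mulr_ge0//.
by rewrite exprMn real_normK ?num_real// cauchy_schwarz2.
Qed.

Lemma cvg_ip (T : Type) (F : set_system T) (FF : Filter F) (f g : T -> V) x y :
  f @ F --> x -> g @ F --> y -> ip (f t) (g t) @[t --> F] --> ip x y.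
Proof.
move=> fx gy.
have cn (h : T -> V) a : h @ F --> a -> (`|h t| ^+ 2) @[t --> F] --> `|a| ^+ 2.
  by move=> ha; apply: cvgM; exact: cvg_norm.
have -> : ip x y = 4^-1 * (`|x + y| ^+ 2 - `|x - y| ^+ 2).
  by rewrite norm2D norm2B; field.
rewrite (_ : (fun t => ip (f t) (g t)) =
  fun t => 4^-1 * (`|f t + g t| ^+ 2 - `|f t - g t| ^+ 2)); last first.
  by apply/funext => t; rewrite norm2D norm2B; field.
apply: cvgM; first exact: cvg_cst.
by apply: cvgB; apply: cn; [exact: cvgD|exact: cvgB].
Qed.

Lemma continuous_ip y : continuous (fun x : V => ip x y).
Proof. by move=> x; apply: cvg_ip; [exact: cvg_id|exact: cvg_cst]. Qed.

Lemma norm_cauchy_cvg (W : completeNormedModType R) (u : nat -> W) :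
  (forall e, 0 < e -> exists N, forall m n, (N <= m)%N -> (N <= n)%N ->
     `|u m - u n| <= e) -> cvgn u.
Proof.
move=> h; apply/cauchy_cvgP/cauchy_ballP => e e0.
have [N hN] := h (e / 2) (ltac:(by rewrite divr_gt0)).
rewrite near_map2; exists ([set n | (N <= n)%N], [set n | (N <= n)%N]) => /=.
  by split; exists N.
move=> [m n] /= [Nm Nn]; rewrite -ball_normE /=.
by apply: le_lt_trans (hN _ _ Nm Nn) _; rewrite ltr_pdivrMr// ltr_pMr// ltr1n.
Qed.

(* The minimizer of [|x|^2 / 2 - L x] represents [L]. *)
Lemma riesz (L : V -> R) (C : R) :
  (forall a x y, L (a *: x + y) = a * L x + L y) ->
  (forall x, `|L x| <= C * `|x|) -> exists u, forall x, L x = ip u x.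
Proof.
move=> linL bL.
have LD x y : L (x + y) = L x + L y by rewrite -[x]scale1r linL mul1r scale1r.
have L0 : L 0 = 0 by have := LD 0 0; rewrite addr0; lra.
have LZ a x : L (a *: x) = a * L x by rewrite -[a *: x]addr0 linL L0 addr0.
pose F x := `|x| ^+ 2 / 2 - L x.
have FC x : - (C ^+ 2 / 2) <= F x.
  have := bL x; rewrite /F ler_norml => /andP[_ Lx].
  have := sqr_ge0 (`|x| - C); nra.
pose A := [set F x | x in [set: V]].
have lbA : has_lbound A by exists (- (C ^+ 2 / 2)) => _ [x _ <-].
have A0 : A !=set0 by exists (F 0), 0.
pose m := inf A.
have mF x : m <= F x by apply: ge_inf => //; exists x.
have /choice[u uP] : forall n : nat, exists x, F x < m + n.+1%:R^-1.
  move=> n; have [_ [x _ <-] xm] := @inf_adherent _ A n.+1%:R^-1 (ltac:(by rewrite invr_gt0 ltr0n)) (conj A0 lbA).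
  by exists x.
(* Parallelogram law at the midpoint, where F is at least m: a minimizing sequence is Cauchy. *)
have cu n k : `|u n - u k| ^+ 2 <= 4 * (n.+1%:R^-1 + k.+1%:R^-1).
  have := mF (2^-1 *: (u n + u k)).
  rewrite /F LZ LD normrZ exprMn ger0_norm//.
  have := parallelogram (u n) (u k); have := uP n; have := uP k; rewrite /F.
  set p := n.+1%:R^-1; set q := k.+1%:R^-1.
  set a := `|u n + u k| ^+ 2; set c := `|u n - u k| ^+ 2; lra.
have inv_small e : 0 < e -> exists N, forall n, (N <= n)%N -> n.+1%:R^-1 <= e :> R.
  move=> e0; exists (Num.truncn e^-1) => n Nn.
  rewrite -[e]invrK lef_pV2 ?posrE ?invr_gt0//.
  apply: ltW; apply: lt_le_trans (truncnS_gt _) _.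
  by rewrite ler_nat ltnS.
have cvu : cvgn u.
  apply: norm_cauchy_cvg => e e0.
  have [N hN] := inv_small (e ^+ 2 / 8) (ltac:(by rewrite divr_gt0// exprn_gt0)).
  exists N => n k Nn Nk; rewrite -(@ler_pXn2r _ 2)// ?nnegrE//; last exact: ltW.
  apply: le_trans (cu n k) _; have := hN _ Nn; have := hN _ Nk.
  by move: n.+1%:R^-1 k.+1%:R^-1 => p q ? ?; lra.
set v := limn u.
(* Near-minimality of [u n] along the line in direction h, written as a quadratic polynomial in s;
   its discriminant bounds the defect [ip (u n) h - L h], which vanishes in the limit. *)
have FN h n s : 0 <= n.+1%:R^-1 + 2 * s * ((ip (u n) h - L h) / 2) + s ^+ 2 * (`|h| ^+ 2 / 2).
  have := mF (u n + s *: h); have := uP n; rewrite /F LD LZ norm2D ipZr normrZ exprMn.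
  rewrite (real_normK (num_real s)); move: n.+1%:R^-1 => p; nra.
exists v => h; apply/esym/eqP; rewrite -subr_eq0; apply/eqP.
have c1 : (((ip (u n) h - L h) / 2) ^+ 2 @[n --> \oo] --> ((ip v h - L h) / 2) ^+ 2).
  have c0 : ((ip (u n) h - L h) / 2 @[n --> \oo] --> (ip v h - L h) / 2).
    apply: cvgM; last exact: cvg_cst.
    apply: cvgB; last exact: cvg_cst.
    by apply: cvg_ip; [exact: cvu|exact: cvg_cst].
  by apply: cvgM.
have c2 : n.+1%:R^-1 * (`|h| ^+ 2 / 2) @[n --> \oo] --> 0 * (`|h| ^+ 2 / 2).
  by apply: cvgM; [exact: cvg_harmonic|exact: cvg_cst].
have : ((ip v h - L h) / 2) ^+ 2 <= 0 * (`|h| ^+ 2 / 2).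
  apply: ler_cvg_to c1 c2 _; apply: nearW => n; exact/quadratic_CS/FN.
rewrite mul0r => h0; have : ((ip v h - L h) / 2) ^+ 2 == 0.
  by rewrite eq_le h0 sqr_ge0.
by rewrite sqrf_eq0 mulf_eq0 invr_eq0 pnatr_eq0 orbF => /eqP.
Qed.

End inner_product_topology.

Lemma series_abs_summable {R : realType} (W : completeNormedModType R)
    (f : nat -> W) (a : nat -> R) (C : R) :
  (forall n, `|f n| <= a n) -> (forall n, \sum_(0 <= k < n) a k <= C) ->
  cvgn (series f).
Proof.
move=> fa aC; have a0 n : 0 <= a n by apply: le_trans (fa n).
have ca : cvgn (series a).
  apply: nondecreasing_is_cvgn.
    apply/nondecreasing_seqP => n; rewrite /series /= big_nat_recr//=.
    by rewrite lerDl.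
  by exists C => _ [n _ <-]; exact: aC.
apply: normed_cvg; apply: series_le_cvg ca => // n; exact: normr_ge0.
Qed.

(** * Orthonormal expansions: Bessel and Parseval *)

Section bessel.
Context {R : realType} {U : hilbertType R}.
Variables (J : set nat) (e : nat -> U).
Hypothesis basis_e : orthonormal_basis J e.

(** Padding by zero off J turns sums over an arbitrary index set into series over nat; the added
    zero vectors contribute nothing to norms or traces. *)
Definition basis_ext (j : nat) : U := if j \in J then e j else 0.
Local Notation b := basis_ext.

Lemma ip_basis_ext i j : i != j -> ip (b i) (b j) = 0.
Proof.
rewrite /basis_ext => ij; case: ifPn => [/set_mem Ji|_]; last by rewrite ip0l.
case: ifPn => [/set_mem Jj|_]; last by rewrite ip0r.
by rewrite (proj1 basis_e)// (negbTE ij).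
Qed.

(** Replaces the normalization of a basis vector: the padded vectors have norm 1 or are 0, and this
    identity covers both cases. *)
Lemma ip_basis_ext_mul i u : ip (b i) (b i) * ip u (b i) = ip u (b i).
Proof.
rewrite /basis_ext; case: ifPn => [/set_mem Ji|_]; last by rewrite !ip0r mulr0.
by rewrite (proj1 basis_e)// eqxx mul1r.
Qed.

Lemma bessel_remainder u n :
  `|u - \sum_(0 <= j < n) ip u (b j) *: b j| ^+ 2 =
  `|u| ^+ 2 - \sum_(0 <= j < n) ip u (b j) ^+ 2.
Proof.
rewrite norm2B -[in X in _ + X]ipxx !ip_sumr.
under eq_bigr do rewrite ipZr -expr2.
have -> : \sum_(0 <= i < n) ip (\sum_(0 <= j < n) ip u (b j) *: b j)
    (ip u (b i) *: b i) = \sum_(0 <= j < n) ip u (b j) ^+ 2.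
  rewrite big_seq [RHS]big_seq; apply: eq_bigr => i ni.
  rewrite ipZr ip_suml (bigD1_seq i) ?iota_uniq//= big1 ?addr0; last first.
    by move=> j ji; rewrite ipZl ip_basis_ext// mulr0.
  by rewrite ipZl [X in _ * X = _]mulrC ip_basis_ext_mul -expr2.
lra.
Qed.

Lemma bessel u n : \sum_(0 <= j < n) ip u (b j) ^+ 2 <= `|u| ^+ 2.
Proof. by rewrite -subr_ge0 -bessel_remainder sqr_ge0. Qed.

Lemma basis_ext_total u : (forall j, ip u (b j) = 0) -> u = 0.
Proof.
move=> h; apply: (proj2 basis_e) => j Jj.
by have := h j; rewrite /basis_ext mem_set.
Qed.

(** Squared increments of the partial sums are increments of the convergent Bessel series, so the
    series converges; its sum has the same coefficients as u, and totality of the basis identifies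
    it. *)
Lemma basis_expansion u : series (fun j => ip u (b j) *: b j) @ \oo --> u.
Proof.
have sub m n : (m <= n)%N ->
    `|series (fun j => ip u (b j) *: b j) n - series (fun j => ip u (b j) *: b j) m| ^+ 2
    = series (fun j => ip u (b j) ^+ 2) n - series (fun j => ip u (b j) ^+ 2) m.
  move=> mn; rewrite !sub_series_geq//.
  rewrite -ipxx ip_suml big_seq [RHS]big_seq; apply: eq_bigr => i ni.
  rewrite ipZl ip_sumr (bigD1_seq i) ?iota_uniq//= big1 ?addr0; last first.
    by move=> j ji; rewrite ipZr ip_basis_ext ?mulr0// eq_sym.
  by rewrite ipZr [X in _ * X = _]mulrC ip_basis_ext_mul -expr2.
have cb : cvgn (series (fun j => ip u (b j) ^+ 2)).
  apply: nondecreasing_is_cvgn.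
    apply/nondecreasing_seqP => n; rewrite /series /= big_nat_recr//=.
    by rewrite lerDl sqr_ge0.
  by exists (`|u| ^+ 2) => _ [n _ <-]; exact: bessel.
have cu : cvgn (series (fun j => ip u (b j) *: b j)).
  apply: norm_cauchy_cvg => r r0.
  have r20 : 0 < r ^+ 2 / 2 by rewrite divr_gt0// exprn_gt0.
  move/cvgrPdist_le : cb => /(_ _ r20)[N _ hN].
  exists N.
  suff suf m n : (N <= m)%N -> (m <= n)%N -> `|series (fun j => ip u (b j) *: b j) n - series (fun j => ip u (b j) *: b j) m| <= r.
    move=> m n Nm Nn; case: (leqP m n) => mn; last by apply: suf => //; exact: ltnW.
    by rewrite distrC; apply: suf.
  move=> Nm mn; rewrite -(@ler_pXn2r _ 2)// ?nnegrE//; last exact: ltW.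
  rewrite sub//; have := hN _ Nm; have := hN _ (leq_trans Nm mn) => /=.
  by rewrite !ler_norml => /andP[? ?] /andP[? ?]; lra.
suff {2}-> : u = limn (series (fun j => ip u (b j) *: b j)) by exact: cu.
apply/subr0_eq/basis_ext_total => j.
rewrite ipBl; apply/eqP; rewrite subr_eq0 eq_sym; apply/eqP.
apply: (@cvg_unique _ (@Rhausdorff R) (ip (series (fun j => ip u (b j) *: b j) n) (b j) @[n --> \oo])).
  by apply: cvg_ip => //; exact: cvg_cst.
apply: cvg_near_cst; exists j.+1 => // n /= jn.
rewrite /series /= ip_suml (bigD1_seq j) ?iota_uniq ?mem_index_iota//= big1 ?addr0.
  by rewrite ipZl mulrC ip_basis_ext_mul.
by move=> k kj; rewrite ipZl ip_basis_ext ?mulr0// eq_sym.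
Qed.

Lemma parseval u : series (fun j => ip u (b j) ^+ 2) @ \oo --> `|u| ^+ 2.
Proof.
rewrite -ipxx.
rewrite (_ : series _ = fun n => ip (series (fun j => ip u (b j) *: b j) n) u).
  by apply: cvg_ip; [exact: basis_expansion|exact: cvg_cst].
apply/funext => n; rewrite /series/= ip_suml; apply: eq_bigr => j _.
by rewrite ipZl (ipC u (b j)) expr2.
Qed.

End bessel.

(** * Positive operators and their Cholesky factorization *)

Section positive_operator.
Context {R : realType} {U : hilbertType R}.

Definition psd_op (T : U -> U) : Prop :=
  [/\ forall a x y, T (a *: x + y) = a *: T x + T y,
      forall x y, ip (T x) y = ip x (T y) &
      forall x, 0 <= ip (T x) x].

Variable T : U -> U.
Hypothesis psdT : psd_op T.

Lemma psd_linD x y : T (x + y) = T x + T y.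
Proof. by case: psdT => l _ _; rewrite -[x]scale1r l !scale1r. Qed.

Lemma psd_lin0 : T 0 = 0.
Proof. by have := psd_linD 0 0; rewrite addr0 => /esym/eqP; rewrite -subr_eq0 addrK => /eqP. Qed.

Lemma psd_linZ a x : T (a *: x) = a *: T x.
Proof. by case: psdT => l _ _; rewrite -[a *: x]addr0 l psd_lin0 addr0. Qed.

Lemma psd_CS x y : ip (T x) y ^+ 2 <= ip (T x) x * ip (T y) y.
Proof.
case: psdT => l s p; apply: quadratic_CS => r.
have := p (x + r *: y); rewrite psd_linD psd_linZ ipDl !ipDr !ipZl !ipZr.
by rewrite (s y x) (ipC y (T x)); congr (0 <= _); ring.
Qed.

Lemma psd_eq0 x : ip (T x) x = 0 -> T x = 0.
Proof.
move=> h; apply: ip_eq0; have := psd_CS x (T x).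
by rewrite h mul0r => h1; apply/eqP; rewrite -sqrf_eq0 eq_le h1 sqr_ge0.
Qed.

End positive_operator.

Section cholesky.
Context {R : realType} {U : hilbertType R}.
Variables (J : set nat) (e : nat -> U).
Hypothesis basis_e : orthonormal_basis J e.
Variable T : U -> U.
Hypothesis psdT : psd_op T.
Local Notation b := (basis_ext J e).

Definition pivot (S : U -> U) (x : U) : U := (Num.sqrt (ip (S x) x))^-1 *: S x.

(* One step of the Cholesky factorization: it kills [x] and keeps the operator
   positive; [pivot S x = 0] when [<S x, x> = 0]. *)
Definition reduce (S : U -> U) (x y : U) : U := S y - ip (pivot S x) y *: pivot S x.

Fixpoint residual (n : nat) : U -> U :=
  if n is m.+1 then reduce (residual m) (b m) else T.

Definition cholesky_col (n : nat) : U := pivot (residual n) (b n).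

(** Stated without a division so that it also covers <Sx, x> = 0, where positivity forces Sx = 0. *)
Lemma pivot_ip S x y : psd_op S ->
  ip (pivot S x) y ^+ 2 * ip (S x) x = ip (S x) y ^+ 2.
Proof.
move=> psdS; rewrite ipZl exprMn exprVn sqr_sqrtr; last by case: psdS.
have [h|h] := eqVneq (ip (S x) x) 0; last by field.
by rewrite (psd_eq0 psdS h) !ip0l expr0n /= mulr0.
Qed.

Lemma psd_reduce S x : psd_op S -> psd_op (reduce S x).
Proof.
move=> psdS; have [l s p] := psdS; split.
- move=> a y z; rewrite /reduce l ipDr ipZr scalerDl -scalerA scalerBr opprD.
  by rewrite !addrA; congr (_ + _); rewrite addrAC.
- move=> y z; rewrite /reduce ipBl ipBr ipZl ipZr s (ipC (pivot S x) y).
  by congr (_ - _); rewrite mulrC.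
- move=> y; rewrite /reduce ipBl ipZl -expr2 subr_ge0.
  have [h|h] := eqVneq (ip (S x) x) 0.
    by rewrite /pivot (psd_eq0 psdS h) scaler0 ip0l expr0n /= p.
  have h0 : 0 < ip (S x) x by rewrite lt_neqAle eq_sym h p.
  by rewrite -(ler_pM2r h0) pivot_ip// mulrC psd_CS.
Qed.

Lemma psd_residual n : psd_op (residual n).
Proof. by elim: n => //= n; exact: psd_reduce. Qed.

Lemma reduce_eq0 S x : psd_op S -> reduce S x x = 0.
Proof.
move=> psdS; rewrite /reduce /pivot ipZl scalerA.
have [h|h] := eqVneq (ip (S x) x) 0.
  by rewrite (psd_eq0 psdS h) scaler0 subr0.
rewrite mulrAC -expr2 exprVn sqr_sqrtr; last by case: psdS.
by rewrite mulVf// scale1r subrr.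
Qed.

(** What has been killed stays killed: by symmetry the pivot column, which lies in the range of S,
    is orthogonal to the kernel of S. *)
Lemma reduce_eq0W S x y : psd_op S -> S y = 0 -> reduce S x y = 0.
Proof.
case=> _ s _ Sy; by rewrite /reduce /pivot ipZl (s x y) Sy ip0r mulr0 scale0r subr0.
Qed.

Lemma residual_eq0 n j : (j < n)%N -> residual n (b j) = 0.
Proof.
elim: n => // n IH; rewrite ltnS leq_eqVlt => /predU1P[->|jn] /=.
  by apply: reduce_eq0; exact: psd_residual.
by apply: reduce_eq0W; [exact: psd_residual|exact: IH].
Qed.

Lemma residualE n u : residual n u =
  T u - \sum_(0 <= k < n) ip (cholesky_col k) u *: cholesky_col k.
Proof.
elim: n u => [u|n IH u]; first by rewrite big_geq// subr0.
by rewrite /= /reduce IH big_nat_recr//= opprD addrA.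
Qed.

Lemma cholesky_col_triangular k j : (j < k)%N -> ip (cholesky_col k) (b j) = 0.
Proof.
move=> jk; rewrite /cholesky_col /pivot ipZl.
case: (psd_residual k) => _ s _.
by rewrite (s (b k) (b j)) (residual_eq0 jk) ip0r mulr0.
Qed.

Lemma cholesky_basis j : T (b j) =
  \sum_(0 <= k < j.+1) ip (cholesky_col k) (b j) *: cholesky_col k.
Proof.
by apply/subr0_eq; rewrite -residualE residual_eq0.
Qed.

(** Expand each |c_k|^2 by Parseval and exchange the sums. Since the residual is positive, the j-th
    diagonal entry of the partial factorization is at most <T b_j, b_j>. *)
Lemma cholesky_col_summable C :
  (forall n, \sum_(0 <= j < n) ip (T (b j)) (b j) <= C) ->
  forall n, \sum_(0 <= k < n) `|cholesky_col k| ^+ 2 <= C.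
Proof.
move=> hC n.
have cv : \sum_(0 <= k < n) series (fun j => ip (cholesky_col k) (b j) ^+ 2) m
   @[m --> \oo] --> \sum_(0 <= k < n) `|cholesky_col k| ^+ 2.
  by apply: cvg_sumr => k; exact: (parseval basis_e).
apply: ler_cvg_to cv (cvg_cst C) _; apply: nearW => m; apply: le_trans (hC m).
rewrite /series /= exchange_big /=; apply: ler_sum => j _.
have := (fun x => let: And3 _ _ p := psd_residual n in p x) (b j).
rewrite residualE ipBl subr_ge0 ip_suml; apply: le_trans.
by under [leRHS]eq_bigr do rewrite ipZl -expr2.
Qed.

Lemma trace_class_psd C :
  (forall n, \sum_(0 <= j < n) ip (T (b j)) (b j) <= C) -> trace_class T.
Proof.
move=> /cholesky_col_summable sC; exists cholesky_col, cholesky_col; split.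
  apply: (@series_abs_summable _ R _ (fun n => `|cholesky_col n| ^+ 2) C) => // n.
  by rewrite ger0_norm ?expr2// mulr_ge0.
move=> u; set f := fun n => _.
have cf : cvgn (series f).
  apply: (@series_abs_summable _ U _ (fun n => `|u| * `|cholesky_col n| ^+ 2) (`|u| * C)).
    move=> n; rewrite /f normrZ expr2 mulrA ler_wpM2r//.
    by rewrite mulrC cauchy_schwarz.
  by move=> n; rewrite -mulr_sumr ler_wpM2l.
suff -> : T u = limn (series f) by exact: cf.
apply/subr0_eq/(basis_ext_total basis_e) => j.
rewrite ipBl; apply/eqP; rewrite subr_eq0 eq_sym; apply/eqP.
apply: (@cvg_unique _ (@Rhausdorff R) (ip (series f n) (b j) @[n --> \oo])).
  by apply: cvg_ip => //; exact: cvg_cst.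
apply: cvg_near_cst; exists j.+1 => // n /= jn.
(* Symmetry moves T onto b_j, where the factorization is a finite sum; by triangularity the columns
   beyond j do not see b_j, so the series is stationary from j + 1 on. *)
case: psdT => _ s _; rewrite (s u (b j)) cholesky_basis ip_sumr /series /= ip_suml.
rewrite (big_cat_nat (leq0n j.+1) jn)/= [X in _ + X]big_nat_cond [X in _ + X]big1 ?addr0; last first.
  move=> k /andP[/andP[jk _] _].
  by rewrite /f ipZl cholesky_col_triangular// mulr0.
by apply: eq_bigr => k _; rewrite /f ipZl ipZr (ipC u) mulrC.
Qed.

End cholesky.

(** The k-th rank-one term contributes sum_j <a_k, b_j> <c_k, b_j>, which Cauchy-Schwarz and Bessel
    bound by |a_k| |c_k|, uniformly in the number of basis vectors. *)
Lemma trace_class_bounded_trace {R : realType} {U : hilbertType R} (J : set nat)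
    (e : nat -> U) (T : U -> U) : orthonormal_basis J e -> trace_class T ->
  exists C, forall n,
    \sum_(0 <= j < n) ip (T (basis_ext J e j)) (basis_ext J e j) <= C.
Proof.
move=> be [a [c [cac hT]]]; exists (limn (series (fun n => `|a n| * `|c n|))) => n.
pose b := basis_ext J e.
have cv : \sum_(0 <= j < n) ip (series (fun k => ip (a k) (b j) *: c k) m) (b j)
   @[m --> \oo] --> \sum_(0 <= j < n) ip (T (b j)) (b j).
  apply: cvg_sumr => j; apply: cvg_ip; [exact: hT|exact: cvg_cst].
apply: ler_cvg_to cv cac _; apply: nearW => m.
rewrite /series/=; under eq_bigr do rewrite ip_suml.
rewrite exchange_big /=; apply: ler_sum => k _.
under eq_bigr do rewrite ipZl.
apply: le_trans (ler_norm _) _.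
rewrite -(@ler_pXn2r _ 2)// ?nnegrE ?mulr_ge0// real_normK ?num_real// exprMn.
apply: le_trans (_ : _ <= (\sum_(0 <= j < n) ip (a k) (b j) ^+ 2) *
   (\sum_(0 <= j < n) ip (c k) (b j) ^+ 2)) _; last first.
  by apply: ler_pM; rewrite ?sumr_ge0// ?bessel// => i _; exact: sqr_ge0.
apply: quadratic_CS => s.
rewrite !mulr_sumr -!big_split sumr_ge0//= => j _.
by have := sqr_ge0 (ip (a k) (b j) + s * ip (c k) (b j)); congr (0 <= _); ring.
Qed.

(** * Spectral representation of the semigroup *)

Section spectral_measures.
Context {R : realType} {V : hilbertType R}.
Variable E : set R -> V -> V.
Hypothesis pvm : projection_valued_measure E.
Implicit Types (B C : set R) (x y z : V).

Lemma pvm_lin B (a : R) x y : measurable B -> E B (a *: x + y) = a *: E B x + E B y.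
Proof. by move=> mB; case: pvm => /(_ _ mB)[-> ]. Qed.

Lemma pvm_linD B x y : measurable B -> E B (x + y) = E B x + E B y.
Proof. by move=> mB; rewrite -[x]scale1r pvm_lin// !scale1r. Qed.

Lemma pvm_lin0 B : measurable B -> E B 0 = 0.
Proof.
by move=> mB; apply: (addrI (E B 0)); rewrite -pvm_linD// !addr0.
Qed.

Lemma pvm_linZ B a x : measurable B -> E B (a *: x) = a *: E B x.
Proof. by move=> mB; rewrite -[a *: x]addr0 pvm_lin// pvm_lin0// addr0. Qed.

Lemma pvm_linN B x : measurable B -> E B (- x) = - E B x.
Proof. by move=> mB; rewrite -scaleN1r pvm_linZ// scaleN1r. Qed.

Lemma pvm_idem B x : measurable B -> E B (E B x) = E B x.
Proof. by move=> mB; case: pvm => /(_ _ mB)[_ ->]. Qed.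

Lemma pvm_sym B x y : measurable B -> ip (E B x) y = ip x (E B y).
Proof. by move=> mB; case: pvm => /(_ _ mB)[_ _ ->]. Qed.

Lemma pvm_norm2 B x : measurable B -> ip (E B x) x = `|E B x| ^+ 2.
Proof. by move=> mB; rewrite -ipxx -[in LHS]pvm_idem// pvm_sym. Qed.

Lemma pvm_setT x : E setT x = x.
Proof. by case: pvm. Qed.

Lemma pvm_setI B C x : measurable B -> measurable C ->
  E B (E C x) = E (B `&` C) x.
Proof. by move=> mB mC; case: pvm => _ _ -> //. Qed.

Lemma pvm_bigcup (F : nat -> set R) x : (forall n, measurable (F n)) ->
  trivIset setT F -> series (fun n => E (F n) x) @ \oo --> E (\bigcup_n F n) x.
Proof. by case: pvm => _ _ _ + mF tF; exact. Qed.

(** Countable additivity for the constant family of empty sets yields a convergent series with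
    constant terms. *)
Lemma pvm_set0 x : E set0 x = 0.
Proof.
have h := @pvm_bigcup (fun=> set0) x (fun=> measurable0) (ltac:(by move=> i j _ _ [u []])).
have := cvg_series_cvg_0 (cvgP _ h).
by move/(cvg_unique (@norm_hausdorff _ V)) => /(_ _ (cvg_cst (E set0 x))).
Qed.

Lemma pvm_setU B C x : measurable B -> measurable C -> B `&` C = set0 ->
  E (B `|` C) x = E B x + E C x.
Proof.
move=> mB mC BC.
have := @pvm_bigcup (bigcup2 B C) x.
rewrite bigcup2E => h.
have {}h := h (ltac:(by move=> [|[|n]] /=)) (ltac:(by rewrite -trivIset_bigcup2)).
apply: (cvg_unique (@norm_hausdorff _ V)) h _.
apply: cvg_near_cst; exists 2%N => // n /= n2.
rewrite /series /= (big_cat_nat (leq0n 2) n2)/= big_nat_recl// big_nat1.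
rewrite [X in _ + _ + X]big_nat_cond [X in _ + _ + X]big1 ?addr0// => k /andP[/andP[k2 _] _].
by case: k k2 => [|[|k]] //= _; rewrite pvm_set0.
Qed.

Lemma pvm_setC B x : measurable B -> E (~` B) x = x - E B x.
Proof.
move=> mB; apply: (addrI (E B x)); rewrite -pvm_setU ?setICr//; last exact: measurableC.
by rewrite setUCr pvm_setT addrC subrK.
Qed.

(** [diag_measure] may be negative on sets that are not measurable, whereas the structure of
    measures asks for nonnegativity on every set; hence the value 0 there. *)
Definition spectral_mu x B : \bar R :=
  if `[< measurable B >] then diag_measure E x B else 0%E.

Lemma spectral_muE x B : measurable B -> spectral_mu x B = (`|E B x| ^+ 2)%:E.
Proof. by move=> mB; rewrite /spectral_mu asboolT// /diag_measure pvm_norm2. Qed.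

Let spectral_mu0 x : spectral_mu x set0 = 0%E.
Proof. by rewrite spectral_muE// pvm_set0 normr0 expr0n. Qed.

Let spectral_mu_ge0 x B : (0 <= spectral_mu x B)%E.
Proof.
have [mB|nmB] := pselect (measurable B); first by rewrite spectral_muE// lee_fin sqr_ge0.
by rewrite /spectral_mu asboolF.
Qed.

Let spectral_mu_sigma_additive x : semi_sigma_additive (spectral_mu x).
Proof.
move=> F mF tF mUF; rewrite spectral_muE//.
rewrite (_ : (fun n => _) =
  EFin \o (fun n => ip (series (fun k => E (F k) x) n) x)); last first.
  apply/funext => n /=; rewrite /series /= ip_suml -sumEFin.
  by apply: eq_bigr => i _; rewrite spectral_muE// pvm_norm2.
apply/fine_cvgP; split; first exact: nearW.
rewrite /= -pvm_norm2//; apply: cvg_ip; last exact: cvg_cst.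
exact: pvm_bigcup.
Qed.

(** The proof of [projection_valued_measure E] is an argument of the head symbol so that the measure
    structure can be attached to it. *)
Definition spectral_meas (_ : projection_valued_measure E) x := spectral_mu x.

HB.instance Definition _ x := isMeasure.Build _ _ _ (spectral_meas pvm x)
  (spectral_mu0 x) (spectral_mu_ge0 x) (@spectral_mu_sigma_additive x).

Let spectral_mu_fin x : fin_num_fun (spectral_meas pvm x).
Proof. by move=> B mB; rewrite /spectral_meas spectral_muE. Qed.

HB.instance Definition _ x :=
  Measure_isFinite.Build _ _ _ (spectral_meas pvm x) (@spectral_mu_fin x).

Local Notation mu := (spectral_meas pvm).

Lemma spectral_measE x B : measurable B -> mu x B = (`|E B x| ^+ 2)%:E.
Proof. exact: spectral_muE. Qed.

Import HBNNSimple.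

(** The integral looks at a set function only through level sets of simple functions, which are
    measurable; there [diag_measure] and the true measure agree. *)
Lemma integral_diag_measure x (f : R -> \bar R) :
  (\int[diag_measure E x]_l f l = \int[mu x]_l f l)%E.
Proof.
have ed B : measurable B -> diag_measure E x B = mu x B.
  by move=> mB; rewrite spectral_measE// /diag_measure pvm_norm2.
rewrite /integral; congr (ereal_sup _ - ereal_sup _)%E;
  apply/seteqP; split => _ [h hf <-]; exists h => //; rewrite /sintegral;
  apply: eq_fsbigr => r _; congr (_ * _)%E;
  have mh : measurable (h @^-1` [set r]) by [];
  by first [exact: ed | exact/esym/ed].
Qed.

Lemma spectral_formE (f : R -> R) x y : spectral_form E f x y =
  4^-1 * (fine (\int[mu (x + y)%R]_l (f l)%:E)%E
          - fine (\int[mu (x - y)%R]_l (f l)%:E)%E).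
Proof. by rewrite /spectral_form !integral_diag_measure. Qed.

(** If x lies in the range of E(B), the complement of B has measure |x - E(B)x|^2 = 0. *)
Lemma integral_spectral_supp B x (f : R -> \bar R) : measurable B ->
  E B x = x -> measurable_fun setT f ->
  (\int[mu x]_l f l = \int[mu x]_(l in B) f l)%E.
Proof.
move=> mB Bx mf; rewrite [RHS]integral_mkcond; apply: ae_eq_integral => //.
  by apply/(measurable_restrictT f mB); exact: measurable_funS mf.
exists (~` B); split; first exact: measurableC.
- rewrite [LHS]spectral_measE; last exact: measurableC.
  by rewrite pvm_setC// Bx subrr normr0 expr0n.
- move=> l /= h Bl; apply: h => _; rewrite patchE mem_set//.
Qed.

Lemma spectral_mu_total x : mu x setT = (`|x| ^+ 2)%:E.
Proof. by rewrite spectral_measE// pvm_setT. Qed.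

Lemma integral_id_bounds (a c : R) x : E `[a, c[ x = x ->
  a * `|x| ^+ 2 <= fine (\int[mu x]_l l%:E)%E <= c * `|x| ^+ 2.
Proof.
move=> Bx; set B : set R := `[a, c[%classic in Bx.
have mB : measurable (B : set R) by exact: measurable_itv.
rewrite (integral_spectral_supp mB Bx); last exact/measurable_EFinP.
have muB : mu x B = (`|x| ^+ 2)%:E by rewrite spectral_measE// Bx.
have ic k : (mu x).-integrable B (fun=> k%:E).
  exact: (finite_measure_integrable_cst (mu x) k mB).
have il : (mu x).-integrable B (fun l => l%:E).
  apply: measurable_bounded_integrable => //; first by rewrite [ltLHS]muB ltry.
  exists (`|a| + `|c|); split; first exact: num_real.
  move=> M hM l /=; rewrite /B /= in_itv/= => /andP[al lc].
  apply: le_trans (ltW hM); rewrite ler_norml.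
  have := ler_norm a; have := ler_norm (- a); have := ler_norm c; have := ler_norm (- c).
  by rewrite !normrN => ? ? ? ?; apply/andP; split; have := normr_ge0 a; have := normr_ge0 c; lra.
have e k : fine (\int[mu x]_(l in B) (cst k%:E) l)%E = k * `|x| ^+ 2.
  by rewrite integral_cst// [X in (_ * X)%E]muB.
rewrite -!e; apply/andP; split; apply: fine_le;
  rewrite ?integrable_fin_num//; try exact: ic; apply: le_integral => //; try exact: ic;
  move=> l; rewrite inE /B /= in_itv/= lee_fin => /andP[? ?] //; exact: ltW.
Qed.

Lemma integral_sqr_lty (a c : R) x : E `[a, c[ x = x ->
  (\int[mu x]_l (l ^+ 2)%:E < +oo)%E.
Proof.
move=> Bx; set B : set R := `[a, c[%classic in Bx.
have mB : measurable (B : set R) by exact: measurable_itv.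
rewrite (integral_spectral_supp mB Bx); last exact/measurable_EFinP/measurable_funX.
apply: (@le_lt_trans _ _ (\int[mu x]_(l in B) (cst ((`|a| + `|c|) ^+ 2)%:E) l)%E).
  apply: ge0_le_integral => //=.
  - by move=> l _; rewrite lee_fin sqr_ge0.
  - by apply/measurable_EFinP/measurable_funX.
  - move=> l; rewrite /B /= in_itv/= lee_fin => /andP[al lc].
    rewrite -(real_normK (num_real l)) ler_pXn2r ?nnegrE ?addr_ge0//.
    have := ler_norm a; have := ler_norm (- a); have := ler_norm c; have := ler_norm (- c).
    by rewrite !normrN ler_norml => ? ? ? ?; apply/andP; split; have := normr_ge0 a; have := normr_ge0 c; lra.
by rewrite integral_cst// [X in (_ * X)%E]spectral_measE// -EFinM ltry.
Qed.

End spectral_measures.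

Lemma continuous_linear_norm_bound {R : realType} (V W : normedModType R)
    (f : {linear V -> W}) : continuous (f : V -> W) ->
  exists2 M : R, 0 <= M & forall x, `|f x| <= M * `|x|.
Proof.
move=> cf; have /linear_boundedP/pinfty_ex_gt0[M M0 hM] : bounded_near f (nbhs 0).
  exact/continuous_linear_bounded/cf.
by exists M => //; exact: ltW.
Qed.

(** * Strongly continuous semigroups *)

Section semigroups.
Context {R : realType} {V : hilbertType R}.
Variable S : R -> {linear V -> V}.
Hypothesis S_c0 : c0_semigroup S.

(** Otherwise there are times s_n tending to 0 with operator norms exceeding n + 1. Strong
    continuity at 0 makes the operators S(s_n) pointwise bounded, against the uniform boundedness
    principle. *)
Lemma c0_semigroup_bound_near0 : exists d M : R, [/\ 0 < d, 1 <= M &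
  forall s x, 0 <= s <= d -> `|S s x| <= M * `|x|].
Proof.
case: S_c0 => cS S0 _ S_cvg; apply: contrapT => nb.
have /choice[s sP] : forall n : nat, exists sx : R * V,
    0 <= sx.1 <= n.+1%:R^-1 /\ n.+1%:R * `|sx.2| < `|S sx.1 sx.2|.
  move=> n; apply: contrapT => h; apply: nb; exists n.+1%:R^-1, n.+1%:R; split.
  - by rewrite invr_gt0.
  - by rewrite ler1n.
  - by move=> t x ht; rewrite leNgt; apply/negP => hx; apply: h; exists (t, x).
have small (e : R) : 0 < e -> exists N, forall n, (N <= n)%N -> n.+1%:R^-1 < e :> R.
  move=> e0; exists (Num.truncn e^-1) => n Nn.
  rewrite -[e]invrK ltf_pV2 ?posrE ?invr_gt0//.
  by apply: lt_le_trans (truncnS_gt _) _; rewrite ler_nat ltnS.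
pose F := [set (S (s n).1 : V -> V) | n in [set: nat]].
have : uniform_bounded F.
  apply: Banach_Steinhauss => [_ [n _ <-]|x].
    split; last by move=> a x y; rewrite linearP.
    have [|M M0 hM r] := continuous_linear_norm_bound (f := S (s n).1).
      by apply: cS; case/andP: (sP n).1.
    by exists (M * r) => y yr; apply: le_trans (hM y) _; rewrite ler_wpM2l.
  have /cvgrPdist_lt/(_ _ ltr01) := S_cvg x.
  rewrite /at_right nearE /= => -[d /= d0 hd].
  have [N hN] := small _ d0.
  (* The first N times are controlled by the sum; for later ones |S(s_n)x - x| < 1. *)
  exists (`|x| + 1 + \sum_(n < N) `|S (s n).1 x|) => _ [n _ <-].
  have [nN|Nn] := ltnP n N.
    rewrite -[leLHS]add0r lerD ?addr_ge0// (bigD1 (Ordinal nN))//= lerDl.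
    by rewrite sumr_ge0.
  rewrite -[leLHS]addr0 lerD ?sumr_ge0//.
  have [/andP[s0 sn] _] := sP n; move: s0; rewrite le_eqVlt => /predU1P[<-|s0].
    by rewrite S0 lerDl.
  have := hd (s n).1; rewrite /ball_ /= sub0r normrN gtr0_norm// => /(_ _ s0).
  move=> /(_ (le_lt_trans sn (hN _ Nn))) h.
  have -> : S (s n).1 x = x - (x - S (s n).1 x) by rewrite opprB addrC subrK.
  by apply: le_trans (ler_normB _ _) _; rewrite lerD2l ltW.
move=> /(_ 1)[M hM].
have [_ /(_ (Num.truncn M)) nM] := (small, fun n => (sP n).2).
set n := Num.truncn M in nM.
have x0 : 0 < `|(s n).2|.
  rewrite lt_neqAle normr_ge0 andbT eq_sym normr_eq0; apply/negP => /eqP x0.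
  by move: nM; rewrite x0 linear0 normr0 mulr0 ltxx.
have := hM (S (s n).1) (ltac:(by exists n)) (`|(s n).2|^-1 *: (s n).2).
rewrite linearZ !normrZ normfV normr_id mulVf ?gt_eqF// lexx => /(_ isT).
rewrite mulrC ler_pdivrMr// => /(lt_le_trans nM); rewrite ltr_pM2r//.
by move=> /(lt_trans (truncnS_gt _)); rewrite ltxx.
Qed.

Lemma c0_semigroup_bound (T : R) : exists2 M : R, 0 <= M &
  forall s x, 0 <= s <= T -> `|S s x| <= M * `|x|.
Proof.
have [d [M [d0 M1 hM]]] := c0_semigroup_bound_near0.
have M0 : 0 <= M by apply: le_trans M1.
case: S_c0 => _ _ SD _.
have H n s x : 0 <= s <= n.+1%:R * d -> `|S s x| <= M ^+ n.+1 * `|x|.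
  elim: n s => [s|n IH s]; first by rewrite mul1r expr1; exact: hM.
  move=> /andP[s0 sn]; have [sd|ds] := leP s d.
    apply: le_trans (hM s x _) _; first by rewrite s0.
    by rewrite ler_wpM2r// exprS ler_peMr// exprn_ege1.
  have -> : s = d + (s - d) by rewrite addrC subrK.
  rewrite SD ?subr_ge0 ?(ltW ds)//; last exact: ltW.
  apply: le_trans (hM d _ _) _; first by rewrite lexx ltW.
  rewrite exprS -mulrA ler_wpM2l// IH// subr_ge0 (ltW ds)/= lerBlDl.
  by move: sn; rewrite -natr1 mulrDl mul1r addrC.
exists (M ^+ (Num.truncn (T / d)).+1); first by rewrite exprn_ge0.
move=> s x /andP[s0 sT]; apply: H; rewrite s0/=.
rewrite -ler_pdivrMr//; apply: le_trans (ltW (truncnS_gt _)).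
by rewrite ler_pM2r ?invr_gt0.
Qed.

(** Right continuity at 0 propagates through S(t) - S(s) = S(s)(S(t - s) - 1) and the uniform bound
    M. Dividing by M + 1 rather than M keeps the tolerance meaningful when M = 0. *)
Lemma c0_semigroup_unif (T : R) x (e : R) : 0 < e -> exists2 d : R, 0 < d &
  forall s t, 0 <= s <= T -> 0 <= t <= T -> `|s - t| < d -> `|S s x - S t x| <= e.
Proof.
move=> e0; have [M M0 hM] := c0_semigroup_bound T.
case: S_c0 => _ S0 SD S_cvg.
have M1 : 0 < M + 1 by rewrite ltr_wpDl.
have /cvgrPdist_lt/(_ (e / (M + 1)) (divr_gt0 e0 M1)) := S_cvg x.
rewrite /at_right nearE /= => -[d /= d0 hd]; exists d => // s t.
wlog st : s t / s <= t => [H|] sT tT std.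
  have [st|ts] := leP s t; first exact: H.
  by rewrite distrC; apply: H => //; [exact: ltW|rewrite distrC].
move: st; rewrite le_eqVlt => /predU1P[->|st]; first by rewrite subrr normr0 ltW.
have -> : t = s + (t - s) by rewrite addrC subrK.
case/andP: (sT) => s0 _.
rewrite SD ?subr_ge0 ?(ltW st)// -linearB.
apply: le_trans (hM _ _ sT) _.
have := hd (t - s); rewrite /ball_ /= sub0r normrN.
rewrite distrC => /(_ std); rewrite subr_gt0 => /(_ st) /ltW h.
apply: le_trans (_ : _ <= M * (e / (M + 1))) _; first by rewrite ler_wpM2l.
by rewrite mulrCA ler_piMr ?(ltW e0)// ler_pdivrMr// mul1r lerDl.
Qed.

Variables (D : set V) (A : V -> V).
Hypothesis S_gen : generated_by S D A.

(* [S(t) - e^(-at)] is telescoped over N time steps of length [t/N], where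
   [S(t/N) x - e^(-at/N) x] has norm at most [(t/N) (d |x| + o(1))]. *)
Lemma semigroup_exp_approx (T M a d : R) x :
  (forall s y, 0 <= s <= T -> `|S s y| <= M * `|y|) -> 0 <= M ->
  0 <= a -> D x -> `|- A x - a *: x| <= d * `|x| ->
  forall t, 0 <= t <= T -> `|S t x - expR (- a * t) *: x| <= t * M * (d * `|x|).
Proof.
move=> hM M0 a0 Dx Axd t /andP[t0 tT].
case: S_c0 => _ S0 SD _.
move: t0; rewrite le_eqVlt => /predU1P[<-|t0].
  by rewrite S0 mulr0 expR0 scale1r subrr normr0 !mul0r.
have step (h : R) : 0 <= h -> forall n, n%:R * h <= T ->
    `|S (n%:R * h) x - expR (- a * (n%:R * h)) *: x| <=
     n%:R * M * `|S h x - expR (- a * h) *: x|.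
  move=> h0; elim=> [|n IH] nT.
    by rewrite !mul0r S0 mulr0 expR0 scale1r subrr normr0.
  have nhT : n%:R * h <= T.
    by apply: le_trans nT; rewrite ler_wpM2r// ler_nat.
  have nh0 : 0 <= n%:R * h by rewrite mulr_ge0.
  have -> : n.+1%:R * h = n%:R * h + h by rewrite -natr1 mulrDl mul1r.
  rewrite SD// mulrDr expRD.
  have -> : S (n%:R * h) (S h x) - (expR (- a * (n%:R * h)) * expR (- a * h)) *: x =
     S (n%:R * h) (S h x - expR (- a * h) *: x) +
     expR (- a * h) *: (S (n%:R * h) x - expR (- a * (n%:R * h)) *: x).
    by rewrite linearB [S _ (_ *: _)]linearZ; apply: ip_inj => z; rewrite !(ipDl, ipNl, ipZl); ring.
  apply: le_trans (ler_normD _ _) _; rewrite -natr1 mulrDl mul1r mulrDl addrC lerD//.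
    rewrite normrZ; apply: le_trans (IH nhT).
    by rewrite ler_piMl// ger0_norm ?expR_ge0// expR_le1 mulNr oppr_le0 mulr_ge0.
  by apply: hM; rewrite nh0.
apply/ler_addgt0Pr => e e0.
have /S_gen/cvgrPdist_le Sx : D x /\ A x = A x by [].
(* All terms proportional to e in the final estimate have total coefficient K - 1. *)
pose K := t * M * (1 + a ^+ 2 * `|x|) + 1.
have K0 : 0 < K by rewrite ltr_wpDl// !mulr_ge0 ?addr_ge0 ?mulr_ge0 ?sqr_ge0// ltW.
have := Sx _ (divr_gt0 e0 K0); rewrite /at_right nearE /= => -[r /= r0 hr].
(* The step h = t/(n + 1) lies below r, where the difference quotient is accurate, and below e/K,
   which absorbs the second-order term in (ah)^2. *)
pose n := maxn (Num.truncn (t / r)) (Num.truncn (t / (e / K))).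
pose h := t / n.+1%:R.
have h0 : 0 < h by rewrite divr_gt0.
have bd (q : R) : 0 < q -> (Num.truncn (t / q) <= n)%N -> h < q.
  move=> q0 qn; rewrite /h ltr_pdivrMr// mulrC -ltr_pdivrMr//.
  by apply: lt_le_trans (truncnS_gt _) _; rewrite ler_nat ltnS.
have hr' : h < r by apply: bd => //; exact: leq_maxl.
have he : h < e / K by apply: bd; [exact: divr_gt0|exact: leq_maxr].
have nh : n.+1%:R * h = t by rewrite /h mulrC divfK.
clearbody h.
have := step h (ltW h0) n.+1; rewrite nh => /(_ tT) /le_trans; apply.
have Sh : `|A x - h^-1 *: (S h x - x)| <= e / K.
  by apply: hr => //=; rewrite sub0r normrN gtr0_norm.
(* The Taylor bound e^(-y) - 1 + y <= y^2 for y >= 0, a consequence of e^(-y) (1 + y) <= 1. *)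
have e1 : `|expR (- a * h) - 1 + a * h| <= (a * h) ^+ 2.
  have ah : 0 <= a * h by rewrite mulr_ge0// ltW.
  have l1 : 1 - a * h <= expR (- a * h) by rewrite -mulNr expR_ge1Dx.
  have l2 : 1 + a * h <= expR (a * h) by rewrite expR_ge1Dx.
  have l3 : expR (- a * h) * expR (a * h) = 1.
    by rewrite -expRD mulNr addNr expR0.
  have l4 := expR_ge0 (- a * h).
  rewrite ger0_norm; last by lra.
  have l5 : expR (- a * h) * (1 + a * h) <= 1 by rewrite -[leRHS]l3 ler_wpM2l.
  have l6 : expR (- a * h) <= 1 by rewrite expR_le1 mulNr oppr_le0.
  nra.
have e2 : S h x - expR (- a * h) *: x =
   h *: (h^-1 *: (S h x - x) - A x) - h *: (- A x - a *: x)
   - (expR (- a * h) - 1 + a * h) *: x.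
  apply: ip_inj => z; rewrite !(ipDl, ipNl, ipZl); field; rewrite gt_eqF//.
have n1h : n.+1%:R = t / h by rewrite -nh mulfK// gt_eqF.
rewrite n1h e2.
have E : `|h *: (h^-1 *: (S h x - x) - A x) - h *: (- A x - a *: x)
   - (expR (- a * h) - 1 + a * h) *: x| <=
   h * (e / K) + h * (d * `|x|) + h * (e / K) * (a ^+ 2 * `|x|).
  apply: le_trans (ler_normB _ _) _; apply: lerD.
    apply: le_trans (ler_normB _ _) _; rewrite !normrZ (gtr0_norm h0).
    by rewrite lerD// ler_wpM2l ?(ltW h0)// distrC.
  rewrite normrZ mulrA ler_wpM2r//; apply: le_trans e1 _.
  rewrite exprMn mulrC ler_wpM2r ?sqr_ge0// expr2 ler_wpM2l ?(ltW h0)//.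
  exact: ltW.
have {E} := ler_wpM2l (divr_ge0 (mulr_ge0 (ltW t0) M0) (ltW h0)) E.
rewrite [t / h * M]mulrAC => /le_trans; apply.
have -> : t * M / h * (h * (e / K) + h * (d * `|x|) + h * (e / K) * (a ^+ 2 * `|x|)) =
   t * M * (d * `|x|) + e / K * (t * M * (1 + a ^+ 2 * `|x|)).
  by field; rewrite !gt_eqF.
rewrite lerD2l mulrAC ler_pdivrMr// ler_wpM2l ?(ltW e0)//.
by rewrite lerDl.
Qed.

End semigroups.

(** * Spectral blocks of equal length *)

Section spectral_blocks.
Context {R : realType} {V : hilbertType R}.
Variable E : set R -> V -> V.
Hypothesis pvm : projection_valued_measure E.
Local Notation mu := (spectral_meas pvm).
Implicit Types (x y z : V).

Local Notation block d j := `[j%:R * d, j.+1%:R * d[%classic.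

Let itv_cat (d : R) k : 0 < d ->
  `[0, k.+1%:R * d[%classic = `[0, k%:R * d[ `|` block d k :> set R.
Proof.
move=> d0; have kd : 0 <= k%:R * d by rewrite mulr_ge0// ltW.
have kd1 : k%:R * d <= k.+1%:R * d by rewrite ler_pM2r// ler_nat.
apply/seteqP; split => l /=; rewrite !in_itv/=.
  by move=> /andP[l0 lk]; have [lkd|kdl] := ltP l (k%:R * d); [left|right]; rewrite ?l0 ?lk.
by case=> /andP[l1 l2]; apply/andP; split => //; lra.
Qed.

Let itv_disj (d : R) k : `[0, k%:R * d[%classic `&` block d k = set0 :> set R.
Proof.
apply/seteqP; split => l //= -[]; rewrite !in_itv/= => /andP[_ l1] /andP[l2 _].
by move: (lt_le_trans l1 l2); rewrite ltxx.
Qed.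

Lemma pvm_blocks (d : R) k x : 0 < d ->
  E `[0, k%:R * d[ x = \sum_(0 <= j < k) E (block d j) x.
Proof.
move=> d0; elim: k => [|k IH].
  by rewrite mul0r set_itvco0 (pvm_set0 pvm) big_geq.
by rewrite itv_cat// (pvm_setU pvm)// IH big_nat_recr.
Qed.

Lemma sum_block_norm2 (d : R) k x : 0 < d -> E `[0, k%:R * d[ x = x ->
  \sum_(0 <= j < k) `|E (block d j) x| ^+ 2 = `|x| ^+ 2.
Proof.
move=> d0 xk; under eq_bigr do rewrite -(pvm_norm2 pvm)//.
by rewrite -ip_suml -pvm_blocks// xk ipxx.
Qed.

(** Cauchy-Schwarz loses a factor k, which is affordable: an error d |E_j x| per block with d of
    order 1/k has total square of order 1/k. *)
Lemma sum_block_norm (d : R) k x : 0 < d -> E `[0, k%:R * d[ x = x ->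
  (\sum_(0 <= j < k) `|E (block d j) x|) ^+ 2 <= k%:R * `|x| ^+ 2.
Proof.
move=> d0 xk; apply: quadratic_CS => s; rewrite -(sum_block_norm2 d0 xk).
have -> : k%:R = \sum_(0 <= j < k) 1 :> R by rewrite big_const_nat iter_addr addr0 subn0.
rewrite !mulr_sumr -!big_split sumr_ge0//= => j _.
by have := sqr_ge0 (1 + s * `|E (block d j) x|); congr (0 <= _); ring.
Qed.

(** On a block of length d the exponential varies by at most the factor e^(-cd), so a single
    left-endpoint sum bounds the integral from both sides. *)
Lemma integral_exp_blocks (d c : R) k x : 0 < d -> 0 <= c ->
  ((expR (- (c * d)) * \sum_(0 <= j < k) expR (- (c * (j%:R * d))) * `|E (block d j) x| ^+ 2)%:E
    <= \int[mu x]_(l in `[0%R, (k%:R * d)%R[) (expR (- (c * l)))%:E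
    <= (\sum_(0 <= j < k) expR (- (c * (j%:R * d))) * `|E (block d j) x| ^+ 2)%:E)%E.
Proof.
move=> d0 c0.
have mexp B : measurable_fun (B : set R) (fun l : R => (expR (- (c * l)))%:E).
  apply/measurable_EFinP/measurableT_comp => //.
  by apply: measurable_funN; exact: measurable_funM.
elim: k => [|k /andP[IH1 IH2]].
  by rewrite mul0r set_itvco0 integral_set0 big_geq// mulr0 lexx.
rewrite itv_cat// ge0_integral_setU//=;
  try by [move=> l _; rewrite lee_fin expR_ge0 | apply/disj_setPS; rewrite itv_disj].
rewrite big_nat_recr//= mulrDr !EFinD.
have mB : measurable (block d k : set R) by [].
have mudef : mu x (block d k) = (`|E (block d k) x| ^+ 2)%:E by rewrite spectral_measE.
have [lB uB] : ((expR (- (c * d)) * (expR (- (c * (k%:R * d))) * `|E (block d k) x| ^+ 2))%:E <=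
   \int[mu x]_(l in block d k) (expR (- (c * l)))%:E)%E /\
  (\int[mu x]_(l in block d k) (expR (- (c * l)))%:E <=
    (expR (- (c * (k%:R * d))) * `|E (block d k) x| ^+ 2)%:E)%E.
  have cs (r : R) : (\int[mu x]_(l in block d k) (cst r%:E) l = (r * `|E (block d k) x| ^+ 2)%:E)%E.
    by rewrite integral_cst// [X in (_ * X)%E]mudef.
  rewrite mulrA -expRD -!cs; split; apply: ge0_le_integral => //=;
    try (by move=> *; rewrite lee_fin expR_ge0);
    move=> l; rewrite in_itv/= lee_fin ler_expR => /andP[l1 l2].
    rewrite -opprD lerN2 -mulrDr ler_wpM2l// ltW//.
    by move: l2; rewrite -natr1 mulrDl mul1r addrC.
  by rewrite lerN2 ler_wpM2l.
by rewrite !leeD.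
Qed.

Lemma pvm_itv_cvg x : E `[0, +oo[ x = x -> E `[0, n%:R[ x @[n --> \oo] --> x.
Proof.
move=> Ex; rewrite -[X in _ --> X]Ex.
rewrite (_ : (fun n => _) = series (fun j => E (block 1 j) x)); last first.
  by apply/funext => n; rewrite -[n%:R]mulr1 pvm_blocks.
have -> : `[0, +oo[%classic = \bigcup_j block 1 j :> set R.
  apply/seteqP; split => l /=.
    rewrite in_itv/= andbT => l0; exists (Num.truncn l) => //=.
    by rewrite in_itv/= !mulr1 truncn_le ?truncnS_gt// l0.
  move=> [j _] /=; rewrite !in_itv/= andbT => /andP[+ _]; apply: le_trans.
  by rewrite mulr1.
apply: (pvm_bigcup pvm) => //.
apply/trivIsetP => i j _ _; wlog ij : i j / (i < j)%N => [H|] nij.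
  by move: (nij); rewrite neq_ltn => /orP[ij|ji]; [exact: H|rewrite setIC; apply: H; rewrite ?ji// eq_sym].
apply/seteqP; split => l //= -[]; rewrite !in_itv/= !mulr1 => /andP[_ l1] /andP[l2 _].
by have := le_lt_trans l2 l1; rewrite ltr_nat ltnS leqNgt ij.
Qed.

End spectral_blocks.

Section spectral_semigroup.
Context {R : realType} {V : hilbertType R}.
Variables (D : set V) (A : V -> V).
Hypotheses (A_sa : self_adjoint D A) (A_neg : negative_op D A).
Variable S : R -> {linear V -> V}.
Hypotheses (S_c0 : c0_semigroup S) (S_gen : generated_by S D A).
Variable E : set R -> V -> V.
Hypothesis E_spec : spectral_measure D (fun v => - A v) E.
Implicit Types (x y z : V).

Lemma spectral_measure_pvm : projection_valued_measure E.
Proof. by case: E_spec. Qed.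
Local Notation pvm := spectral_measure_pvm.
Local Notation mu := (spectral_meas pvm).

Lemma block_dom (a c : R) x : E `[a, c[ x = x -> D x.
Proof.
case: E_spec => _ dom _ xB; apply/dom; rewrite (integral_diag_measure pvm).
exact: integral_sqr_lty xB.
Qed.

Lemma block_form (a c : R) x : E `[a, c[ x = x ->
  a * `|x| ^+ 2 <= ip (- A x) x <= c * `|x| ^+ 2.
Proof.
move=> xB; have Dx := block_dom xB.
case: E_spec => _ _ ->//; rewrite (spectral_formE pvm) subrr.
(* At y = x the polarized form reads the measures of 2x and of 0: the first gives a factor 4 against
   1/4, the second gives 0. *)
have x2B : E `[a, c[ (x + x) = x + x by rewrite (pvm_linD pvm)// xB.
have x0B : E `[a, c[ 0 = 0 by rewrite (pvm_lin0 pvm).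
have := integral_id_bounds pvm x0B; rewrite normr0 expr0n !mulr0 -eq_le => /eqP <-.
have := integral_id_bounds pvm x2B.
have -> : `|x + x| ^+ 2 = 4 * `|x| ^+ 2.
  by rewrite -mulr2n normrMn; ring.
by rewrite subr0; set q := fine _; move=> /andP[? ?]; apply/andP; split; lra.
Qed.

(** The negative half-line is a countable union of intervals bounded away from 0 and from infinity.
    A vector y in the range of such a spectral projection has <-Ay, y> <= -|y|^2/(n + 1), while
    negativity of A makes the left side nonnegative; so y = 0. *)
Lemma pvm_nonneg x : E `[0, +oo[ x = x.
Proof.
pose B (n : nat) : set R := `[- n.+1%:R, - n.+1%:R^-1[%classic.
have negE : ~` `[0, +oo[%classic = \bigcup_n B n :> set R.
  apply/seteqP; split => l /=; last first.
    move=> [n _]; rewrite /B /= !in_itv/= andbT => /andP[_ l0]; apply/negP.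
    by rewrite -ltNge (lt_trans l0)// oppr_lt0 invr_gt0.
  rewrite in_itv/= andbT => /negP; rewrite -ltNge => l0.
  have nl0 : 0 < - l by rewrite oppr_gt0.
  exists (maxn (Num.truncn (- l)) (Num.truncn (- l)^-1)) => //; rewrite /B /= in_itv/=.
  apply/andP; split.
    rewrite lerNl; apply: le_trans (ltW (truncnS_gt _)) _.
    by rewrite ler_nat ltnS leq_maxl.
  rewrite ltrNr -[ltRHS]invrK ltf_pV2 ?posrE ?invr_gt0//.
  by apply: lt_le_trans (truncnS_gt _) _; rewrite ler_nat ltnS leq_maxr.
have mB n : measurable (B n) by exact: measurable_itv.
have B0 n : mu x (B n) = 0%E.
  rewrite spectral_measE//; set y := E (B n) x.
  have yB : E (B n) y = y by rewrite (pvm_idem pvm).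
  have /andP[_ h1] := block_form yB; have h2 := A_neg (block_dom yB).
  suff : `|y| ^+ 2 = 0 by move=> ->.
  apply/eqP; rewrite eq_le sqr_ge0 andbT.
  have : 0 <= - n.+1%:R^-1 * `|y| ^+ 2.
    by apply: le_trans h1; rewrite ipNl oppr_ge0.
  by rewrite mulNr oppr_ge0 pmulr_rle0// invr_gt0.
have : mu x (~` `[0, +oo[%classic) = 0%E.
  rewrite negE; apply: measure_negligible; first exact: bigcup_measurable.
  by apply: negligible_bigcup => n; exists (B n); split => //; exact: B0.
rewrite spectral_measE; last exact: measurableC.
rewrite (pvm_setC pvm)// => -[/eqP]; rewrite sqrf_eq0 normr_eq0 subr_eq0.
by move=> /eqP <-.
Qed.

(** The definition of the spectral measure provides only the form of -A, not |(-A - a)x|^2. The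
    vector w = -Ax - ax is therefore tested against y in D: it is orthogonal to the part of y
    outside the block, and inside the block the form of -A - a lies between 0 and d, so
    Cauchy-Schwarz applies. Density of D recovers the norm of w. *)
Lemma block_approx (a d : R) x : 0 <= d -> E `[a, a + d[ x = x ->
  `|- A x - a *: x| <= d * `|x|.
Proof.
move=> d0 xB; have Dx := block_dom xB; set B : set R := `[a, a + d[%classic in xB.
have mB : measurable (B : set R) by exact: measurable_itv.
case: A_sa => dD linA symA.
have bnd z : E B z = z -> 0 <= ip (- A z - a *: z) z <= d * `|z| ^+ 2.
  move=> zB; have /andP[h1 h2] := block_form zB.
  by rewrite ipBl ipZl ipxx; apply/andP; split; lra.
set w := - A x - a *: x.
have wy y : D y -> `|ip w y| <= d * `|x| * `|y|.
  move=> Dy; pose y1 := E B y; pose y2 := y - y1.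
  have y1B : E B y1 = y1 by rewrite (pvm_idem pvm).
  have y2B : E B y2 = 0.
    by rewrite /y2 (pvm_linD pvm)// (pvm_linN pvm)// (pvm_idem pvm)// subrr.
  have Dy1 := block_dom y1B.
  have Dy2 : D y2.
    by have [+ _] := linA (-1) y1 y Dy1 Dy; rewrite scaleN1r addrC.
  (* Polarization gives a difference of integrals against the measures of x + y2 and x - y2. These
     coincide: <E(C)x, E(C)y2> = 0, since x is in the range of E(B) and y2 in its kernel. *)
  have wy2 : ip w y2 = 0.
    rewrite ipBl ipZl -[in X in _ * ip X _]xB (pvm_sym pvm)// y2B ip0r mulr0 subr0.
    case: E_spec => _ _ ->//; rewrite (spectral_formE pvm).
    rewrite (eq_measure_integral (mu (x - y2))) ?subrr ?mulr0// => C mC _.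
    rewrite [LHS]spectral_measE// [RHS]spectral_measE// (pvm_linD pvm)// [E C (x - y2)](pvm_linD pvm)//.
    rewrite (pvm_linN pvm)// norm2D norm2B.
    suff -> : ip (E C x) (E C y2) = 0 by rewrite !mulr0 addr0 subr0.
    rewrite -(pvm_sym pvm)// (pvm_idem pvm)// -xB (pvm_setI pvm)// setIC -(pvm_setI pvm)//.
    by rewrite (pvm_sym pvm)// y2B ip0r.
  have -> : ip w y = ip w y1 by rewrite -[y](subrK y1) ipDr wy2 add0r.
  have y1y : `|y1| <= `|y|.
    rewrite -(@ler_pXn2r _ 2)// ?nnegrE// -(pvm_norm2 pvm)//.
    apply: le_trans (ler_norm _) _; apply: le_trans (cauchy_schwarz _ _) _.
    rewrite expr2 ler_wpM2r//.
    have := cauchy_schwarz y1 y; rewrite (pvm_norm2 pvm)// ger0_norm ?sqr_ge0//.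
    rewrite -/y1; have [y10|y10] := eqVneq y1 0; first by rewrite y10 normr0.
    by rewrite expr2 ler_pM2l// normr_gt0.
  apply: le_trans (_ : d * `|x| * `|y1| <= _); last by rewrite ler_wpM2l// mulr_ge0.
  rewrite -(@ler_pXn2r _ 2)// ?nnegrE ?mulr_ge0// real_normK ?num_real//.
  have CS : ip w y1 ^+ 2 <= ip w x * ip (- A y1 - a *: y1) y1.
    apply: quadratic_CS => s.
    have zB : E B (s *: y1 + x) = s *: y1 + x by rewrite (pvm_lin pvm)// y1B xB.
    have [_ Az] := linA s y1 x Dy1 Dx.
    have sym : ip (A y1) x = ip (A x) y1.
      by rewrite (ipC (A x)) ((iffLR (symA x (A x))) (conj Dx erefl) y1 Dy1).
    have /andP[+ _] := bnd _ zB; rewrite Az.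
    rewrite !(ipDl, ipNl, ipZl, ipDr, ipNr, ipZr) (ipC y1 x) sym.
    by congr (0 <= _); ring.
  apply: le_trans CS _.
  have /andP[p1 p2] := bnd _ xB; have /andP[p3 p4] := bnd _ y1B.
  apply: le_trans (ler_pM p1 p3 p2 p4) _.
  by rewrite le_eqVlt; apply/orP; left; apply/eqP; ring.
have [->|w0] := eqVneq w 0; first by rewrite normr0 mulr_ge0.
have {}w0 : 0 < `|w| by rewrite normr_gt0.
suff : `|w| ^+ 2 <= d * `|x| * `|w| by rewrite expr2 ler_pM2r.
apply/ler_addgt0Pr => e e0.
(* w itself may lie outside D; it is replaced by some y in D within e/K of it, at a cost of at most
   (d|x| + |w|) e/K. *)
pose K := d * `|x| + `|w| + 1.
have K0 : 0 < K by rewrite ltr_wpDl// addr_ge0// mulr_ge0.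
have [y [yw Dy]] : (ball w (e / K) `&` D) !=set0.
  apply: dD; first by exists w; apply: ballxx; exact: divr_gt0.
  exact: ball_open.
move: yw; rewrite -ball_normE /= => yw.
have -> : `|w| ^+ 2 = ip w y + ip w (w - y).
  by rewrite -ipDr (addrC y) subrK ipxx.
have q1 := le_trans (ler_norm _) (wy y Dy).
have q2 := le_trans (ler_norm _) (cauchy_schwarz w (w - y)).
have q3 : `|y| <= `|w| + e / K.
  have -> : y = w - (w - y) by rewrite opprB addrC subrK.
  by apply: le_trans (ler_normB _ _) _; rewrite lerD2l ltW.
have q4 : K * (e / K) = e by rewrite mulrC divfK// gt_eqF.
have q6 : d * `|x| * `|y| <= d * `|x| * (`|w| + e / K) by rewrite ler_wpM2l// mulr_ge0.
have q7 : `|w| * `|w - y| <= `|w| * (e / K) by rewrite ler_wpM2l// ltW.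
have q8 : 0 < e / K by rewrite divr_gt0.
rewrite /K in q4; set u := e / _ in q3 q4 q6 q7 q8.
nra.
Qed.

(* On the range of [E `[a, a + d[], [S(t)] is [e^(-at)] up to [O(d)]; the blocks
   are orthogonal, so the errors add up in the square norm and vanish with [d]. *)
Lemma semigroup_block_ip (m : nat) x (t s : R) : 0 <= t -> 0 <= s ->
  E `[0, m.+1%:R[ x = x ->
  ((ip (S t x) (S s x))%:E =
   \int[mu x]_(l in `[0%R, m.+1%:R[) (expR (- ((t + s) * l)))%:E)%E.
Proof.
move=> t0 s0 xm.
pose T := t + s.
have tT : 0 <= t <= T by rewrite t0 lerDl.
have sT : 0 <= s <= T by rewrite s0 lerDr.
have [M M0 hM] := c0_semigroup_bound S_c0 T.
pose d N : R := m.+1%:R / N.+1%:R.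
have d0 N : 0 < d N by rewrite divr_gt0.
have dN N : N.+1%:R * d N = m.+1%:R by rewrite /d mulrC divfK.
have xd N : E `[0, N.+1%:R * d N[ x = x by rewrite dN.
pose B N j : set R := `[j%:R * d N, j.+1%:R * d N[%classic.
have mB N j : measurable (B N j) by exact: measurable_itv.
pose Y (u : R) N := \sum_(0 <= j < N.+1) expR (- (u * (j%:R * d N))) *: E (B N j) x.
have xB N : x = \sum_(0 <= j < N.+1) E (B N j) x.
  by rewrite -(pvm_blocks pvm)// xd.
have cY u : 0 <= u <= T -> Y u N @[N --> \oo] --> S u x.
  move=> uT; have u0 : 0 <= u by case/andP: uT.
  have bd N : `|S u x - Y u N| <= u * M * (d N * \sum_(0 <= j < N.+1) `|E (B N j) x|).
    rewrite {1}(xB N) linear_sum -sumrB.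
    apply: le_trans (ler_norm_sum _ _ _) _.
    rewrite !mulr_sumr; apply: ler_sum => j _.
    have yB : E (B N j) (E (B N j) x) = E (B N j) x by rewrite (pvm_idem pvm).
    rewrite mulrC -mulNr.
    have yB' : E `[j%:R * d N, j%:R * d N + d N[ (E (B N j) x) = E (B N j) x.
      by move: yB; rewrite {1}/B -natr1 mulrDl mul1r.
    have jd0 : 0 <= j%:R * d N by rewrite mulr_ge0// ltW.
    apply: (semigroup_exp_approx S_c0 S_gen hM M0 jd0 (block_dom yB') _ uT).
    by apply: block_approx; [exact: ltW|].
  pose K := (u * M) ^+ 2 * (m.+1%:R ^+ 2 * `|x| ^+ 2).
  have bd2 N : `|S u x - Y u N| ^+ 2 <= K * N.+1%:R^-1.
    apply: le_trans (_ : _ <= (u * M * (d N * \sum_(0 <= j < N.+1) `|E (B N j) x|)) ^+ 2) _.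
      rewrite ler_pXn2r ?nnegrE//; apply: le_trans (bd N) => //.
    have -> : K / N.+1%:R = (u * M) ^+ 2 * (d N ^+ 2 * (N.+1%:R * `|x| ^+ 2)).
      by rewrite /K /d; field.
    rewrite exprMn [(d N * _) ^+ 2]exprMn.
    by do 2 (rewrite ler_wpM2l ?sqr_ge0//); exact: (sum_block_norm pvm).
  apply/cvgrPdist_le => e e0.
  have : K * N.+1%:R^-1 @[N --> \oo] --> K * 0 by apply: cvgMr; exact: cvg_harmonic.
  rewrite mulr0 => /cvgrPdist_le/(_ (e ^+ 2) (exprn_gt0 _ e0)).
  apply: filterS => N; rewrite sub0r normrN => h.
  rewrite -(@ler_pXn2r _ 2)// ?nnegrE//; last exact: ltW.
  by apply: le_trans (bd2 N) _; apply: le_trans h; exact: ler_norm.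
pose Sg N := \sum_(0 <= j < N.+1) expR (- (T * (j%:R * d N))) * `|E (B N j) x| ^+ 2.
have cS : Sg N @[N --> \oo] --> ip (S t x) (S s x).
  have -> : Sg = fun N => ip (Y t N) (Y s N).
    apply/funext => N; rewrite /Sg /Y ip_suml big_seq [RHS]big_seq.
    apply: eq_bigr => j jN; rewrite ipZl ip_sumr (bigD1_seq j) ?iota_uniq//=.
    rewrite big1 ?addr0.
      by rewrite ipZr ipxx [RHS]mulrA -expRD /T mulrDl opprD.
    move=> k kj; rewrite ipZr -(pvm_sym pvm)// (pvm_setI pvm)//.
    rewrite (_ : _ `&` _ = set0) ?(pvm_set0 pvm) ?ip0l ?mulr0//.
    apply/seteqP; split => l //= -[]; rewrite /B /= !in_itv/=.
    move=> /andP[l1 l2] /andP[l3 l4].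
    have := le_lt_trans l1 l4; have := le_lt_trans l3 l2.
    rewrite !ltr_pM2r// !ltr_nat !ltnS => kj1 kj2.
    by move: kj; rewrite eqn_leq kj1 kj2.
  by apply: cvg_ip; exact: cY.
have T0 : 0 <= T by rewrite addr_ge0.
(* The sums [Sg] converge to the inner product and enclose the integral up to the factor e^(-Td),
   which tends to 1. *)
have sw N := integral_exp_blocks pvm N.+1 x (d0 N) T0.
rewrite -/T; set I := (\int[mu x]_(l in _) _)%E.
have {}sw N : ((expR (- (T * d N)) * Sg N)%:E <= I <= (Sg N)%:E)%E by have := sw N; rewrite dN.
have /andP[i1 i2] := sw 0%N.
have Ifin : I \is a fin_num.
  by rewrite fin_numE -ltNye -ltey (lt_le_trans (ltNyr _) i1)//= (le_lt_trans i2 (ltry _)).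
rewrite -(fineK Ifin); congr EFin; apply/eqP; rewrite eq_le; apply/andP; split.
  have c1 : expR (- (T * d N)) * Sg N @[N --> \oo] --> 1 * ip (S t x) (S s x).
    apply: cvgM => //; rewrite -expR0 -[X in expR X]oppr0 -[X in - X](mulr0 T).
    apply: continuous_cvg; first exact: continuous_expR.
    apply: cvgN; apply: cvgMr; rewrite -[X in _ --> X](mulr0 m.+1%:R).
    by apply: cvgMr; exact: cvg_harmonic.
  rewrite -[leLHS]mul1r; apply: ler_cvg_to c1 (cvg_cst _) _; apply: nearW => N.
  by have /andP[+ _] := sw N; rewrite -{1}(fineK Ifin) lee_fin.
apply: ler_cvg_to (cvg_cst _) cS _; apply: nearW => N.
by have /andP[_ +] := sw N; rewrite -{1}(fineK Ifin) lee_fin.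
Qed.

(** The cut-offs E([0, n + 1[)x converge to x because the spectrum of -A is nonnegative; the inner
    products follow by continuity of S, the integrals by monotone convergence. *)
Lemma semigroup_ip x (t s : R) : 0 <= t -> 0 <= s ->
  ((ip (S t x) (S s x))%:E =
   \int[mu x]_(l in `[0%R, +oo[) (expR (- ((t + s) * l)))%:E)%E.
Proof.
move=> t0 s0.
pose f (l : R) := (expR (- ((t + s) * l)))%:E.
have mf B : measurable_fun (B : set R) f.
  apply/measurable_EFinP/measurableT_comp => //.
  by apply: measurable_funN; exact: measurable_funM.
pose xn n := E `[0, n.+1%:R[ x.
have cx : xn n @[n --> \oo] --> x.
  have := pvm_itv_cvg pvm (pvm_nonneg x).
  by rewrite -(cvg_shiftS (fun n => E `[0, n%:R[ x)).
have St u : 0 <= u -> S u (xn n) @[n --> \oo] --> S u x.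
  by move=> u0; case: S_c0 => cS _ _ _; apply: continuous_cvg cx; exact: cS.
have c1 : (ip (S t (xn n)) (S s (xn n)))%:E @[n --> \oo] --> (ip (S t x) (S s x))%:E.
  apply/fine_cvgP; split; first exact: nearW.
  by apply: cvg_ip; exact: St.
apply: (cvg_unique (@ereal_hausdorff R)) c1 _.
(* On subsets of [0, n + 1[ the measures of the cut-off vector and of x agree, so cutting the vector
   amounts to restricting the domain of integration. *)
rewrite (_ : (fun n => _) = fun n => (\int[mu x]_(l in `[0%R, n.+1%:R[) f l)%E); last first.
  apply/funext => n; rewrite (@semigroup_block_ip n)//; last by rewrite /xn (pvm_idem pvm).
  apply: eq_measure_integral => C mC Cn.
  by rewrite [LHS]spectral_measE// [RHS]spectral_measE// /xn (pvm_setI pvm)// (setIidl Cn).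
have -> : `[0%R, +oo[%classic = \bigcup_n `[0%R, n.+1%:R[%classic :> set R.
  apply/seteqP; split => l /=.
    rewrite in_itv/= andbT => l0; exists (Num.truncn l) => //=.
    by rewrite in_itv/= l0 truncnS_gt.
  by move=> [n _] /=; rewrite !in_itv/= andbT => /andP[].
apply: ge0_nondecreasing_set_cvg_integral => //.
- by apply/nondecreasing_seqP => n; apply/subsetPset => l /=; rewrite !in_itv/= => /andP[-> /lt_trans->]//; rewrite ltr_nat.
- by move=> n l _; rewrite lee_fin expR_ge0.
Qed.

End spectral_semigroup.

(** * Bounded functional calculus and the sandwiched operator *)

Section spectral_calculus.
Context {R : realType} {V : hilbertType R}.
Variable E : set R -> V -> V.
Hypothesis pvm : projection_valued_measure E.
Local Notation mu := (spectral_meas pvm).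
Implicit Types (x y z : V).

Import HBNNSimple.

Lemma spectral_nnsfun (h : {nnsfun R >-> R}) : exists L : V -> V,
  [/\ forall (a : R) x y, L (a *: x + y) = a *: L x + L y,
      forall x y, ip (L x) y = ip x (L y) &
      forall x, (\int[mu x]_l (h l)%:E = (ip (L x) x)%:E)%E].
Proof.
have mh r : measurable (h @^-1` [set r]) by [].
exists (fun x => \sum_(r <- finmap.enum_fset (fset_set (range h))) r *: E (h @^-1` [set r]) x); split.
- move=> a x y; rewrite scaler_sumr -big_split; apply: eq_bigr => r _ /=.
  by rewrite (pvm_lin pvm)// scalerDr !scalerA mulrC.
- move=> x y; rewrite ip_suml ip_sumr; apply: eq_bigr => r _.
  by rewrite ipZl ipZr (pvm_sym pvm).
- move=> x; rewrite integralT_nnsfun sintegralE fsbig_finite//= ip_suml -sumEFin.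
  apply: eq_bigr => r _; rewrite ipZl (pvm_norm2 pvm)// EFinM; congr (_ * _)%E.
  by rewrite [LHS]spectral_measE.
Qed.

Variable f : R -> R.
Hypotheses (mf : measurable_fun setT f) (f01 : forall l, 0 <= f l <= 1).
Local Notation B := (spectral_form E f).

Let Q x : \bar R := (\int[mu x]_l (f l)%:E)%E.

Let Q_ge0 x : (0 <= Q x)%E.
Proof. by apply: integral_ge0 => l _; rewrite lee_fin; case/andP: (f01 l). Qed.

Let Q_le x : (Q x <= (`|x| ^+ 2)%:E)%E.
Proof.
rewrite -(spectral_mu_total pvm) -[leRHS]mul1e -integral_cst//.
apply: ge0_le_integral => //=.
- by move=> l _; rewrite lee_fin; case/andP: (f01 l).
- exact/measurable_EFinP.
- by move=> l _; rewrite lee_fin; case/andP: (f01 l).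
Qed.

Lemma spectral_integral_fin x : Q x \is a fin_num.
Proof. by rewrite ge0_fin_numE// (le_lt_trans (Q_le x))// ltry. Qed.

(** The form is assembled from integrals against two different measures, which hides its
    bilinearity. For simple functions it comes from an explicit symmetric combination of
    projections; monotone approximation of f then exhibits it as a limit of symmetric bilinear
    forms. *)
Lemma spectral_form_approx : exists L : nat -> V -> V,
  [/\ forall n (a : R) x y, L n (a *: x + y) = a *: L n x + L n y,
      forall n x y, ip (L n x) y = ip x (L n y),
      forall x, ip (L n x) x @[n --> \oo] --> fine (Q x) &
      forall x y, ip (L n x) y @[n --> \oo] --> B x y].
Proof.
have mEf : measurable_fun setT (fun l => (f l)%:E) by exact/measurable_EFinP.
pose g := nnsfun_approx measurableT mEf.
have /choice[L hL] := fun n => spectral_nnsfun (g n).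
have f0 l : setT l -> (0 <= (f l)%:E)%E by move=> _; rewrite lee_fin; case/andP: (f01 l).
have cL x : ip (L n x) x @[n --> \oo] --> fine (Q x).
  have : (\int[mu x]_l (g n l)%:E)%E @[n --> \oo] --> Q x.
    rewrite /Q (_ : (fun l => (f l)%:E) = fun l => limn (fun n => (g n l)%:E)); last first.
      apply/funext => l; apply/esym/cvg_lim => //.
      exact: (cvg_nnsfun_approx measurableT mEf f0).
    apply: cvg_monotone_convergence => //.
    - by move=> n; apply/measurable_EFinP.
    - by move=> n l _; rewrite lee_fin.
    - by move=> l _ m n mn; rewrite lee_fin; exact/lefP/nd_nnsfun_approx.
  rewrite -(fineK (spectral_integral_fin x)) => /fine_cvgP[_].
  rewrite (_ : fine \o _ = fun n => ip (L n x) x)//.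
  by apply/funext => n /=; have [_ _ ->] := hL n.
exists L; split => //.
- by move=> n; have [] := hL n.
- by move=> n; have [] := hL n.
- move=> x y; rewrite (_ : (fun n => _) =
    fun n => 4^-1 * (ip (L n (x + y)) (x + y) - ip (L n (x - y)) (x - y))).
    rewrite (spectral_formE pvm); apply: cvgMr.
    by apply: cvgB; exact: cL.
  apply/funext => n; have [lin sym _] := hL n.
  have -> : x + y = 1 *: x + y by rewrite scale1r.
  have -> : x - y = (-1) *: y + x by rewrite scaleN1r addrC.
  by rewrite !lin !(ipDl, ipDr, ipZl, ipZr) (sym y x) (ipC y (L n x)); field.
Qed.

Lemma spectral_formC x y : B x y = B y x.
Proof.
have [L [lin sym cL cB]] := spectral_form_approx.
apply: (cvg_unique (@Rhausdorff R)) (cB x y) _.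
rewrite (_ : (fun n => _) = fun n => ip (L n y) x); first exact: cB.
by apply/funext => n; rewrite sym ipC.
Qed.

Lemma spectral_form_lin (a : R) x y z : B (a *: x + y) z = a * B x z + B y z.
Proof.
have [L [lin sym cL cB]] := spectral_form_approx.
apply: (cvg_unique (@Rhausdorff R)) (cB _ z) _.
rewrite (_ : (fun n => _) = fun n => a * ip (L n x) z + ip (L n y) z).
  by apply: cvgD => //; exact: cvgMr.
by apply/funext => n; rewrite lin ipDl ipZl.
Qed.

Lemma spectral_form_diag x : B x x = fine (Q x).
Proof.
have [L [lin sym cL cB]] := spectral_form_approx.
exact: (cvg_unique (@Rhausdorff R)) (cB x x) (cL x).
Qed.

Lemma spectral_form_bound x y : `|B x y| <= `|x| * `|y|.
Proof.
have BD u v w : B (u + v) w = B u w + B v w.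
  by rewrite -[u]scale1r spectral_form_lin mul1r scale1r.
have B0 w : B 0 w = 0 by have := BD 0 0 w; rewrite addr0; lra.
have BZ (a : R) v w : B (a *: v) w = a * B v w.
  by rewrite -[a *: v]addr0 spectral_form_lin B0 addr0.
have p z : 0 <= B z z <= `|z| ^+ 2.
  rewrite spectral_form_diag -!lee_fin fineK ?spectral_integral_fin//.
  by rewrite Q_ge0 Q_le.
rewrite -(@ler_pXn2r _ 2)// ?nnegrE ?mulr_ge0// real_normK ?num_real// [leRHS]exprMn.
apply: le_trans (_ : _ <= B x x * B y y) _; last first.
  by have /andP[? ?] := p x; have /andP[? ?] := p y; exact: ler_pM.
apply: quadratic_CS => s; have /andP[+ _] := p (x + s *: y).
rewrite BD BZ (spectral_formC x (x + _)) (spectral_formC y (x + _)).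
rewrite !BD !BZ (spectral_formC y x).
by congr (0 <= _); ring.
Qed.

(** The bound on the form and the Riesz representation show that the set in the definition is
    inhabited, so [xget] returns the representing vector and not its default 0. *)
Lemma spectral_integral_ip x y : ip (spectral_integral E f x) y = B x y.
Proof.
have [u hu] : exists u, forall y, B x y = ip u y.
  apply: (@riesz _ _ _ `|x|); last exact: spectral_form_bound.
  move=> a u v; rewrite !(spectral_formC x).
  exact: spectral_form_lin.
rewrite /spectral_integral; move: y.
by apply: (xgetPex 0 (P := [set v | forall y, ip v y = B x y])); exists u.
Qed.

End spectral_calculus.

Lemma adjoint_ip {R : realType} {U V : hilbertType R} (L : {linear U -> V}) v w :
  continuous (L : U -> V) -> ip (adjoint L v) w = ip (L w) v.
Proof.
move=> /continuous_linear_norm_bound[M M0 hM].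
have [u hu] : exists u, forall w, ip (L w) v = ip u w.
  apply: (@riesz _ _ _ (M * `|v|)) => [a x y|x].
    by rewrite linearP ipDl ipZl.
  apply: le_trans (cauchy_schwarz _ _) _.
  by rewrite mulrAC ler_wpM2r.
apply/esym; rewrite ipC [RHS]ipC [LHS]ipC; move: w; rewrite /adjoint.
have := xgetPex 0 (P := [set u | forall w, ip (L w) v = ip w u]).
by apply; exists u => w; rewrite hu ipC.
Qed.

Section sandwiched_operator.
Context {R : realType} {U V : hilbertType R}.
Variable E : set R -> V -> V.
Hypothesis pvm : projection_valued_measure E.
Variable Phi : {linear U -> V}.
Hypothesis bounded_Phi : continuous (Phi : U -> V).
Variable f : R -> R.
Hypotheses (mf : measurable_fun setT f) (f01 : forall l, 0 <= f l <= 1).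
Let T0 u := adjoint Phi (spectral_integral E f (Phi u)).

Lemma sandwich_ip u w : ip (T0 u) w = spectral_form E f (Phi u) (Phi w).
Proof. by rewrite /T0 adjoint_ip// ipC (spectral_integral_ip pvm). Qed.

Lemma sandwich_diag u :
  ((ip (T0 u) u)%:E = \int[spectral_meas pvm (Phi u)]_l (f l)%:E)%E.
Proof.
rewrite sandwich_ip (spectral_form_diag pvm)// fineK//.
exact: spectral_integral_fin.
Qed.

Lemma sandwich_psd : psd_op T0.
Proof.
split.
- move=> a x y; apply: ip_inj => z.
  by rewrite ipDl ipZl !sandwich_ip linearP (spectral_form_lin pvm).
- by move=> x y; rewrite (ipC x) !sandwich_ip (spectral_formC pvm).
- move=> x; rewrite -lee_fin sandwich_diag.
  by apply: integral_ge0 => l _; rewrite lee_fin; case/andP: (f01 l).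
Qed.

End sandwiched_operator.

(** * Fractional kernels *)

Section calculus.
Context {R : realType}.
Notation mu := (@lebesgue_measure R).
Implicit Types (F f G : R -> R) (a b c e x : R).

Lemma is_derive_continuous F x (l : R) : is_derive x 1 F l -> {for x, continuous F}.
Proof.
by move=> h; apply: differentiable_continuous; apply/derivable1_diffP; case: h.
Qed.

Lemma continuous_powR (p x : R) : 0 < x -> {for x, continuous (fun y : R => y `^ p)}.
Proof. by move=> x0; apply: is_derive_continuous; exact: is_derive1_powR. Qed.

Section primitive.
Variables (F f : R -> R) (c e : R).
Hypothesis dF : forall x, c < x < e -> is_derive x 1 F (f x).
Hypothesis cf : forall x, c < x < e -> {for x, continuous f}.

Lemma derive1_primitive x : c < x < e -> F^`()%classic x = f x.
Proof. by move=> /dF h; rewrite derive1E derive_val. Qed.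

Lemma continuous_derive1_primitive x : c < x < e -> {for x, continuous F^`()%classic}.
Proof.
move=> xce; rewrite /prop_for /continuous_at derive1_primitive//.
apply: cvg_trans (cf xce); apply: near_eq_cvg.
have : x \in `]c, e[ by rewrite in_itv.
move=> /near_in_itvoo; apply: filterS => y; rewrite in_itv/= => yce.
by rewrite derive1_primitive.
Qed.

Variables a b : R.
Hypotheses (ca : c < a) (ab : a < b) (be : b < e).

Let ab_ce x : a <= x <= b -> c < x < e.
Proof.
by move=> /andP[ax xb]; rewrite (lt_le_trans ca ax) (le_lt_trans xb be).
Qed.

Lemma primitive_LRcontinuous : derivable_oo_LRcontinuous F a b.
Proof.
split.
- move=> x; rewrite in_itv/= => /andP[? ?].
  by have /dF[] : c < x < e by apply: ab_ce; apply/andP; split; exact: ltW.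
- apply: cvg_at_right_filter; apply: is_derive_continuous.
  by apply: dF; apply: ab_ce; rewrite lexx ltW.
- apply: cvg_at_left_filter; apply: is_derive_continuous.
  by apply: dF; apply: ab_ce; rewrite lexx ltW.
Qed.

Lemma integral_primitive :
  (\int[mu]_(x in `[a, b]) (f x)%:E = (F b)%:E - (F a)%:E)%E.
Proof.
apply: continuous_FTC2 => //.
- by apply: continuous_in_subspaceT => x; rewrite inE/= in_itv/= => /ab_ce/cf.
- exact: primitive_LRcontinuous.
- move=> x; rewrite in_itv/= => /andP[? ?]; rewrite derive1_primitive//.
  by apply: ab_ce; apply/andP; split; exact: ltW.
Qed.

Lemma integral_substitution G :
  {in `[a, b] &, {homo F : x y / (x < y)%R}} ->
  (forall x, F a <= x <= F b -> {for x, continuous G}) ->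
  (\int[mu]_(x in `[F a, F b]) (G x)%:E = \int[mu]_(x in `[a, b]) (G (F x) * f x)%:E)%E.
Proof.
move=> incF cG; rewrite integration_by_substitution_increasing//.
- apply: eq_integral => x; rewrite inE/= in_itv/= => /ab_ce xce.
  by rewrite -(derive1_primitive xce).
- exact: ltW.
- move=> x; rewrite in_itv/= => /andP[? ?]; apply: continuous_derive1_primitive.
  by apply: ab_ce; apply/andP; split; exact: ltW.
- apply/cvg_ex; exists (F^`()%classic a); apply: cvg_at_right_filter.
  by apply: continuous_derive1_primitive; apply: ab_ce; rewrite lexx ltW.
- apply/cvg_ex; exists (F^`()%classic b); apply: cvg_at_left_filter.
  by apply: continuous_derive1_primitive; apply: ab_ce; rewrite lexx ltW.
- exact: primitive_LRcontinuous.
- by apply: continuous_in_subspaceT => x; rewrite inE/= in_itv/= => /cG.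
Qed.

End primitive.

(** The divisor starts at 3 so that the left endpoint is strictly below the right one from the first
    index on. *)
Definition exhaust_l (c e : R) (n : nat) : R := c + (e - c) / n.+3%:R.

Definition exhaust_r (c e : R) (n : nat) : R := e - (e - c) / n.+3%:R.

Lemma exhaust_bounds c e n : c < e ->
  [/\ c < (exhaust_l c e n), (exhaust_l c e n) < (exhaust_r c e n)
    & (exhaust_r c e n) < e].
Proof.
move=> ce; have d0 : 0 < (e - c) / n.+3%:R by rewrite divr_gt0// subr_gt0.
have d1 : (e - c) / n.+3%:R * 3 <= e - c.
  rewrite -[leRHS](divfK (x := n.+3%:R))// ler_wpM2l ?(ltW d0)//.
  by rewrite ler_nat.
rewrite /exhaust_l /exhaust_r; set d := (e - c) / _ in d0 d1 *; split; lra.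
Qed.

Lemma exhaust_mono c e m n : c < e -> (m <= n)%N ->
  (exhaust_l c e n) <= (exhaust_l c e m) /\ (exhaust_r c e m) <= (exhaust_r c e n).
Proof.
move=> ce mn; rewrite /exhaust_l /exhaust_r.
have : (e - c) / n.+3%:R <= (e - c) / m.+3%:R.
  by rewrite ler_wpM2l ?subr_ge0 ?(ltW ce)// lef_pV2 ?posrE// ler_nat.
by move=> h; split; [rewrite lerD2l|rewrite lerD2l lerN2].
Qed.

Lemma exhaust_cover c e x : c < x < e -> exists n, (exhaust_l c e n) <= x <= (exhaust_r c e n).
Proof.
move=> /andP[cx xe]; have ce : c < e by lra.
pose q := Num.min (x - c) (e - x).
have q0 : 0 < q by rewrite lt_min !subr_gt0 cx.
exists (Num.truncn ((e - c) / q)).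
have h : (e - c) / (Num.truncn ((e - c) / q)).+3%:R <= q.
  rewrite ler_pdivrMr// mulrC -ler_pdivrMr//.
  by apply: le_trans (ltW (truncnS_gt _)) _; rewrite ler_nat leqW// leqW.
move: h; rewrite le_min => /andP[h1 h2]; rewrite /exhaust_l /exhaust_r.
by apply/andP; split; move: h1 h2; set d := (e - c) / _ => h1 h2; lra.
Qed.

Lemma integral_exhaust c e f : c < e -> (forall x, c < x < e -> 0 <= f x) ->
  measurable_fun `]c, e[ f ->
  (\int[mu]_(x in `[(exhaust_l c e n), (exhaust_r c e n)]) (f x)%:E @[n --> \oo] -->
   \int[mu]_(x in `]c, e[) (f x)%:E)%E.
Proof.
move=> ce f0 mf.
have E : `]c, e[%classic = \bigcup_n `[(exhaust_l c e n), (exhaust_r c e n)]%classic :> set R.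
  apply/seteqP; split => x /=.
    by rewrite in_itv/= => /exhaust_cover[n xn]; exists n => //=; rewrite in_itv.
  move=> [n _] /=; rewrite !in_itv/= => /andP[? ?].
  by have [? ? ?] := exhaust_bounds n ce; apply/andP; split; lra.
have sub n : `[(exhaust_l c e n), (exhaust_r c e n)]%classic `<=` `]c, e[%classic.
  by rewrite E => x xn; exists n.
rewrite E; apply: ge0_nondecreasing_set_cvg_integral => //.
- move=> m n mn; apply/subsetPset => x /=; rewrite !in_itv/= => /andP[? ?].
  by have [? ?] := exhaust_mono ce mn; apply/andP; split; lra.
- by move=> n; apply/measurable_EFinP; apply: measurable_funS mf => //; exact: sub.
- by move=> n x /sub; rewrite /= in_itv/= lee_fin; exact: f0.
Qed.

Lemma continuous_itv_measurable c e f : (forall x, c < x < e -> {for x, continuous f}) ->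
  measurable_fun `]c, e[ f.
Proof.
move=> cf; apply: open_continuous_measurable_fun; first exact: interval_open.
by move=> x; rewrite inE/= in_itv/=; exact: cf.
Qed.

(** The integrand may blow up at the endpoints; a bound on the increments of F inside the open
    interval replaces the boundary values of the improper integral. *)
Lemma integral_primitive_le F f c e (M : R) : c < e ->
  (forall x, c < x < e -> is_derive x 1 F (f x)) ->
  (forall x, c < x < e -> {for x, continuous f}) ->
  (forall x, c < x < e -> 0 <= f x) ->
  (forall x y, c < x < e -> c < y < e -> F y - F x <= M) ->
  (\int[mu]_(x in `]c, e[) (f x)%:E <= M%:E)%E.
Proof.
move=> ce dF cf f0 FM.
have h := integral_exhaust ce f0 (continuous_itv_measurable cf).
apply: cvge_to_le h _; apply: nearW => n.
have [c1 c2 c3] := exhaust_bounds n ce.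
rewrite (@integral_primitive F f c e)// -EFinD lee_fin; apply: FM; apply/andP; split; lra.
Qed.

(** Both integrands may be singular at the ends. The classical substitution holds on the exhausting
    closed intervals, and monotone convergence passes to the limit on both sides. *)
Lemma integral_substitution_oo F f G c e c' e' : c < e -> c' < e' ->
  (forall x, c < x < e -> is_derive x 1 F (f x)) ->
  (forall x, c < x < e -> {for x, continuous f}) ->
  (forall x, c < x < e -> 0 <= f x) ->
  (forall x y, c < x -> x < y -> y < e -> F x < F y) ->
  (forall x, c < x < e -> c' < F x < e') ->
  (forall x', c' < x' < e' -> exists2 x, c < x < e & F x = x') ->
  (forall x, c' < x < e' -> {for x, continuous G}) ->
  (forall x, c' < x < e' -> 0 <= G x) ->
  (\int[mu]_(x in `]c', e'[) (G x)%:E = \int[mu]_(x in `]c, e[) (G (F x) * f x)%:E)%E.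
Proof.
move=> ce ce' dF cf f0 incF Fim Fsurj cG G0.
have cGF x : c < x < e -> {for x, continuous (fun x => G (F x) * f x)}.
  move=> xce; apply: cvgM; last exact: cf.
  apply: (@continuous_comp _ _ _ F G); last exact/cG/Fim.
  by apply: is_derive_continuous; exact: dF.
have h := @integral_exhaust c e (fun x => G (F x) * f x) ce
  (fun x xce => mulr_ge0 (G0 _ (Fim _ xce)) (f0 _ xce)) (continuous_itv_measurable cGF).
apply: (cvg_unique (@ereal_hausdorff R)) _ h.
rewrite (_ : (fun n => _) = fun n => (\int[mu]_(x in `[F (exhaust_l c e n), F (exhaust_r c e n)]) (G x)%:E)%E); last first.
  apply/funext => n; have [c1 c2 c3] := exhaust_bounds n ce.
  rewrite (@integral_substitution F f c e)//.
  - by move=> x y; rewrite !in_itv/= => /andP[? ?] /andP[? ?] xy; apply: incF => //; lra.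
  - have i1 := Fim (exhaust_l c e n); have i2 := Fim (exhaust_r c e n).
    move=> x /andP[x1 x2]; apply: cG.
    have /andP[? ?] : c' < F (exhaust_l c e n) < e' by apply: i1; apply/andP; split; lra.
    have /andP[? ?] : c' < F (exhaust_r c e n) < e' by apply: i2; apply/andP; split; lra.
    by apply/andP; split; lra.
have lF x y : c < x -> x <= y -> y < e -> F x <= F y.
  by move=> cx; rewrite le_eqVlt => /predU1P[->//|xy] ye; exact/ltW/incF.
have mG := continuous_itv_measurable cG.
have E : `]c', e'[%classic = \bigcup_n `[F (exhaust_l c e n), F (exhaust_r c e n)]%classic :> set R.
  apply/seteqP; split => x' /=.
    rewrite in_itv/= => /Fsurj[x xce <-]; have [n /andP[x1 x2]] := exhaust_cover xce.
    have [c1 c2 c3] := exhaust_bounds n ce.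
    by exists n => //=; rewrite in_itv/=; apply/andP; split; apply: lF; lra.
  move=> [n _] /=; rewrite !in_itv/= => /andP[x1 x2].
  have [c1 c2 c3] := exhaust_bounds n ce.
  have /andP[? ?] := Fim (exhaust_l c e n) (ltac:(by apply/andP; split; lra)).
  have /andP[? ?] := Fim (exhaust_r c e n) (ltac:(by apply/andP; split; lra)).
  by apply/andP; split; lra.
have sub n : `[F (exhaust_l c e n), F (exhaust_r c e n)]%classic `<=` `]c', e'[%classic.
  by rewrite E => x xn; exists n.
rewrite E; apply: ge0_nondecreasing_set_cvg_integral => //.
- move=> m n mn; apply/subsetPset => x /=; rewrite !in_itv/= => /andP[x1 x2].
  have [c1 c2 c3] := exhaust_bounds n ce; have [d1 d2 d3] := exhaust_bounds m ce.
  have [p1 p2] := exhaust_mono ce mn.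
  have := lF (exhaust_l c e n) (exhaust_l c e m) c1 p1 (ltac:(lra)).
  have := lF (exhaust_r c e m) (exhaust_r c e n) (ltac:(lra)) p2 c3.
  by move=> q1 q2; apply/andP; split; lra.
- by move=> n; apply/measurable_EFinP; apply: measurable_funS mG => //; exact: sub.
- by move=> n x /sub; rewrite /= in_itv/= lee_fin; exact: G0.
Qed.

Lemma integral_powR_right (v r p : R) : 0 < r -> -1 < p ->
  (\int[mu]_(l in `]v, (v + r)%R[) ((l - v) `^ p)%:E <= (r `^ (p + 1) / (p + 1))%:E)%E.
Proof.
move=> r0 p1; have p10 : 0 < p + 1 by lra.
have pos x : v < x < v + r -> 0 < x - v by move=> /andP[? _]; rewrite subr_gt0.
have dX (q x : R) : v < x < v + r -> is_derive x 1 (fun x => (x - v) `^ q) (q * (x - v) `^ (q - 1)).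
  move=> xv; have d1 : is_derive x 1 (fun x : R => x - v) 1.
    by apply: is_derive_eq; rewrite subr0.
  have d2 := is_derive1_powR q (pos _ xv).
  have := @is_derive1_comp _ (fun y => y `^ q) (fun y => y - v) x _ _ d2 d1.
  by rewrite mulr1.
apply: (@integral_primitive_le (fun x => (p + 1)^-1 * (x - v) `^ (p + 1))).
- by rewrite ltrDl.
- move=> x xv; have := dX (p + 1) _ xv; rewrite addrK => d.
  have := is_deriveZ ((p + 1)^-1) d; rewrite /= => d'.
  by apply: is_derive_eq d' _; rewrite /GRing.scale /= mulKf// gt_eqF.
- by move=> x xv; exact/is_derive_continuous/dX.
- by move=> x xv; exact: powR_ge0.
- move=> x y xv yv; rewrite mulrC.
  rewrite -[leRHS]subr0 lerB// ?mulr_ge0 ?powR_ge0 ?invr_ge0 ?(ltW p10)//.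
  rewrite ler_wpM2r ?invr_ge0 ?(ltW p10)//.
  apply: ge0_ler_powR; rewrite ?nnegrE ?(ltW p10) ?(ltW r0) ?(ltW (pos _ yv))//.
  by case/andP: yv => _ ?; lra.
Qed.

Lemma integral_powR_left (v r p : R) : 0 < r -> -1 < p ->
  (\int[mu]_(l in `](v - r)%R, v[) ((v - l) `^ p)%:E <= (r `^ (p + 1) / (p + 1))%:E)%E.
Proof.
move=> r0 p1; have p10 : 0 < p + 1 by lra.
have pos x : v - r < x < v -> 0 < v - x by move=> /andP[_ ?]; rewrite subr_gt0.
have dX (q x : R) : v - r < x < v -> is_derive x 1 (fun x => (v - x) `^ q) (- (q * (v - x) `^ (q - 1))).
  move=> xv; have d1 : is_derive x 1 (fun x : R => v - x) (- 1).
    apply: (is_derive_eq (is_deriveD (is_derive_cst v x 1) (is_deriveN (is_derive_id x 1)))).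
    by rewrite add0r.
  have d2 := is_derive1_powR q (pos _ xv).
  have := @is_derive1_comp _ (fun y => y `^ q) (fun y => v - y) x _ _ d2 d1.
  by rewrite mulrN1.
apply: (@integral_primitive_le (fun x => - (p + 1)^-1 * (v - x) `^ (p + 1))).
- by rewrite ltrBlDr ltrDl.
- move=> x xv; have := dX (p + 1) _ xv; rewrite addrK => d.
  have := is_deriveZ (- (p + 1)^-1) d; rewrite /= => d'.
  by apply: is_derive_eq d' _; rewrite /GRing.scale /= mulrNN mulKf// gt_eqF.
- by move=> x xv; exact/is_derive_continuous/dX.
- by move=> x xv; exact: powR_ge0.
- move=> x y xv yv; rewrite !mulNr opprK addrC mulrC.
  rewrite -[leRHS]subr0 lerB// ?mulr_ge0 ?powR_ge0 ?invr_ge0 ?(ltW p10)//.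
  rewrite ler_wpM2r ?invr_ge0 ?(ltW p10)//.
  apply: ge0_ler_powR; rewrite ?nnegrE ?(ltW p10) ?(ltW r0) ?(ltW (pos _ xv))//.
  by case/andP: xv => ? _; lra.
Qed.

End calculus.

Section tonelli_rectangle.
Context {R : realType} d1 d2 (T1 : measurableType d1) (T2 : measurableType d2).
Variables (m1 : {sigma_finite_measure set T1 -> \bar R}).
Variables (m2 : {sigma_finite_measure set T2 -> \bar R}).
Local Open Scope ereal_scope.

Lemma tonelli_rectangle (A : set T1) (B : set T2) (f : T1 * T2 -> \bar R) :
  measurable A -> measurable B -> measurable_fun setT f -> (forall p, 0 <= f p) ->
  \int[m1 \x m2]_(p in A `*` B) f p = \int[m1]_(u in A) \int[m2]_(v in B) f (u, v).
Proof.
move=> mA mB mf f0; rewrite integral_mkcond fubini_tonelli1//=; first last.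
- by move=> p; rewrite patchE; case: ifP.
- apply/(measurable_restrictT f); first exact: measurableX.
  exact: measurable_funS mf.
rewrite [RHS]integral_mkcond; apply: eq_integral => u _; rewrite /fubini_F patchE.
case: ifPn => [uA|uA].
  rewrite [RHS]integral_mkcond; apply: eq_integral => v _; rewrite !patchE.
  by rewrite in_setX /= uA.
by rewrite integral0_eq// => v _; rewrite patchE in_setX /= (negbTE uA).
Qed.

Lemma measurable_integral_section (B : set T2) (f : T1 * T2 -> \bar R) :
  measurable B -> measurable_fun setT f -> (forall p, 0 <= f p) ->
  measurable_fun setT (fun u => \int[m2]_(v in B) f (u, v)).
Proof.
move=> mB mf f0; under eq_fun do rewrite integral_mkcond.
have mg : measurable_fun setT (f \_ (setT `*` B)).
  apply/(measurable_restrictT f); first exact: measurableX.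
  exact: measurable_funS mf.
have : measurable_fun setT (fubini_F m2 (f \_ (setT `*` B))).
  by apply: measurable_fun_fubini_tonelli_F => // p; rewrite patchE; case: ifP.
rewrite (_ : fubini_F _ _ = fun u => \int[m2]_x ((fun v => f (u, v)) \_ B) x)//.
apply/funext => u; rewrite /fubini_F; apply: eq_integral => v _.
by rewrite !patchE in_setX /= in_setT.
Qed.

Lemma integral_product_fun (A : set T1) (B : set T2) (f : T1 -> \bar R) (g : T2 -> \bar R) :
  measurable A -> measurable B -> measurable_fun setT f -> measurable_fun setT g ->
  (forall u, 0 <= f u) -> (forall v, 0 <= g v) ->
  \int[m1 \x m2]_(p in A `*` B) (f p.1 * g p.2) =
  (\int[m1]_(u in A) f u) * (\int[m2]_(v in B) g v).
Proof.
move=> mA mB mf mg f0 g0; rewrite tonelli_rectangle//; last 2 first.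
- by apply: emeasurable_funM; apply: measurableT_comp.
- by move=> p; rewrite mule_ge0.
rewrite -ge0_integralZr//; last 2 first.
- exact: measurable_funS mf.
- by apply: integral_ge0.
apply: eq_integral => u _; rewrite -ge0_integralZl//.
exact: measurable_funS mg.
Qed.

End tonelli_rectangle.

(** * The Volterra kernel and its Gram function *)

Section fractional_kernel.
Context {R : realType}.
Notation mu := (@lebesgue_measure R).
Implicit Types (u v x y p q h : R).

Lemma powRE_gt0 x p : 0 < x -> x `^ p = expR (p * ln x).
Proof. by move=> x0; rewrite /powR gt_eqF. Qed.

Lemma powR_decr p x y : p <= 0 -> 0 < x -> x <= y -> y `^ p <= x `^ p.
Proof.
move=> p0 x0 xy; have y0 : 0 < y by lra.
by rewrite !powRE_gt0// ler_expR ler_wnM2l// ler_ln ?posrE.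
Qed.

Lemma powR_ge1 p x : p <= 0 -> 0 < x -> x <= 1 -> 1 <= x `^ p.
Proof. by move=> p0 x0 x1; have := powR_decr p0 x0 x1; rewrite powR1. Qed.

Definition beta_fun_pq p q x : R := x `^ p * (1 - x) `^ q.

(** The exponents are nonpositive, so on each half of the interval the factor that is regular there
    is at most its value at 1/2; the two singularities separate. *)
Lemma beta_fun_split p q x : p <= 0 -> q <= 0 -> 0 < x < 1 ->
  beta_fun_pq p q x <= 2^-1 `^ q * x `^ p + 2^-1 `^ p * (1 - x) `^ q.
Proof.
move=> p0 q0 /andP[x0 x1]; rewrite /beta_fun_pq.
have [x2|x2] := leP x 2^-1.
  apply: le_trans (_ : 2^-1 `^ q * x `^ p <= _); last first.
    by rewrite lerDl mulr_ge0// powR_ge0.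
  by rewrite mulrC ler_wpM2r ?powR_ge0// powR_decr//; lra.
apply: le_trans (_ : 2^-1 `^ p * (1 - x) `^ q <= _); last first.
  by rewrite lerDr mulr_ge0// powR_ge0.
by rewrite ler_wpM2r ?powR_ge0// powR_decr//; lra.
Qed.

Lemma continuous_beta_fun p q x : 0 < x < 1 -> {for x, continuous (beta_fun_pq p q)}.
Proof.
move=> /andP[x0 x1]; apply: cvgM; first exact: continuous_powR.
apply: (@continuous_comp _ _ _ (fun x => 1 - x) (fun x => x `^ q)).
  by apply: cvgB; [exact: cvg_cst|exact: cvg_id].
by apply: continuous_powR; rewrite subr_gt0.
Qed.

Lemma measurable_powR_comp d (T : measurableType d) (f : T -> R) p (B : set T) :
  measurable_fun B f ->
  measurable_fun B (fun w => f w `^ p).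
Proof. by move=> mf; apply: (measurableT_comp (measurable_powR p)). Qed.

Lemma measurable_beta_fun p q (B : set R) : measurable_fun B (beta_fun_pq p q).
Proof.
apply: measurable_funM; apply: measurable_powR_comp => //.
by apply: measurable_funB.
Qed.

(** The integrand is at least 1, which gives the lower bound; together with finiteness this allows
    dividing by the beta constant. *)
Lemma integral_beta_fun p q : -1 < p <= 0 -> -1 < q <= 0 ->
  exists2 b : R, 1 <= b & (\int[mu]_(x in `]0%R, 1%R[) (beta_fun_pq p q x)%:E = b%:E)%E.
Proof.
move=> /andP[p1 p0] /andP[q1 q0].
set I := (\int[mu]_(x in _) _)%E.
have i1 : (1 <= I)%E.
  have <- : (\int[mu]_(x in `]0%R, 1%R[) (cst 1%:E) x = 1)%E.
    rewrite integral_cst// mul1e; have : mu (`]0, 1[%classic : set R) = 1%E by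
      rewrite lebesgue_measure_itv/= lte_fin ltr01 oppr0 adde0.
    exact.
  apply: ge0_le_integral => //=.
  - by apply/measurable_EFinP; apply: measurable_beta_fun.
  - move=> x; rewrite in_itv/= lee_fin => /andP[x0 x1].
    rewrite -[leLHS]mulr1; apply: ler_pM => //; apply: powR_ge1 => //; lra.
have mp r (f : R -> R) : measurable_fun (`]0, 1[%classic : set R) f ->
    measurable_fun (`]0, 1[%classic : set R) (fun x => (f x `^ r)%:E).
  by move=> mf; apply/measurable_EFinP; exact: measurable_powR_comp.
have i2 : (I < +oo)%E.
  apply: (@le_lt_trans _ _ (\int[mu]_(x in `]0%R, 1%R[)
     ((2^-1 `^ q)%:E * (x `^ p)%:E + (2^-1 `^ p)%:E * ((1 - x) `^ q)%:E))%E).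
    apply: ge0_le_integral => //=.
    - by move=> x _; rewrite lee_fin mulr_ge0 ?powR_ge0.
    - by apply/measurable_EFinP; apply: measurable_beta_fun.
    - apply: emeasurable_funD; apply: measurable_funeM; apply: mp => //.
      exact: measurable_funB.
    - by move=> x; rewrite in_itv/= -!EFinM -EFinD lee_fin => /beta_fun_split; exact.
  rewrite ge0_integralD//; first last.
  - by apply: measurable_funeM; apply: mp; exact: measurable_funB.
  - by move=> x _; rewrite -EFinM lee_fin mulr_ge0// powR_ge0.
  - by apply: measurable_funeM; exact: mp.
  - by move=> x _; rewrite -EFinM lee_fin mulr_ge0// powR_ge0.
  rewrite !ge0_integralZl_EFin ?powR_ge0//; first last.
  - exact: mp.
  - by move=> x _; rewrite lee_fin powR_ge0.
  - by apply: mp; exact: measurable_funB.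
  - by move=> x _; rewrite lee_fin powR_ge0.
  have h1 := @integral_powR_right R 0 1 p ltr01 p1.
  have h2 := @integral_powR_left R 1 1 q ltr01 q1.
  rewrite add0r in h1; rewrite subrr in h2.
  have {}h1 : (\int[mu]_(x in `]0%R, 1%R[) (x `^ p)%:E < +oo)%E.
    apply: le_lt_trans (ltry _); last apply: le_trans h1.
    by under [leRHS]eq_integral do rewrite subr0.
  have {}h2 := le_lt_trans h2 (ltry _).
  have f1 := ge0_fin_numE (integral_ge0 mu (D := `]0%R, 1%R[%classic) (f := fun x => (x `^ p)%:E) (fun x _ => ltac:(by rewrite lee_fin powR_ge0))).
  have f2 := ge0_fin_numE (integral_ge0 mu (D := `]0%R, 1%R[%classic) (f := fun x => ((1 - x) `^ q)%:E) (fun x _ => ltac:(by rewrite lee_fin powR_ge0))).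
  rewrite -[X in (_ * X + _)%E]fineK ?f1// -[X in (_ + _ * X)%E]fineK ?f2//.
  by rewrite -!EFinM -EFinD ltry.
have I0 : (0 <= I)%E by apply: le_trans i1.
exists (fine I); last by rewrite fineK// ge0_fin_numE.
by rewrite -lee_fin fineK// ge0_fin_numE.
Qed.

(* Substitution [x = y (u - v) / (v (u - y))]. *)
Lemma beta_substitution u v p q : 0 < v < u -> p + 2 * q + 2 = 0 ->
  (\int[mu]_(x in `]0%R, 1%R[) (beta_fun_pq p q x)%:E =
   ((u - v) `^ (p + 1) * (u * v) `^ (q + 1))%:E *
   \int[mu]_(y in `]0%R, v[) (y `^ p * (v - y) `^ q * (u - y) `^ q)%:E)%E.
Proof.
move=> /andP[v0 vu] pq.
have uv0 : 0 < u - v by rewrite subr_gt0.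
have u0 : 0 < u by lra.
pose F y := (u - v) / v * (y / (u - y)).
pose f y := (u - v) / v * (u / ((u - y) * (u - y))).
have uy y : 0 < y < v -> 0 < u - y by move=> /andP[? ?]; lra.
have dF y : 0 < y < v -> is_derive y 1 F (f y).
  move=> yv; have uy0 := uy _ yv; have uyn : u - y != 0 by rewrite gt_eqF.
  have d1 : is_derive y 1 (fun y : R => u - y) (-1).
    apply: (is_derive_eq (is_deriveD (is_derive_cst u y 1) (is_deriveN (is_derive_id y 1)))).
    by rewrite add0r.
  have d2 := is_deriveV (f := fun y : R => u - y) uyn d1.
  have d3 := is_deriveM (is_derive_id y 1) d2.
  have d4 := is_deriveZ ((u - v) / v) d3.
  apply: (is_derive_eq d4); rewrite /f /GRing.scale /=.
  by field; rewrite uyn gt_eqF.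
have cf y : 0 < y < v -> {for y, continuous f}.
  move=> yv; apply: cvgMr; apply: cvgMr; apply: cvgV.
    by rewrite mulf_neq0// gt_eqF// uy.
  by apply: cvgM; (apply: cvgB; [exact: cvg_cst|exact: cvg_id]).
rewrite (@integral_substitution_oo _ F f (beta_fun_pq p q) 0 v 0 1)//.
- rewrite -ge0_integralZl_EFin//=.
  + apply: eq_integral => y; rewrite inE/= in_itv/= => yv; congr EFin.
    have uy0 := uy _ yv; case/andP: (yv) => y0 yv'.
    have vy0 : 0 < v - y by rewrite subr_gt0.
    (* In logarithms the identity between products of powers becomes a linear one. *)
    have e1 : F y = expR (ln (u - v) - ln v + ln y - ln (u - y)).
      by rewrite !expRD !expRN !lnK ?posrE// /F; field; rewrite !gt_eqF.
    have e2 : 1 - F y = expR (ln u + ln (v - y) - ln v - ln (u - y)).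
      by rewrite !expRD !expRN !lnK ?posrE// /F; field; rewrite !gt_eqF.
    have e3 : f y = expR (ln (u - v) + ln u - ln v - 2 * ln (u - y)).
      rewrite !expRD !expRN expRM_natl expr2 !lnK ?posrE// /f.
      by field; rewrite !gt_eqF.
    rewrite /beta_fun_pq e2 [F y]e1 e3 !powRE_gt0 ?expR_gt0 ?mulr_gt0// !expRK.
    rewrite lnM ?posrE// -!expRD; congr expR.
    (* The substitution produces the exponent -p - q - 2 of u - y, which the relation between p and
       q turns into q. *)
    have -> : p = - 2 * q - 2 by lra.
    by ring.
  + by move=> y _; rewrite lee_fin !mulr_ge0// powR_ge0.
  + apply/measurable_EFinP; apply: measurable_funM; first apply: measurable_funM;
    apply: measurable_powR_comp => //; exact: measurable_funB.
  + by rewrite mulr_ge0// powR_ge0.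
- by move=> y yv; rewrite /f !mulr_ge0// ?invr_ge0 ?mulr_ge0 ?(ltW uv0) ?(ltW v0) ?(ltW u0)// ltW// uy.
- move=> x y x0 xy yv; rewrite /F ltr_pM2l ?divr_gt0//.
  have h1 : 0 < u - x by lra. have h2 : 0 < u - y by lra.
  rewrite ltr_pdivrMr// mulrAC ltr_pdivlMr//; nra.
- move=> y yv; have uy0 := uy _ yv; case/andP: yv => y0 yv.
  rewrite /F !mulr_gt0 ?invr_gt0//=.
  rewrite mulrACA -invfM ltr_pdivrMr ?mulr_gt0// mul1r; nra.
- move=> x /andP[x0 x1]; exists (x * u * v / (u - v + x * v)).
    have d0 : 0 < u - v + x * v by rewrite addr_gt0// mulr_gt0.
    have x1' : 0 < 1 - x by rewrite subr_gt0.
    rewrite !mulr_gt0 ?invr_gt0//= ltr_pdivrMr//.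
    by have := mulr_gt0 (mulr_gt0 v0 uv0) x1'; lra.
  have d0 : 0 < u - v + x * v by rewrite addr_gt0// mulr_gt0.
  by rewrite /F; field; rewrite !gt_eqF//; nra.
- by move=> x; exact: continuous_beta_fun.
- by move=> x _; rewrite mulr_ge0// powR_ge0.
Qed.

(** With the cut-off, integrals in y run over the whole line for every u, so that Tonelli can
    exchange them with integrals in u. *)
Definition volterra h u y : R := if 0 < y < u then dK h u y else 0.

Lemma measurable_volterra h : measurable_fun setT (fun p : R * R => volterra h p.1 p.2).
Proof.
apply: measurable_fun_ifT => //.
  apply: measurable_and; apply: measurable_fun_ltr => //.
by rewrite /dK; do 2 (apply: measurable_funM; last by
   apply: (measurableT_comp (measurable_powR _)) => //; apply: measurable_funB);
  apply: measurable_funM => //; apply: (measurableT_comp (measurable_powR _)).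
Qed.

Lemma volterra_ge0 h u y : 0 <= volterra h u y.
Proof.
by rewrite /volterra; case: ifP => // _; rewrite !mulr_ge0 ?powR_ge0 ?sqrtr_ge0.
Qed.

(** Take p = 1 - 2h, twice the exponent of y in [dK], and q = h - 3/2: the relation asked by
    [beta_substitution] holds, and the beta integral that appears is the one in the normalization of
    [dK], so they cancel. *)
Lemma volterra_gram_lt h u v : 2^-1 < h < 1 -> 0 < v < u ->
  (\int[mu]_y (volterra h u y * volterra h v y)%:E =
   (h * (2 * h - 1) * (u - v) `^ (2 * h - 2))%:E)%E.
Proof.
move=> /andP[h2 h1] vu; have /andP[v0 vu'] := vu.
have u0 : 0 < u by lra. have uv0 : 0 < u - v by lra.
pose p := 1 - 2 * h; pose q := h - 3 / 2.
have pq : p + 2 * q + 2 = 0 by rewrite /p /q; lra.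
have [b b1 bE] := @integral_beta_fun p q (ltac:(rewrite /p; lra)) (ltac:(rewrite /q; lra)).
have betaE : beta (2 - 2 * h) (h - 2^-1) = b.
  have -> : b = fine b%:E by []. rewrite -bE /beta /Rintegral; congr fine.
  apply: eq_integral => x _; rewrite /beta_fun_pq /p /q; congr (_ `^ _ * _ `^ _)%:E; lra.
pose c := h * (2 * h - 1) / b.
have c0 : 0 <= c by rewrite /c divr_ge0 ?mulr_ge0//; lra.
have sub := beta_substitution vu pq.
set J := (\int[mu]_(y in `]0%R, v[) _)%E in sub.
have J0 : (0 <= J)%E by apply: integral_ge0 => y _; rewrite lee_fin !mulr_ge0// powR_ge0.
have k0 : 0 < (u - v) `^ (p + 1) * (u * v) `^ (q + 1).
  by rewrite mulr_gt0// powR_gt0// mulr_gt0.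
have JE : J = (b / ((u - v) `^ (p + 1) * (u * v) `^ (q + 1)))%:E.
  move: sub; rewrite bE; case: J J0 => [r| |] //=.
    by move=> _; rewrite -EFinM => -[->]; rewrite mulrAC divff ?mul1r// gt_eqF.
  by move=> _; rewrite gt0_mulye ?lte_fin// || rewrite gt0_muley ?lte_fin.
transitivity (\int[mu]_(y in `]0%R, v[) ((c * (u * v) `^ (h - 2^-1))%:E *
    (y `^ p * (v - y) `^ q * (u - y) `^ q)%:E))%E.
  rewrite [RHS]integral_mkcond; apply: eq_integral => y _.
  rewrite patchE mem_setE in_itv/= /volterra.
  have [yv|] := boolP (0 < y < v); last by rewrite mulr0.
  case/andP: (yv) => y0 yv'; rewrite y0 (lt_trans yv' vu')/= -EFinM; congr EFin.
  rewrite /dK betaE -/c -/q powRM ?(ltW u0) ?(ltW v0)//.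
  have -> : y `^ p = y `^ (2^-1 - h) * y `^ (2^-1 - h).
    rewrite -powRD; last by apply/implyP => _; rewrite gt_eqF.
    by congr (_ `^ _); rewrite /p; lra.
  rewrite -[in RHS](sqr_sqrtr c0); ring.
rewrite ge0_integralZl_EFin//=; last 3 first.
- by move=> y _; rewrite lee_fin !mulr_ge0// powR_ge0.
- apply/measurable_EFinP; apply: measurable_funM; first apply: measurable_funM;
  apply: measurable_powR_comp => //; exact: measurable_funB.
- by rewrite mulr_ge0// powR_ge0.
rewrite -/J JE -EFinM; congr EFin.
have -> : (u * v) `^ (q + 1) = (u * v) `^ (h - 2^-1) by rewrite /q; congr (_ `^ _); lra.
have -> : 2 * h - 2 = - (p + 1) by rewrite /p; lra.
rewrite powRN /c; field.
rewrite !gt_eqF ?powR_gt0 ?mulr_gt0//; lra.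
Qed.

Lemma volterra_gram h u v : 2^-1 < h < 1 -> 0 < u -> 0 < v -> u != v ->
  (\int[mu]_y (volterra h u y * volterra h v y)%:E =
   (h * (2 * h - 1) * `|u - v| `^ (2 * h - 2))%:E)%E.
Proof.
move=> hh u0 v0; rewrite neq_lt => /orP[uv|vu].
  under eq_integral do rewrite mulrC.
  by rewrite volterra_gram_lt ?u0// ltr0_norm ?subr_lt0// opprB.
by rewrite volterra_gram_lt ?v0// gtr0_norm ?subr_gt0.
Qed.

End fractional_kernel.

(** * Exponential energies of the Riesz kernel *)

Section riesz_kernel.
Context {R : realType}.
Notation mu := (@lebesgue_measure R).
Implicit Types (u v t l r : R).
Variable a : R.
Hypothesis a01 : -1 < a < 0.

Definition riesz_kernel (p : R * R) : R := `|p.1 - p.2| `^ a.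

Lemma riesz_kernel_ge0 p : 0 <= riesz_kernel p.
Proof. exact: powR_ge0. Qed.

Lemma riesz_kernelC u v : riesz_kernel (u, v) = riesz_kernel (v, u).
Proof. by rewrite /riesz_kernel /= distrC. Qed.

Lemma measurable_riesz_kernel : measurable_fun setT riesz_kernel.
Proof.
apply: measurable_powR_comp; apply: measurableT_comp => //=.
exact: measurable_funB.
Qed.

Lemma measurable_riesz_row v (B : set R) : measurable_fun B (fun u => riesz_kernel (u, v)).
Proof.
apply: measurable_powR_comp; apply: measurableT_comp => //=.
exact: measurable_funB.
Qed.

Let a1 : 0 < a + 1. Proof. by case/andP: a01 => ? ?; lra. Qed.

Lemma integral_riesz_near v r (B : set R) : 0 < r -> measurable B ->
  (\int[mu]_(u in B) (if `|u - v| < r then riesz_kernel (u, v) else 0)%:E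
    <= (2 * r `^ (a + 1) / (a + 1))%:E)%E.
Proof.
move=> r0 mB; have [am1 a0] := andP a01.
pose f1 := (fun u => ((u - v) `^ a)%:E) \_ (`]v, v + r[%classic : set R).
pose f2 := (fun u => ((v - u) `^ a)%:E) \_ (`]v - r, v[%classic : set R).
have m1 : measurable_fun setT f1.
  apply/(measurable_restrictT (fun u => ((u - v) `^ a)%:E)) => //; apply/measurable_EFinP; apply: measurable_powR_comp.
  exact: measurable_funB.
have m2 : measurable_fun setT f2.
  apply/(measurable_restrictT (fun u => ((v - u) `^ a)%:E)) => //; apply/measurable_EFinP; apply: measurable_powR_comp.
  exact: measurable_funB.
have p1 u : (0 <= f1 u)%E by rewrite /f1 patchE; case: ifP => // _; rewrite lee_fin powR_ge0.
have p2 u : (0 <= f2 u)%E by rewrite /f2 patchE; case: ifP => // _; rewrite lee_fin powR_ge0.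
have E u : (if `|u - v| < r then riesz_kernel (u, v) else 0)%:E = (f1 u + f2 u)%E.
  rewrite /f1 /f2 !patchE !mem_setE !in_itv/= /riesz_kernel/=.
  have [vu|uv|->] := ltgtP v u.
  - rewrite gtr0_norm ?subr_gt0// ltrBlDl andbF /= adde0.
    by case: ifP.
  - rewrite ltr0_norm ?subr_lt0// opprB ltrBlDr -ltrBlDl andbT /= add0e.
    by rewrite ltrBlDr addrC -ltrBlDr; case: ifP.
  (* On the diagonal the kernel is 0, by the convention for 0 raised to a nonzero power. *)
  - by rewrite subrr normr0 powR0 ?lt_eqF// andbF adde0; case: ifP.
under eq_integral do rewrite E.
apply: (@le_trans _ _ (\int[mu]_u (f1 u + f2 u))%E).
  apply: ge0_subset_integral => //; first exact: emeasurable_funD.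
  by move=> u _; rewrite adde_ge0.
rewrite ge0_integralD// /f1 /f2 -!integral_mkcond.
have -> : 2 * r `^ (a + 1) / (a + 1) = r `^ (a + 1) / (a + 1) + r `^ (a + 1) / (a + 1).
  by rewrite -mulrA mulr_natl mulr2n.
by rewrite EFinD; apply: leeD; [exact: integral_powR_right|exact: integral_powR_left].
Qed.

Lemma integral_exp_tail l t : 0 < l -> 0 <= t ->
  (\int[mu]_(u in `[0%R, t]) (expR (- (l * (t - u))))%:E <= (l^-1)%:E)%E.
Proof.
move=> l0; rewrite le_eqVlt => /predU1P[<-|t0].
  by rewrite set_itv1 integral_set1 lee_fin invr_ge0 ltW.
pose f u := expR (- (l * (t - u))).
have dF u : -1 < u < t + 1 -> is_derive u 1 (fun u => l^-1 * f u) (f u).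
  move=> _; have d1 : is_derive u 1 (fun u : R => - (l * (t - u))) l.
    have h1 := is_deriveD (is_derive_cst t u 1) (is_deriveN (is_derive_id u 1)).
    have h2 := is_deriveN (is_deriveZ l h1).
    by apply: (is_derive_eq h2); rewrite /GRing.scale /= add0r mulrN1 opprK.
  have d2 := @is_derive1_comp _ expR (fun u => - (l * (t - u))) u _ _ (is_derive_expR _) d1.
  have d3 := is_deriveZ l^-1 d2.
  by apply: (is_derive_eq d3); rewrite /GRing.scale /= mulrCA mulVf ?gt_eqF// mulr1.
have cf u : -1 < u < t + 1 -> {for u, continuous f}.
  move=> _; apply: (@continuous_comp _ _ _ (fun u => - (l * (t - u))) expR).
    by apply: cvgN; apply: cvgMr; apply: cvgB; [exact: cvg_cst|exact: cvg_id].
  exact: continuous_expR.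
rewrite (integral_primitive dF cf)//; last by lra.
rewrite -EFinB lee_fin /f subrr mulr0 oppr0 expR0 mulr1 gerBl.
by rewrite mulr_ge0 ?expR_ge0// invr_ge0 ltW.
Qed.

Definition exp_riesz l t (p : R * R) : R :=
  expR (- (l * (2 * t - p.1 - p.2))) * riesz_kernel p.

Lemma exp_riesz_ge0 l t p : 0 <= exp_riesz l t p.
Proof. by rewrite mulr_ge0 ?expR_ge0 ?riesz_kernel_ge0. Qed.

Lemma measurable_exp_riesz l t : measurable_fun setT (exp_riesz l t).
Proof.
apply: measurable_funM; last exact: measurable_riesz_kernel.
apply: measurableT_comp => //; apply: measurable_funN; apply: measurable_funM => //.
by apply: measurable_funB => //; exact: measurable_funB.
Qed.

Lemma measurable_exp_tail l t (B : set R) :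
  measurable_fun B (fun u : R => (expR (- (l * (t - u))))%:E).
Proof.
apply/measurable_EFinP; apply: measurableT_comp => //; apply: measurable_funN.
by apply: measurable_funM => //; exact: measurable_funB.
Qed.

(** A Schur-type bound: one exponential is pulled out of the row integral, what remains is at most K
    uniformly in u, and the extracted exponential has mass at most M. *)
Lemma integral_exp_riesz_le l t (K M : R) : 0 <= t -> 0 <= K -> 0 <= M ->
  (forall u, 0 <= u <= t ->
    (\int[mu]_(v in `[0%R, t]) (expR (- (l * (t - v))) * riesz_kernel (v, u))%:E <= K%:E)%E) ->
  (\int[mu]_(u in `[0%R, t]) (expR (- (l * (t - u))))%:E <= M%:E)%E ->
  (\int[mu \x mu]_(p in square t) (exp_riesz l t p)%:E <= (K * M)%:E)%E.
Proof.
move=> t0 K0 M0 hK hM; rewrite /square tonelli_rectangle//; last 2 first.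
- by apply/measurable_EFinP; exact: measurable_exp_riesz.
- by move=> p; rewrite lee_fin exp_riesz_ge0.
have mr u : measurable_fun (`[0, t]%classic : set R)
    (fun v => (expR (- (l * (t - v))) * riesz_kernel (v, u))%:E).
  apply/measurable_EFinP; apply: measurable_funM.
    by apply/measurable_EFinP; exact: measurable_exp_tail.
  exact: measurable_riesz_row.
apply: (@le_trans _ _ (\int[mu]_(u in `[0%R, t]) (K%:E * (expR (- (l * (t - u))))%:E))%E).
  apply: ge0_le_integral => //=.
  - by move=> u _; apply: integral_ge0 => v _; rewrite lee_fin exp_riesz_ge0.
  - apply: measurable_funTS; apply: (@measurable_integral_section _ _ _ _ _ mu `[0, t]%classic (fun p => (exp_riesz l t p)%:E)) => //.
      by apply/measurable_EFinP; exact: measurable_exp_riesz.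
    by move=> p; rewrite lee_fin exp_riesz_ge0.
  - by apply: measurable_funeM; exact: measurable_exp_tail.
  - move=> u; rewrite in_itv/= => ut.
    rewrite (_ : (\int[mu]_(v in _) _)%E = ((expR (- (l * (t - u))))%:E *
      \int[mu]_(v in `[0%R, t]) (expR (- (l * (t - v))) * riesz_kernel (v, u))%:E)%E); last first.
      rewrite -ge0_integralZl_EFin ?expR_ge0//; last first.
      - exact: mr.
      - by move=> v _; rewrite lee_fin mulr_ge0 ?expR_ge0 ?riesz_kernel_ge0.
      apply: eq_integral => v _; rewrite -EFinM; congr EFin.
      rewrite /exp_riesz /= riesz_kernelC mulrA -expRD; congr (expR _ * _); ring.
    by rewrite muleC; apply: lee_wpmul2r; rewrite ?lee_fin ?expR_ge0// hK.
rewrite ge0_integralZl_EFin//; last exact: measurable_exp_tail.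
by rewrite EFinM; apply: lee_wpmul2l; rewrite ?lee_fin.
Qed.

(* For [l >= 1], [|u - v|^a] is at most [l^(-a)] where [|u - v| >= 1/l], and its
   integral over [|u - v| <= 1/l] is of order [l^(-a-1)]. *)
Lemma integral_exp_riesz_upper (T : R) : 0 <= T -> exists2 C : R, 0 <= C &
  forall l t, 0 <= l -> 0 <= t <= T ->
  (\int[mu \x mu]_(p in square t) (exp_riesz l t p)%:E
    <= (C * Num.max l 1 `^ (- (a + 2)))%:E)%E.
Proof.
move=> T0; have [am1 a0] := andP a01.
(* [CT] bounds the row integrals when l <= 1. For l > 1 the two summands of [K1] stand for the parts
   of the row nearer and farther than 1/l. *)
pose CT := 2 * (T + 1) `^ (a + 1) / (a + 1).
pose K1 := 2 / (a + 1) + 1.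
have CT0 : 0 <= CT by rewrite /CT !mulr_ge0 ?powR_ge0 ?invr_ge0 ?(ltW a1).
have K10 : 0 <= K1 by rewrite /K1 addr_ge0// mulr_ge0// invr_ge0 ltW.
exists (CT * T + K1); first by rewrite addr_ge0// mulr_ge0.
move=> l t l0 /andP[t0 tT].
have mr u : measurable_fun (`[0, t]%classic : set R)
    (fun v => (riesz_kernel (v, u))%:E).
  by apply/measurable_EFinP; exact: measurable_riesz_row.
have mer u : measurable_fun (`[0, t]%classic : set R)
    (fun v => (expR (- (l * (t - v))) * riesz_kernel (v, u))%:E).
  apply/measurable_EFinP; apply: measurable_funM.
    by apply/measurable_EFinP; exact: measurable_exp_tail.
  exact: measurable_riesz_row.
have mnear r u : measurable_fun (`[0, t]%classic : set R)
    (fun v => (if `|v - u| < r then riesz_kernel (v, u) else 0)%:E).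
  apply/measurable_EFinP; apply: measurable_fun_if => //.
  - apply: measurable_fun_ltr => //; apply: measurableT_comp => //.
    exact: measurable_funB.
  - exact: measurable_riesz_row.
have e1 v : 0 <= v <= t -> expR (- (l * (t - v))) <= 1.
  by move=> /andP[_ vt]; rewrite expR_le1 oppr_le0 mulr_ge0// subr_ge0.
(* Here the target power is 1 and the exponentials are bounded by 1; the radius T + 1 exceeds every
   distance within [0, t], so the truncation removes nothing. *)
have [l1|l1] := leP l 1.
  rewrite powR1 mulr1; apply: le_trans (_ : ((CT * T)%:E <= _)%E); last first.
    by rewrite lee_fin lerDl.
  apply: integral_exp_riesz_le => // [u /andP[u0 ut]|].
    apply: le_trans (integral_riesz_near u (ltac:(lra) : 0 < T + 1) (measurable_itv `[0, t])).
    apply: ge0_le_integral => //=.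
    - by move=> v _; rewrite lee_fin mulr_ge0 ?expR_ge0 ?riesz_kernel_ge0.
    - exact: mer.
    - exact: mnear.
    - move=> v; rewrite in_itv/= lee_fin => /andP[v0 vt].
      have -> : `|v - u| < T + 1 by rewrite ltr_norml; apply/andP; split; lra.
      by rewrite ler_piMl ?riesz_kernel_ge0// e1// v0.
  apply: (@le_trans _ _ (\int[mu]_(u in `[0%R, t]) (cst 1%:E) u)%E).
    by apply: ge0_le_integral => //=; exact: measurable_exp_tail.
  rewrite integral_cst// mul1e.
  apply: (@le_trans _ _ t%:E); last by rewrite lee_fin.
  rewrite [leLHS]lebesgue_measure_itv/= lte_fin oppr0 adde0.
  by case: ltP.
have l00 : 0 < l by lra.
apply: le_trans (_ : ((K1 * l `^ (- a - 1) * l^-1)%:E <= _)%E); last first.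
  have -> : - (a + 2) = - a - 1 + - 1 by lra.
  have -> : l `^ (- a - 1 + - 1) = l `^ (- a - 1) * l^-1.
    by rewrite powRD ?(gt_eqF l00) ?implybT// powR_inv1// ltW.
  rewrite lee_fin mulrA.
  by rewrite ler_wpM2r ?invr_ge0 ?(ltW l00)// ler_wpM2r ?powR_ge0// lerDr mulr_ge0.
apply: integral_exp_riesz_le => //.
- by rewrite mulr_ge0 ?powR_ge0.
- by rewrite invr_ge0.
- move=> u /andP[u0 ut].
  have i1 := integral_riesz_near u (ltac:(by rewrite invr_gt0) : 0 < l^-1) (measurable_itv `[0, t]).
  have i2 := integral_exp_tail l00 t0.
  apply: (@le_trans _ _ (\int[mu]_(v in `[0%R, t])
    ((if `|v - u| < l^-1 then riesz_kernel (v, u) else 0)%:E +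
     (l `^ (- a))%:E * (expR (- (l * (t - v))))%:E))%E).
    apply: ge0_le_integral => //=.
    - by move=> v _; rewrite lee_fin mulr_ge0 ?expR_ge0 ?riesz_kernel_ge0.
    - exact: mer.
    - by apply: emeasurable_funD; [exact: mnear|apply: measurable_funeM; exact: measurable_exp_tail].
    - move=> v; rewrite in_itv/= -EFinM -EFinD lee_fin => /e1 ve.
      have [h|h] := ltP `|v - u| l^-1.
        apply: le_trans (_ : riesz_kernel (v, u) <= _).
          by rewrite ler_piMl ?riesz_kernel_ge0.
        by rewrite lerDl mulr_ge0 ?expR_ge0 ?powR_ge0.
      rewrite add0r mulrC ler_wpM2r ?expR_ge0// /riesz_kernel /=.
      apply: le_trans (powR_decr (ltW a0) _ h) _; first by rewrite invr_gt0.
      by rewrite -powR_inv1 ?(ltW l00)// -powRrM mulN1r.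
  rewrite ge0_integralD//; first last.
  - by apply: measurable_funeM; exact: measurable_exp_tail.
  - by move=> v _; rewrite -EFinM lee_fin mulr_ge0 ?expR_ge0 ?powR_ge0.
  - exact: mnear.
  - by move=> v _; case: ifP; rewrite lee_fin ?riesz_kernel_ge0.
  rewrite ge0_integralZl_EFin ?powR_ge0//; first last.
    exact: measurable_exp_tail.
  rewrite /K1 mulrDl mul1r EFinD; apply: leeD.
    apply: le_trans i1 _; rewrite lee_fin.
    have -> : l^-1 `^ (a + 1) = l `^ (- a - 1).
      by rewrite -powR_inv1 ?(ltW l00)// -powRrM mulN1r opprD.
    by rewrite mulrAC.
  rewrite powRD ?(gt_eqF l00) ?implybT// powR_inv1 ?(ltW l00)// EFinM.
  by apply: lee_wpmul2l => //; rewrite lee_fin powR_ge0.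
- exact: integral_exp_tail.
Qed.

(** A box of side m/2 near the corner (T, T) suffices: with m of order 1/max(l, 1) the exponentials
    stay bounded below, the kernel is at least m^a and the area is m^2/4, in total of order
    m^(a+2). *)
Lemma integral_exp_riesz_lower (T : R) : 0 < T -> exists2 c : R, 0 < c &
  forall l, 0 <= l ->
  ((c * Num.max l 1 `^ (- (a + 2)))%:E <=
   \int[mu \x mu]_(p in square T) (exp_riesz l T p)%:E)%E.
Proof.
move=> T0; have [am1 a0] := andP a01.
pose q := Num.min T 1.
have q0 : 0 < q by rewrite lt_min T0/=.
exists (expR (- 2) * q `^ a * (q / 2) ^+ 2).
  by rewrite !mulr_gt0 ?expR_gt0 ?powR_gt0// exprn_gt0// divr_gt0.
move=> l l0; pose L := Num.max l 1.
have L0 : 0 < L by rewrite lt_max ltr01 orbT.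
have lL : l <= L by rewrite le_max lexx.
have L1 : 1 <= L by rewrite le_max lexx orbT.
(* m <= T keeps the box inside the square, and l m <= 1 keeps the product of exponentials above
   e^(-2). *)
pose m := q / L.
have m0 : 0 < m by rewrite divr_gt0.
have mT : m <= T.
  rewrite /m ler_pdivrMr//; apply: le_trans (_ : T <= _); first by rewrite ge_min lexx.
  by rewrite ler_peMr// ltW.
have lm : l * m <= 1.
  apply: le_trans (_ : L * m <= _); first by rewrite ler_wpM2r// ltW.
  by rewrite /m mulrC divfK ?gt_eqF// ge_min lexx orbT.
(* A is open at the right end, hence disjoint from B: the box avoids the diagonal, where the kernel
   is 0 and its lower bound fails. *)
pose A : set R := `[T - m, T - m / 2[%classic.
pose B : set R := `[T - m / 2, T]%classic.
have mAB : measurable (A `*` B) by apply: measurableX; exact: measurable_itv.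
have mSq : measurable (square T) by apply: measurableX; exact: measurable_itv.
apply: (@le_trans _ _ (\int[mu \x mu]_(p in A `*` B) (cst (expR (- 2) * m `^ a)%:E) p)%E); last first.
  apply: (@le_trans _ _ (\int[mu \x mu]_(p in A `*` B) (exp_riesz l T p)%:E)%E).
    apply: ge0_le_integral => //=.
    - by move=> p _; rewrite lee_fin mulr_ge0 ?expR_ge0 ?powR_ge0.
    - by apply: measurable_funTS; apply/measurable_EFinP; exact: measurable_exp_riesz.
    - move=> [u v] /= [] ; rewrite /A /B /= !in_itv/= => /andP[u1 u2] /andP[v1 v2].
      rewrite lee_fin /exp_riesz; apply: ler_pM; rewrite ?expR_ge0 ?powR_ge0//.
        rewrite ler_expR lerN2 /=.
        have h1 : l * (T - u) <= l * m by rewrite ler_wpM2l//; lra.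
        have h2 : l * (T - v) <= l * m by rewrite ler_wpM2l//; lra.
        lra.
      apply: powR_decr; rewrite ?(ltW a0)//=.
        by rewrite normr_gt0 subr_eq0 lt_eqF//; lra.
      by rewrite ler_norml; apply/andP; split; lra.
  apply: ge0_subset_integral => //.
  - by apply: measurable_funTS; apply/measurable_EFinP; exact: measurable_exp_riesz.
  - by move=> p _; rewrite lee_fin exp_riesz_ge0.
  - move=> [u v] /= []; rewrite /A /B /= !in_itv/= => /andP[u1 u2] /andP[v1 v2].
    by split; rewrite /= in_itv/=; apply/andP; split; lra.
rewrite integral_cst//.
rewrite [X in (_ * X)%E]product_measure1E; [|exact: measurable_itv|exact: measurable_itv].
have muA : mu A = (m / 2)%:E.
  rewrite /A lebesgue_measure_itv/= lte_fin ifT; last by lra.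
  by rewrite -EFinB; congr EFin; field.
have muB : mu B = (m / 2)%:E.
  rewrite /B lebesgue_measure_itv/= lte_fin ifT; last by lra.
  by rewrite -EFinB; congr EFin; field.
rewrite [X in (_ * (X * _))%E]muA [X in (_ * (_ * X))%E]muB -!EFinM lee_fin -/L.
have -> : m `^ a = q `^ a * L `^ (- a).
  rewrite /m powRM ?(ltW q0) ?invr_ge0 ?(ltW L0)//.
  by rewrite -[L^-1]powR_inv1 ?(ltW L0)// -powRrM mulN1r.
have -> : - (a + 2) = - a - 2%:R by lra.
rewrite powRB ?(gt_eqF L0) ?implybT// powR_mulrn ?(ltW L0)//.
by rewrite le_eqVlt; apply/orP; left; apply/eqP; rewrite /m; field; rewrite gt_eqF.
Qed.

Lemma integral_riesz_square (T : R) : 0 <= T ->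
  (\int[mu \x mu]_(p in square T) (riesz_kernel p)%:E < +oo)%E.
Proof.
move=> T0; have [C C0 hC] := integral_exp_riesz_upper T0.
have := hC 0 T (lexx _); rewrite T0 lexx => /(_ isT) h.
apply: le_lt_trans (ltry _); last apply: le_trans h.
have mSq : measurable (square T) by apply: measurableX; exact: measurable_itv.
apply: ge0_le_integral => //=.
- by move=> p _; rewrite lee_fin riesz_kernel_ge0.
- by apply: measurable_funTS; apply/measurable_EFinP; exact: measurable_riesz_kernel.
- by apply: measurable_funTS; apply/measurable_EFinP; exact: measurable_exp_riesz.
- by move=> p _; rewrite lee_fin /exp_riesz mul0r oppr0 expR0 mul1r.
Qed.

End riesz_kernel.

(** * Square integrable vector-valued functions *)

(** The line as a Hilbert space: real random variables and kernels on the plane become instances of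
    the vector-valued L^2 theory below. *)
HB.instance Definition _ (R : realType) := NormedModule_isHilbert.Build R R^o
  (fun x y : R => mulrC x y) (fun x y z : R => mulrDl x y z)
  (fun a x y : R => esym (mulrA a x y)) (fun x : R => esym (real_normK (num_real x))).

Section dense_sequence.
Context {R : realType}.

Lemma dense_sequence (V : hilbertType R) : separable V ->
  exists q : nat -> V, dense (range q).
Proof.
move=> [Q [/countable_injP[f finj] dQ]].
exists (fun n => xget 0 [set x | Q x /\ f x = n]) => O O0 oO.
have [x [Ox Qx]] := dQ O O0 oO; exists x; split => //; exists (f x) => //.
case: xgetP => [y _ [Qy fyx]|/(_ x)[]//].
by apply: finj fyx; rewrite inE.
Qed.

Lemma separable_scalars : separable (R^o : hilbertType R).
Proof.
exists (range (@ratr R)); split; last exact: dense_rat.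
exact: card_le_trans (card_image_le _ _) (countableP _).
Qed.

Lemma dense_approx (V : hilbertType R) (q : nat -> V) : dense (range q) ->
  forall x (e : R), 0 < e -> exists n, `|x - q n| < e.
Proof.
move=> dq x e e0; have := dq (ball x e).
have ne : ball x e !=set0 by exists x; exact: ballxx.
move=> /(_ ne (ball_open _ _))[y []].
by rewrite -ball_normE /= => xe [n _ qn]; exists n; rewrite qn.
Qed.

End dense_sequence.

(** * Weak and Borel measurability in a separable Hilbert space *)

Section weak_measurability.
Context {R : realType} {V : hilbertType R} (sepV : separable V).
Context {d : measure_display} {T : measurableType d}.
Implicit Types X Y : T -> V.

(** Sums, multiples and pointwise limits are immediate for this notion; the Borel one used in the
    statement is equivalent to it by [borel_weakly_measurable]. *)
Definition weakly_measurable X := forall v, measurable_fun setT (fun w => ip (X w) v).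

Lemma weakly_measurableD X Y : weakly_measurable X -> weakly_measurable Y ->
  weakly_measurable (fun w => X w + Y w).
Proof.
move=> mX mY v; under eq_fun do rewrite ipDl.
exact: measurable_funD.
Qed.

Lemma weakly_measurableZ a X : weakly_measurable X -> weakly_measurable (fun w => a *: X w).
Proof.
move=> mX v; under eq_fun do rewrite ipZl.
exact: measurable_funM.
Qed.

Lemma weakly_measurable_scale (f : T -> R) (x : V) : measurable_fun setT f ->
  weakly_measurable (fun w => f w *: x).
Proof.
move=> mf v; under eq_fun do rewrite ipZl.
exact: measurable_funM.
Qed.

Lemma weakly_measurable_cst x : weakly_measurable (fun=> x).
Proof. by move=> v; exact: measurable_cst. Qed.

Lemma weakly_measurable_cvg (Xn : nat -> T -> V) X :
  (forall n, weakly_measurable (Xn n)) -> (forall w, Xn n w @[n --> \oo] --> X w) ->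
  weakly_measurable X.
Proof.
move=> mX cX v; apply: (measurable_fun_cvg (fun n => mX n v)) => w _.
by apply: cvg_ip; [exact: cX|exact: cvg_cst].
Qed.

(** Each term equals |y|^2 - |y - q_n|^2. The squared norm becomes a countable supremum of functions
    that are affine in y, hence is measurable along weakly measurable functions. *)
Lemma norm2_sups (q : nat -> V) (y : V) : dense (range q) ->
  has_ubound (range (fun n => 2 * ip y (q n) - `|q n| ^+ 2)) /\
  `|y| ^+ 2 = sups (fun n => 2 * ip y (q n) - `|q n| ^+ 2) 0.
Proof.
move=> dq; have E n : 2 * ip y (q n) - `|q n| ^+ 2 = `|y| ^+ 2 - `|y - q n| ^+ 2.
  by rewrite norm2B; ring.
have ub : ubound (range (fun n => 2 * ip y (q n) - `|q n| ^+ 2)) (`|y| ^+ 2).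
  by move=> _ [n _ <-]; rewrite E gerBl sqr_ge0.
split; first by exists (`|y| ^+ 2).
rewrite /sups /= /sdrop /= (_ : [set k | (0 <= k)%N] = setT); last by apply/seteqP.
apply/eqP; rewrite eq_le; apply/andP; split; last first.
  by apply: ge_sup => //; exists (2 * ip y (q 0%N) - `|q 0%N| ^+ 2), 0%N.
apply/ler_addgt0Pr => e e0.
have [n yn] := dense_approx dq y (ltac:(by rewrite sqrtr_gt0) : 0 < Num.sqrt e).
have : 2 * ip y (q n) - `|q n| ^+ 2 <=
    sup (range (fun n => 2 * ip y (q n) - `|q n| ^+ 2)).
  by apply: ub_le_sup; [exists (`|y| ^+ 2)|exists n].
rewrite {1}E => h.
have : `|y - q n| ^+ 2 < e.
  by rewrite -[e]sqr_sqrtr ?(ltW e0)// ltr_pXn2r ?nnegrE ?sqrtr_ge0.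
by move=> h2; lra.
Qed.

Lemma measurable_norm2 X : weakly_measurable X -> measurable_fun setT (fun w => `|X w| ^+ 2).
Proof.
move=> mX; have [q dq] := dense_sequence sepV.
have -> : (fun w => `|X w| ^+ 2) =
    fun w => sups (fun n => 2 * ip (X w) (q n) - `|q n| ^+ 2) 0.
  by apply/funext => w; exact: (norm2_sups _ dq).2.
apply: measurable_fun_sups => [w _|n]; first exact: (norm2_sups _ dq).1.
by apply: measurable_funB => //; apply: measurable_funM => //; exact: mX.
Qed.

Lemma measurable_norm X : weakly_measurable X -> measurable_fun setT (fun w => `|X w|).
Proof.
move=> mX; have -> : (fun w => `|X w|) = fun w => Num.sqrt (`|X w| ^+ 2).
  by apply/funext => w; rewrite sqrtr_sqr normr_id.
apply: measurableT_comp (measurable_norm2 mX).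
by apply: continuous_measurable_fun; exact: sqrt_continuous.
Qed.

Lemma weakly_measurableB X Y : weakly_measurable X -> weakly_measurable Y ->
  weakly_measurable (fun w => X w - Y w).
Proof.
move=> mX mY v; under eq_fun do rewrite ipBl.
exact: measurable_funB.
Qed.

Lemma measurable_ip X Y : weakly_measurable X -> weakly_measurable Y ->
  measurable_fun setT (fun w => ip (X w) (Y w)).
Proof.
move=> mX mY; have -> : (fun w => ip (X w) (Y w)) =
    fun w => 4^-1 * (`|X w + Y w| ^+ 2 - `|X w - Y w| ^+ 2).
  by apply/funext => w; rewrite norm2D norm2B; field.
apply: measurable_funM => //; apply: measurable_funB; apply: measurable_norm2.
  exact: weakly_measurableD.
exact: weakly_measurableB.
Qed.

(** Pettis' theorem: by separability an open set is a countable union of balls, whose preimages are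
    measurable because norms are. *)
Lemma borel_weakly_measurable X : borel_fun setT X <-> weakly_measurable X.
Proof.
split=> [bX v|mX].
  apply: (measurability _ (RGenOpens.measurableE R)) => _ [_ [a [b ->]] <-].
  rewrite setTI.
  have -> : (fun w => ip (X w) v) @^-1` `]a, b[ =
      X @^-1` ((fun y : V => ip y v) @^-1` `]a, b[) by [].
  rewrite -[X in measurable X]setTI.
  apply: (bX measurableT).
  apply: sub_sigma_algebra.
  apply: open_comp; first by move=> y _; exact: continuous_ip.
  exact: interval_open.
have [q dq] := dense_sequence sepV.
rewrite /borel_fun; apply: (@measurability _ _ _ (g_sigma_algebraType (@open V)) _ _ (@open V)) => // _ [W oW <-].
rewrite setTI.
pose F (p : nat * nat) := if `[< ball (q p.1) (p.2.+1%:R^-1) `<=` W >] then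
  [set w | `|X w - q p.1| < p.2.+1%:R^-1] else set0.
have -> : X @^-1` W = \bigcup_p F p.
  apply/seteqP; split=> w /=; last first.
    move=> [p _]; rewrite /F; case: ifPn => [/asboolP Ip /= h|//].
    by apply: Ip; rewrite -ball_normE /= distrC.
  move=> OX; have := open_nbhs_nbhs (conj oW OX).
  rewrite nbhs_ballP => -[e /= e0 he].
  have [k ke] : exists k : nat, k.+1%:R^-1 < e / 2.
    exists (Num.truncn (2 / e)).
    rewrite -[ltRHS]invrK ltf_pV2 ?posrE ?invr_gt0 ?divr_gt0// invf_div.
    exact: truncnS_gt.
  have [n hn] := dense_approx dq (X w) (ltac:(by rewrite invr_gt0) : 0 < k.+1%:R^-1).
  exists (n, k) => //; rewrite /F; case: ifPn => [//|/asboolP[]] y.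
  rewrite /= -ball_normE /= => qy; apply: he.
  rewrite -ball_normE /=; apply: le_lt_trans (ler_distD (q n) _ _) _.
  move: k.+1%:R^-1 ke hn qy => p *; lra.
apply: countable_bigcupT_measurable => [|p]; first exact: countableP.
rewrite /F; case: ifP => _ //.
rewrite -[X in measurable X]setTI.
apply: (measurable_fun_ltr _ _ measurableT) => //.
by apply: measurable_norm; apply: weakly_measurableB => //; exact: weakly_measurable_cst.
Qed.

End weak_measurability.

Section square_integrable.
Context {R : realType} {V : hilbertType R} (sepV : separable V).
Context {d : measure_display} {T : measurableType d} (mu : {measure set T -> \bar R}).
Implicit Types X Y Z : T -> V.

Definition sqint X := weakly_measurable X /\ (\int[mu]_w (`|X w| ^+ 2)%:E < +oo)%E.

Definition l2dot X Y : R := \int[mu]_w ip (X w) (Y w).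

Definition l2to (Xn : nat -> T -> V) X : Prop :=
  (fun n => l2dot (fun w => Xn n w - X w) (fun w => Xn n w - X w)) @ \oo --> (0 : R).

Lemma integrable_norm2 X : sqint X -> mu.-integrable setT (fun w => (`|X w| ^+ 2)%:E).
Proof.
move=> [mX X2]; apply/integrableP; split.
  by apply/measurable_EFinP; exact: measurable_norm2.
by under eq_integral do rewrite gee0_abs ?lee_fin ?sqr_ge0//.
Qed.

Lemma sqintP X : weakly_measurable X -> mu.-integrable setT (fun w => (`|X w| ^+ 2)%:E) ->
  sqint X.
Proof.
move=> mX /integrableP[_]; split => //.
by under eq_integral do rewrite -[_%:E]gee0_abs ?lee_fin ?sqr_ge0//.
Qed.

Lemma integrable_ip X Y : sqint X -> sqint Y ->
  mu.-integrable setT (fun w => (ip (X w) (Y w))%:E).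
Proof.
move=> X2 Y2; have iXY := integrableD measurableT (integrable_norm2 X2) (integrable_norm2 Y2).
apply: le_integrable iXY => //.
  by apply/measurable_EFinP; apply: measurable_ip => //; [case: X2|case: Y2].
move=> w _; rewrite -EFinD !abse_EFin lee_fin.
apply: le_trans (cauchy_schwarz _ _) _; rewrite [leRHS]ger0_norm ?addr_ge0 ?sqr_ge0//.
by have := sqr_ge0 (`|X w| - `|Y w|); have := normr_ge0 (X w); have := normr_ge0 (Y w); nra.
Qed.

Lemma sqintD X Y : sqint X -> sqint Y -> sqint (fun w => X w + Y w).
Proof.
move=> X2 Y2; have mD : weakly_measurable (fun w => X w + Y w).
  by apply: weakly_measurableD; [case: X2|case: Y2].
apply: sqintP => //.
have h := integrableD measurableT
  (integrableZl measurableT 2 (integrable_norm2 X2))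
  (integrableZl measurableT 2 (integrable_norm2 Y2)).
apply: le_integrable h => //.
  by apply/measurable_EFinP; exact: measurable_norm2.
move=> w _; rewrite -!EFinM -EFinD !abse_EFin lee_fin -parallelogram.
by rewrite !ger0_norm ?addr_ge0 ?sqr_ge0// lerDl sqr_ge0.
Qed.

Lemma sqintZ a X : sqint X -> sqint (fun w => a *: X w).
Proof.
move=> X2; apply: sqintP; first by apply: weakly_measurableZ; case: X2.
have -> : (fun w => (`|a *: X w| ^+ 2)%:E) = (fun w => ((a ^+ 2)%:E * (`|X w| ^+ 2)%:E)%E).
  by apply/funext => w; rewrite -EFinM normrZ exprMn real_normK ?num_real.
by apply: integrableZl => //; exact: integrable_norm2.
Qed.

Lemma sqintB X Y : sqint X -> sqint Y -> sqint (fun w => X w - Y w).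
Proof.
move=> X2 /(sqintZ (-1)) Y2; have := sqintD X2 Y2.
by under eq_fun do rewrite scaleN1r.
Qed.

Lemma sqint0 : sqint (fun=> 0).
Proof.
split; first exact: weakly_measurable_cst.
by under eq_integral do rewrite normr0 expr0n; rewrite integral0.
Qed.

Lemma sqint_sum I (r : seq I) (p : pred I) (F : I -> T -> V) :
  (forall i, p i -> sqint (F i)) -> sqint (fun w => \sum_(i <- r | p i) F i w).
Proof.
move=> h; elim: r => [|i r IH]; first by under eq_fun do rewrite big_nil; exact: sqint0.
under eq_fun do rewrite big_cons; case pi : (p i) => //.
by apply: sqintD => //; exact: h.
Qed.

Lemma l2dotC X Y : l2dot X Y = l2dot Y X.
Proof. by rewrite /l2dot; under eq_Rintegral do rewrite ipC. Qed.

Lemma l2dotDl X Y Z : sqint X -> sqint Y -> sqint Z ->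
  l2dot (fun w => X w + Y w) Z = l2dot X Z + l2dot Y Z.
Proof.
move=> X2 Y2 Z2; rewrite /l2dot; under eq_Rintegral do rewrite ipDl.
by rewrite RintegralD//; exact: integrable_ip.
Qed.

Lemma l2dotZl a X Y : sqint X -> sqint Y -> l2dot (fun w => a *: X w) Y = a * l2dot X Y.
Proof.
move=> X2 Y2; rewrite /l2dot; under eq_Rintegral do rewrite ipZl.
by rewrite RintegralZl//; exact: integrable_ip.
Qed.

Lemma l2dotDr X Y Z : sqint X -> sqint Y -> sqint Z ->
  l2dot Z (fun w => X w + Y w) = l2dot Z X + l2dot Z Y.
Proof. by move=> *; rewrite l2dotC l2dotDl// !(l2dotC Z). Qed.

Lemma l2dotZr a X Y : sqint X -> sqint Y -> l2dot X (fun w => a *: Y w) = a * l2dot X Y.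
Proof. by move=> *; rewrite l2dotC l2dotZl// l2dotC. Qed.

Lemma l2dotBl X Y Z : sqint X -> sqint Y -> sqint Z ->
  l2dot (fun w => X w - Y w) Z = l2dot X Z - l2dot Y Z.
Proof.
move=> X2 Y2 Z2; have := l2dotDl X2 (sqintZ (-1) Y2) Z2.
by rewrite l2dotZl// mulN1r; under eq_fun do rewrite scaleN1r.
Qed.

Lemma l2dotBr X Y Z : sqint X -> sqint Y -> sqint Z ->
  l2dot Z (fun w => X w - Y w) = l2dot Z X - l2dot Z Y.
Proof. by move=> *; rewrite l2dotC l2dotBl// !(l2dotC Z). Qed.

Lemma l2dot0l X : l2dot (fun=> 0) X = 0.
Proof.
by rewrite /l2dot; under eq_Rintegral do rewrite ip0l; rewrite /Rintegral integral0.
Qed.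

Lemma l2dot_suml I (r : seq I) (p : pred I) (F : I -> T -> V) Y :
  (forall i, p i -> sqint (F i)) -> sqint Y ->
  l2dot (fun w => \sum_(i <- r | p i) F i w) Y = \sum_(i <- r | p i) l2dot (F i) Y.
Proof.
move=> h Y2; elim: r => [|i r IH].
  by under eq_fun do rewrite big_nil; rewrite big_nil l2dot0l.
under eq_fun do rewrite big_cons; rewrite big_cons; case pi : (p i) => //.
by rewrite l2dotDl ?IH//; [exact: h|exact: sqint_sum].
Qed.

Lemma l2dot_sumr I (r : seq I) (p : pred I) (F : I -> T -> V) Y :
  (forall i, p i -> sqint (F i)) -> sqint Y ->
  l2dot Y (fun w => \sum_(i <- r | p i) F i w) = \sum_(i <- r | p i) l2dot Y (F i).
Proof.
by move=> h Y2; rewrite l2dotC l2dot_suml//; apply: eq_bigr => i _; rewrite l2dotC.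
Qed.

Lemma l2dot_ge0 X : 0 <= l2dot X X.
Proof. by apply: Rintegral_ge0 => w _; exact: ip_ge0. Qed.

Lemma integral_norm2 X : sqint X -> (\int[mu]_w (`|X w| ^+ 2)%:E)%E = (l2dot X X)%:E.
Proof.
move=> X2; rewrite /l2dot /Rintegral; under [in RHS]eq_integral do rewrite ipxx.
rewrite fineK// ge0_fin_numE; first by case: X2.
by apply: integral_ge0 => w _; rewrite lee_fin sqr_ge0.
Qed.

Lemma l2dot_CS X Y : sqint X -> sqint Y -> l2dot X Y ^+ 2 <= l2dot X X * l2dot Y Y.
Proof.
move=> X2 Y2; apply: quadratic_CS => s.
have := l2dot_ge0 (fun w => X w + s *: Y w).
rewrite l2dotDl ?l2dotDr ?l2dotZl ?l2dotZr ?(l2dotC Y X)//; try exact: sqintZ; first last.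
  by apply: sqintD => //; exact: sqintZ.
by congr (0 <= _); ring.
Qed.

Lemma l2dot_cvg0 (Xn Yn : nat -> T -> V) (C : R) :
  (forall n, sqint (Xn n)) -> (forall n, sqint (Yn n)) ->
  (fun n => l2dot (Xn n) (Xn n)) @ \oo --> (0 : R) ->
  (fun n => l2dot (Yn n) (Yn n)) @ \oo --> C ->
  (fun n => l2dot (Xn n) (Yn n)) @ \oo --> (0 : R).
Proof.
move=> X2 Y2 X0 YC; apply: norm_cvg0.
have h n : `|l2dot (Xn n) (Yn n)| <=
    Num.sqrt (l2dot (Xn n) (Xn n) * l2dot (Yn n) (Yn n)).
  by rewrite -sqrtr_sqr ler_wsqrtr// l2dot_CS.
apply: (@squeeze_cvgr _ _ _ _ (fun=> 0)
    (fun n => Num.sqrt (l2dot (Xn n) (Xn n) * l2dot (Yn n) (Yn n)))).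
- by apply: nearW => n; rewrite normr_ge0 h.
- exact: cvg_cst.
- rewrite -[X in _ --> X](@sqrtr0 R) -[X in Num.sqrt X](mul0r C).
  apply: continuous_cvg; first exact: sqrt_continuous.
  exact: cvgM.
Qed.

Lemma l2dot_cvg (Xn Yn : nat -> T -> V) X Y :
  (forall n, sqint (Xn n)) -> (forall n, sqint (Yn n)) -> sqint X -> sqint Y ->
  l2to Xn X -> l2to Yn Y ->
  (fun n => l2dot (Xn n) (Yn n)) @ \oo --> l2dot X Y.
Proof.
move=> Xn2 Yn2 X2 Y2 cX cY.
pose dX n w := Xn n w - X w; pose dY n w := Yn n w - Y w.
have dX2 n : sqint (dX n) by exact: sqintB.
have dY2 n : sqint (dY n) by exact: sqintB.
have -> : (fun n => l2dot (Xn n) (Yn n)) = fun n =>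
    l2dot X Y + (l2dot (dX n) Y + (l2dot (dY n) X + l2dot (dX n) (dY n))).
  apply/funext => n; rewrite /dX /dY !(l2dotBl, l2dotBr)//; try exact: sqintB.
  by rewrite (l2dotC (Yn n) X) (l2dotC Y X); ring.
rewrite -[X in _ --> X]addr0; apply: cvgD; first exact: cvg_cst.
have z0 : (0 : R) = 0 + (0 + 0) by rewrite !addr0.
rewrite [X in _ --> X]z0; apply: cvgD.
  by apply: (l2dot_cvg0 (Yn := fun=> Y) dX2 _ cX); [|exact: cvg_cst].
apply: cvgD; last exact: l2dot_cvg0 cX cY.
by apply: (l2dot_cvg0 (Yn := fun=> X) dY2 _ cY); [|exact: cvg_cst].
Qed.

Lemma l2to_norm_cvg (Xn : nat -> T -> V) X :
  (forall n, sqint (Xn n)) -> sqint X -> l2to Xn X ->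
  (fun n => l2dot (Xn n) (Xn n)) @ \oo --> l2dot X X.
Proof. by move=> *; exact: l2dot_cvg. Qed.

Lemma l2toP (Xn : nat -> T -> V) X : (forall n, sqint (Xn n)) -> sqint X ->
  (l2to Xn X <-> (\int[mu]_w (`|Xn n w - X w| ^+ 2)%:E @[n --> \oo] --> 0)%E).
Proof.
move=> Xn2 X2; rewrite /l2to.
have -> : (fun n => \int[mu]_w (`|Xn n w - X w| ^+ 2)%:E)%E =
    (fun n => (l2dot (fun w => Xn n w - X w) (fun w => Xn n w - X w))%:E).
  by apply/funext => n; rewrite integral_norm2//; exact: sqintB.
by split => [h|/fine_cvgP[]//]; apply: cvg_EFin => //; exact: nearW.
Qed.

Lemma sqint_l2_close X Y : weakly_measurable X -> sqint Y ->
  (\int[mu]_w (`|Y w - X w| ^+ 2)%:E < +oo)%E -> sqint X.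
Proof.
move=> mX Y2 h; have d2 : sqint (fun w => Y w - X w).
  by split => //; apply: weakly_measurableB => //; case: Y2.
by have := sqintB Y2 d2; under eq_fun do rewrite opprB addrC subrK.
Qed.

(* Along a subsequence with [|X_{k+1} - X_k|^2] of integral at most [4^-k], the
   bound [D <= (2^-k + 2^k D^2) / 2] makes [sum D_k] finite almost everywhere. *)
Lemma l2_complete_fast (Xn : nat -> T -> V) : (forall n, sqint (Xn n)) ->
  (forall m n, (m <= n)%N ->
    l2dot (fun w => Xn n w - Xn m w) (fun w => Xn n w - Xn m w) <= (4 ^- m)) ->
  exists X, sqint X /\ forall m,
    l2dot (fun w => Xn m w - X w) (fun w => Xn m w - X w) <= (4 ^- m).
Proof.
move=> X2 fast.
pose D k w := `|Xn k.+1 w - Xn k w|.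
pose G w := (\sum_(0 <= k <oo) (2 ^+ k * D k w ^+ 2)%:E)%E.
have mterm k : measurable_fun setT (fun w => (2 ^+ k * D k w ^+ 2)%:E).
  apply/measurable_EFinP; apply: measurable_funM => //.
  by apply: (measurable_norm2 sepV (X := fun w => Xn k.+1 w - Xn k w));
    apply: weakly_measurableB; [case: (X2 k.+1)|case: (X2 k)].
have term0 k w : (0 <= (2 ^+ k * D k w ^+ 2)%:E)%E.
  by rewrite lee_fin mulr_ge0 ?sqr_ge0 ?exprn_ge0.
have mG : measurable_fun setT G.
  by apply: ge0_emeasurable_sum => // k w _ _; exact: term0.
have G0 w : (0 <= G w)%E by apply: nneseries_ge0 => k _ _; exact: term0.
have iG : (\int[mu]_w G w < +oo)%E.
  rewrite integral_nneseries//.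
  apply: (@le_lt_trans _ _ (\sum_(0 <= k <oo) ((2^-1) ^+ k)%:E)%E).
    apply: lee_nneseries => [k _ _|k _]; first exact: integral_ge0.
    under eq_integral do rewrite EFinM.
    rewrite ge0_integralZl_EFin ?exprn_ge0//; first last.
    - apply/measurable_EFinP.
      by apply: (measurable_norm2 sepV (X := fun w => Xn k.+1 w - Xn k w));
        apply: weakly_measurableB; [case: (X2 k.+1)|case: (X2 k)].
    - by move=> w _; rewrite lee_fin sqr_ge0.
    rewrite integral_norm2; last exact: sqintB.
    rewrite -EFinM lee_fin; apply: le_trans (_ : 2 ^+ k * 4 ^- k <= _).
      by rewrite ler_wpM2l ?exprn_ge0// fast.
    by rewrite -exprVn -exprMn; have -> : 2 * 4^-1 = 2^-1 :> R by field.
  apply: (@le_lt_trans _ _ 2%:E); last exact: ltry.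
  apply: lime_le; first by apply: is_cvg_nneseries => k _ _; rewrite lee_fin exprn_ge0.
  apply: nearW => n; rewrite sumEFin lee_fin.
  have -> : \sum_(0 <= k < n) 2^-1 ^+ k = 2 - 2 * 2^-1 ^+ n :> R.
    elim: n => [|n IH]; first by rewrite big_geq// expr0; lra.
    by rewrite big_nat_recr//= IH exprS; move: (2^-1 ^+ n) => p; lra.
  by rewrite gerBl mulr_ge0// exprn_ge0.
have [N [mN N0 GN]] : mu.-negligible (~` [set w | setT w -> G w \is a fin_num]).
  apply: integrable_ae => //; apply/integrableP; split => //.
  by under eq_integral do rewrite gee0_abs//.
have Gfin w : ~ N w -> G w \is a fin_num.
  by move=> Nw; apply: contrapT => h; apply: Nw; apply: GN => /(_ I).
have cX w : ~ N w -> cvgn (fun n => Xn n w).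
  move=> /Gfin Gw.
  suff : cvgn (series (fun n => Xn n.+1 w - Xn n w)).
    move=> /cvg_ex[l hl]; apply/cvg_ex; exists (l + Xn 0%N w).
    have -> : (fun n => Xn n w) = fun n => series (fun n => Xn n.+1 w - Xn n w) n + Xn 0%N w.
      by apply/funext => n; rewrite /series /= telescope_sumr// subrK.
    by apply: cvgD => //; exact: cvg_cst.
  apply: (@series_abs_summable _ _ _ (fun k => (2^-1 ^+ k + 2 ^+ k * D k w ^+ 2) / 2)
    ((2 + fine (G w)) / 2)) => [k|n].
    rewrite -/(D k w); have := sqr_ge0 (1 - 2 ^+ k * D k w).
    rewrite -(@ler_pM2l _ (2^-1 ^+ k)) ?exprn_gt0// mulr0.
    have -> : 2^-1 ^+ k * (1 - 2 ^+ k * D k w) ^+ 2 =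
        2^-1 ^+ k - 2 * (2^-1 ^+ k * 2 ^+ k) * D k w + (2^-1 ^+ k * 2 ^+ k) * (2 ^+ k * D k w ^+ 2).
      by ring.
    rewrite -exprMn mulVf// expr1n mulr1 mul1r => h; lra.
  rewrite -mulr_suml big_split /= ler_pM2r ?invr_gt0// lerD//.
    have -> : \sum_(0 <= k < n) 2^-1 ^+ k = 2 - 2 * 2^-1 ^+ n :> R.
      elim: n => [|n IH]; first by rewrite big_geq// expr0; lra.
      by rewrite big_nat_recr//= IH exprS; move: (2^-1 ^+ n) => p; lra.
    by rewrite gerBl mulr_ge0// exprn_ge0.
  rewrite -lee_fin fineK// -sumEFin /G.
  exact: nneseries_lim_ge.
(* Setting X to 0 on the null set N makes it weakly measurable everywhere, as a pointwise limit of
   the truncated sequence. *)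
pose X w := if w \in N then 0 else limn (fun n => Xn n w).
have XnX w : ~ N w -> Xn n w @[n --> \oo] --> X w.
  move=> Nw; rewrite /X (_ : w \in N = false); first exact: cX.
  by apply/negP; rewrite inE.
have mX : weakly_measurable X.
  apply: (@weakly_measurable_cvg _ _ _ _ (fun n w => if w \in N then 0 else Xn n w)).
    move=> n v.
    have -> : (fun w => ip (if w \in N then 0 else Xn n w) v) =
        fun w => \1_(~` N) w * ip (Xn n w) v.
      apply/funext => w; rewrite indicE in_setC.
      by case: (w \in N); rewrite /= ?ip0l ?mul0r ?mul1r.
    apply: measurable_funM; last by case: (X2 n).
    by apply: measurable_indic; exact: measurableC.
  move=> w; rewrite /X; case: (boolP (w \in N)) => wN; first exact: cvg_cst.
  by apply: cX; move/negP : wN; rewrite inE.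
have bound m : (\int[mu]_w (`|Xn m w - X w| ^+ 2)%:E <= (4 ^- m)%:E)%E.
  have mYn Y : weakly_measurable Y ->
      measurable_fun setT (fun w => (`|Xn m w - Y w| ^+ 2)%:E).
    move=> mY; apply/measurable_EFinP; apply: (measurable_norm2 sepV).
    by apply: weakly_measurableB => //; case: (X2 m).
  rewrite (ge0_negligible_integral mN)//; last exact: mYn.
  rewrite setTD.
  (* Fatou's lemma in the second index transfers the bound on X_m - X_n to X_m - X. *)
  apply: (@le_trans _ _ (\int[mu]_(w in ~` N) limn_einf (fun n => (`|Xn m w - Xn n w| ^+ 2)%:E))%E).
    rewrite le_eqVlt; apply/orP; left; apply/eqP; apply: eq_integral => w /[!inE] Nw.
    have /cvg_limn_einf_sup[-> _]// : (`|Xn m w - Xn n w| ^+ 2)%:E @[n --> \oo] --> (`|Xn m w - X w| ^+ 2)%:E.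
    apply: cvg_EFin; first exact: nearW.
    have h : `|Xn m w - Xn n w| @[n --> \oo] --> `|Xn m w - X w|.
      by apply: cvg_norm; apply: cvgB; [exact: cvg_cst|exact: XnX].
    exact: cvgM.
  apply: le_trans (fatou mu _ _ _) _ => //.
  - exact: measurableC.
  - by move=> n; apply: measurable_funS (mYn _ _) => //; case: (X2 n).
  rewrite limn_einf_lim; apply: lime_le; first exact: is_cvg_einfs.
  apply: nearW => k.
  apply: ereal_inf_le; exists (\int[mu]_(w in ~` N) (`|Xn m w - Xn (maxn m k) w| ^+ 2)%:E)%E.
    by exists (maxn m k) => //=; exact: leq_maxr.
  apply: (@le_trans _ _ (\int[mu]_w (`|Xn m w - Xn (maxn m k) w| ^+ 2)%:E)%E).
    by apply: ge0_subset_integral => //; [exact: measurableC|apply: mYn; case: (X2 (maxn m k))].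
  rewrite integral_norm2; last exact: sqintB.
  rewrite lee_fin; apply: le_trans (fast _ _ (leq_maxl m k)).
  rewrite le_eqVlt; apply/orP; left; apply/eqP; apply: eq_Rintegral => w _.
  by rewrite !ipxx distrC.
have X2' : sqint X.
  by apply: (sqint_l2_close mX (X2 0%N)); apply: le_lt_trans (bound 0%N) (ltry _).
exists X; split => // m.
by rewrite -lee_fin -integral_norm2//; exact: sqintB.
Qed.

Lemma l2_complete (Xn : nat -> T -> V) : (forall n, sqint (Xn n)) ->
  (forall e : R, 0 < e -> exists N, forall m n, (N <= m)%N -> (N <= n)%N ->
    l2dot (fun w => Xn n w - Xn m w) (fun w => Xn n w - Xn m w) <= e) ->
  exists2 X, sqint X & l2to Xn X.
Proof.
move=> X2 cau.
have {cau}[N hN] : exists N : nat -> nat, forall k m n, (N k <= m)%N -> (N k <= n)%N ->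
    l2dot (fun w => Xn n w - Xn m w) (fun w => Xn n w - Xn m w) <= 4 ^- k.
  have h k : exists N, forall m n, (N <= m)%N -> (N <= n)%N ->
    l2dot (fun w => Xn n w - Xn m w) (fun w => Xn n w - Xn m w) <= 4 ^- k.
    by apply: cau; rewrite invr_gt0 exprn_gt0.
  by have [N hN] := choice h; exists N.
(* A running maximum, so that [M n] is beyond every threshold [N m] with m <= n. *)
pose M k := \max_(i < k.+1) N i.
have NM i k : (i <= k)%N -> (N i <= M k)%N.
  by move=> ik; exact: (@leq_bigmax _ (fun i : 'I_k.+1 => N i) (Ordinal (ik : (i < k.+1)%N))).
have [X [sX hX]] := @l2_complete_fast (fun k => Xn (M k)) (fun k => X2 (M k))
  (fun m n mn => hN m _ _ (NM _ _ (leqnn m)) (NM _ _ mn)).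
exists X => //.
apply/cvgrPdist_le => e e0.
(* The factor 4 comes from |x + y|^2 <= 2|x|^2 + 2|y|^2 with both squares at most 4^(-k). *)
have [k ke] : exists k : nat, 4 * 4 ^- k <= e.
  have : (fun k : nat => 4 * (4^-1 : R) ^+ k) @ \oo --> 4 * (0 : R).
    apply: cvgM; first exact: cvg_cst.
    by apply: cvg_expr; rewrite ger0_norm ?invr_ge0// invf_lt1// ltr1n.
  rewrite mulr0 => /cvgrPdist_le/(_ _ e0)[k _ /(_ k (leqnn k))].
  rewrite /= sub0r normrN ger0_norm ?mulr_ge0 ?exprn_ge0 ?invr_ge0// => h.
  by exists k; rewrite -exprVn.
near=> n.
rewrite sub0r normrN ger0_norm ?l2dot_ge0//.
have nk : (N k <= n)%N by near: n; exists (N k).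
have h1 := hN k _ _ (NM _ _ (leqnn k)) nk; have h2 := hX k.
apply: le_trans ke; move: h1 h2.
set x := (fun w => Xn n w - Xn (M k) w); set y := (fun w => _ - X w) => h1 h2.
have x2 : sqint x by exact: sqintB.
have y2 : sqint y by exact: sqintB.
have -> : (fun w => Xn n w - X w) = (fun w => x w + y w).
  by apply/funext => w; rewrite /x /y addrA subrK.
clearbody x y; have := l2dot_ge0 (fun w => x w - y w).
rewrite !(l2dotBl, l2dotBr, l2dotDl, l2dotDr)//; try exact: sqintB; try exact: sqintD.
move: (4 ^- k) h1 h2 => p; rewrite (l2dotC y x); lra.
Unshelve. all: by end_near. Qed.

End square_integrable.

(** * Independence and Gaussian moments *)

Section change_of_measure.
Context {R : realType} {d1 d2 : measure_display}.
Context {T1 : measurableType d1} {T2 : measurableType d2}.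
Variables (m1 : {measure set T1 -> \bar R}) (m2 : {measure set T2 -> \bar R}).
Variables (phi : T2 -> T1) (W : T2 -> R).
Hypotheses (mphi : measurable_fun setT phi) (mW : measurable_fun setT W).
Hypothesis W0 : forall w, 0 <= W w.
Hypothesis m1E : forall B, measurable B -> m1 B = (\int[m2]_w ((\1_B (phi w))%:E * (W w)%:E))%E.
Import HBNNSimple.

Let integral_nnsfun_weight (h : {nnsfun T1 >-> R}) :
  (\int[m1]_x (h x)%:E = \int[m2]_w ((h (phi w))%:E * (W w)%:E))%E.
Proof.
have mh r : measurable (h @^-1` [set r]) by [].
have h0 r : r \in range h -> 0 <= r by rewrite inE => -[x _ <-].
have mI r : measurable_fun setT (fun w => ((\1_(h @^-1` [set r]) (phi w))%:E * (W w)%:E)%E).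
  apply: emeasurable_funM; apply/measurable_EFinP => //.
  by apply: measurableT_comp => //; exact: measurable_indic.
rewrite integralT_nnsfun sintegralE fsbig_finite//=.
transitivity (\int[m2]_w (\sum_(r <- finmap.enum_fset (fset_set (range h)))
    (r%:E * ((\1_(h @^-1` [set r]) (phi w))%:E * (W w)%:E))))%E; last first.
  apply: eq_integral => w _; rewrite fimfunE fsbig_finite//= -sumEFin.
  rewrite big_seq_cond [in RHS]big_seq_cond ge0_sume_distrl; last first.
    move=> r /andP[rh _]; rewrite lee_fin mulr_ge0//.
    by apply: h0; move: rh; rewrite in_fset_set.
  by apply: eq_bigr => r _; rewrite EFinM muleA.
(* [ge0_integral_sum] asks for nonnegative terms at every index r, while r >= 0 is known only on the
   range of h; the maximum with 0 changes nothing there. *)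
rewrite (eq_integral (fun w => \sum_(r <- finmap.enum_fset (fset_set (range h)))
    ((Num.max r 0)%:E * ((\1_(h @^-1` [set r]) (phi w))%:E * (W w)%:E)))%E); last first.
  move=> w _; rewrite big_seq_cond [in RHS]big_seq_cond; apply: eq_bigr => r /andP[rh _].
  by rewrite max_l// h0//; move: rh; rewrite in_fset_set.
rewrite ge0_integral_sum//; last 2 first.
- by move=> r; apply: emeasurable_funM => //; exact: mI.
- move=> r w _; apply: mule_ge0; first by rewrite lee_fin le_max lexx orbT.
  by rewrite mule_ge0 ?lee_fin.
rewrite big_seq_cond [in RHS]big_seq_cond; apply: eq_bigr => r /andP[rh _].
rewrite ge0_integralZl_EFin ?le_max ?lexx ?orbT//; last first.
  by move=> w _; rewrite mule_ge0 ?lee_fin.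
by rewrite -m1E// max_l// h0//; move: rh; rewrite in_fset_set.
Qed.

(** [m1E] says that m1 is the image under phi of the measure with density W. The formula extends
    from indicators to simple functions and then to monotone limits. *)
Lemma integral_weight (f : T1 -> \bar R) : measurable_fun setT f -> (forall x, (0 <= f x)%E) ->
  (\int[m1]_x f x = \int[m2]_w (f (phi w) * (W w)%:E))%E.
Proof.
move=> mf f0; pose g := nnsfun_approx measurableT mf.
have gf x : (g n x)%:E @[n --> \oo] --> f x.
  exact: (cvg_nnsfun_approx measurableT mf (fun x _ => f0 x)).
have c1 : (\int[m1]_x (g n x)%:E)%E @[n --> \oo] --> (\int[m1]_x f x)%E.
  rewrite (_ : f = fun x => limn (fun n => (g n x)%:E)); last first.
    by apply/funext => x; apply/esym/cvg_lim.
  apply: cvg_monotone_convergence => //.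
  - by move=> n; apply/measurable_EFinP.
  - by move=> n x _; rewrite lee_fin.
  - by move=> x _ m n mn; rewrite lee_fin; exact/lefP/nd_nnsfun_approx.
have c2 : (\int[m2]_w ((g n (phi w))%:E * (W w)%:E))%E @[n --> \oo] -->
    (\int[m2]_w (f (phi w) * (W w)%:E))%E.
  rewrite (_ : (fun w => f (phi w) * (W w)%:E)%E =
      fun w => limn (fun n => ((g n (phi w))%:E * (W w)%:E)%E)); last first.
    apply/funext => w; apply/esym/cvg_lim => //.
    by apply: cvgeZr.
  apply: cvg_monotone_convergence => //.
  - move=> n; apply: emeasurable_funM; apply/measurable_EFinP => //.
    by apply: (measurableT_comp (f := g n)).
  - by move=> n w _; rewrite mule_ge0 ?lee_fin.
  - move=> w _ m n mn; apply: lee_wpmul2r; first by rewrite lee_fin.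
    by rewrite lee_fin; exact/lefP/nd_nnsfun_approx.
apply: (cvg_unique _ c1) => //.
suff -> : (fun n => \int[m1]_x (g n x)%:E)%E = (fun n => \int[m2]_w ((g n (phi w))%:E * (W w)%:E))%E by [].
by apply/funext => n; rewrite integral_nnsfun_weight.
Qed.

End change_of_measure.

Section independent_products.
Context {R : realType} {d : measure_display} {Omega : measurableType d}.
Variable P : probability Omega R.
Context {I : choiceType}.
Variables (J : set I) (zeta : I -> Omega -> R).
Hypothesis mzeta : forall i, measurable_fun setT (zeta i).
Hypothesis indep : forall (js : seq I) (C : I -> set R), uniq js ->
  (forall j, j \in js -> J j) -> (forall j, measurable (C j)) ->
  P (\bigcap_(j in [set` js]) (zeta j @^-1` C j)) = (\prod_(j <- js) P (zeta j @^-1` C j))%E.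

Definition mean (F : I -> R -> R) j : R := \int[P]_w F j (zeta j w).

Definition indic_part js (C : I -> set R) w : R := \prod_(j <- js) \1_(C j) (zeta j w).
Definition fun_part js (F : I -> R -> R) w : R := \prod_(j <- js) F j (zeta j w).

Let fun_part_cons j js F w : fun_part (j :: js) F w = F j (zeta j w) * fun_part js F w.
Proof. by rewrite /fun_part big_cons. Qed.

Let measurable_indic_part js C : (forall j, measurable (C j)) ->
  measurable_fun setT (indic_part js C).
Proof.
move=> mC; apply: measurable_prod => j _.
by apply: measurableT_comp => //; exact: measurable_indic.
Qed.

Let measurable_fun_part js F : (forall j, measurable_fun setT (F j)) ->
  measurable_fun setT (fun_part js F).
Proof. by move=> mF; apply: measurable_prod => j _; exact: measurableT_comp. Qed.

Let indic_part_ge0 js C w : 0 <= indic_part js C w.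
Proof. by apply: prodr_ge0 => j _; rewrite indicE ler0n. Qed.

(* Indicators of the coordinates in [js1] are replaced by nonnegative functions
   one coordinate at a time: a factor independent of the rest defines the same
   measure as its mean times the law of the coordinate. *)
Let product_ge0 js1 js2 (C : I -> set R) (F : I -> R -> R) :
  uniq (js1 ++ js2) -> (forall j, j \in js1 ++ js2 -> J j) ->
  (forall j, measurable (C j)) -> (forall j, measurable_fun setT (F j)) ->
  (forall j x, j \in js2 -> 0 <= F j x) ->
  (forall j, j \in js2 -> P.-integrable setT (fun w => (F j (zeta j w))%:E)) ->
  (\int[P]_w (indic_part js1 C w * fun_part js2 F w)%:E =
   (\prod_(j <- js1) fine (P (zeta j @^-1` C j)) * \prod_(j <- js2) mean F j)%:E)%E.
Proof.
elim: js2 js1 C => [|j js2 IH] js1 C ujs jsJ mC mF F0 iF.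
  rewrite big_nil mulr1.
  have mzC j : measurable (zeta j @^-1` C j).
    by rewrite -[X in measurable X]setTI; exact: mzeta.
  transitivity (P (\bigcap_(j in [set` js1]) (zeta j @^-1` C j))).
    transitivity (\int[P]_w (\1_(\bigcap_(j in [set` js1]) (zeta j @^-1` C j)) w)%:E)%E.
      apply: eq_integral => w _; rewrite /fun_part big_nil mulr1 /indic_part.
      congr EFin; rewrite bigcap_seq; elim: (js1) => [|i js IHjs].
        by rewrite !big_nil indicE in_setT.
      by rewrite !big_cons IHjs !indicE in_setI -natrM mulnb.
    rewrite integral_indic// ?setIT//.
    by rewrite bigcap_seq; apply: bigsetI_measurable => i _.
  rewrite indep//; last 2 first.
  - by move: ujs; rewrite cats0.
  - by move=> i ijs; apply: jsJ; rewrite cats0.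
  elim: (js1) => [|i js IHjs]; first by rewrite !big_nil.
  by rewrite !big_cons IHjs EFinM fineK// fin_num_measure.
have jjs1 : j \notin js1.
  by move: ujs; rewrite cat_uniq /= negb_or => /and3P[_ /andP[]].
have m0 i : i \in j :: js2 -> 0 <= mean F i.
  by move=> ijs; apply: Rintegral_ge0 => w _; exact: F0.
pose c := \prod_(i <- js1) fine (P (zeta i @^-1` C i)) * \prod_(i <- js2) mean F i.
have c0 : 0 <= c.
  apply: mulr_ge0; first by apply: prodr_ge0 => i _; rewrite fine_ge0.
  by rewrite big_seq_cond; apply: prodr_ge0 => i /andP[ijs _]; rewrite m0// inE ijs orbT.
pose W w := indic_part js1 C w * fun_part js2 F w.
have fun_part_ge0 w : 0 <= fun_part js2 F w.
  rewrite /fun_part big_seq_cond; apply: prodr_ge0 => i /andP[ijs _].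
  by rewrite F0// inE ijs orbT.
have mW : measurable_fun setT W.
  by apply: measurable_funM; [exact: measurable_indic_part|exact: measurable_fun_part].
have IHW B : measurable B -> ((NngNum c0)%:num%:E * P (zeta j @^-1` B) =
    \int[P]_w ((\1_B (zeta j w))%:E * (W w)%:E))%E.
  (* The indicator of B becomes the condition on coordinate j in the first list, so the induction
     hypothesis applies with one function fewer. *)
  move=> mB; pose C' i := if i == j then B else C i.
  have eC (js : seq I) (K : I -> set R -> R) : j \notin js ->
      \prod_(i <- js) K i (C' i) = \prod_(i <- js) K i (C i).
    move=> jjs; rewrite big_seq_cond [RHS]big_seq_cond; apply: eq_bigr => i /andP[ijs _].
    by rewrite /C'; case: eqP => // ij; move: jjs; rewrite -ij ijs.
  transitivity (\int[P]_w (indic_part (j :: js1) C' w * fun_part js2 F w)%:E)%E; last first.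
    apply: eq_integral => w _; rewrite -EFinM /W /indic_part big_cons.
    rewrite (eC js1 (fun i D => \1_D (zeta i w)))// {1}/C' eqxx.
    by rewrite mulrA.
  have pe : perm_eq ((j :: js1) ++ js2) (js1 ++ j :: js2).
    by rewrite -cat1s -catA perm_catCA.
  rewrite IH.
  - rewrite big_cons (eC js1 (fun i D => fine (P (zeta i @^-1` D))))// {1}/C' eqxx.
    have Pj : P (zeta j @^-1` B) \is a fin_num.
      apply: fin_num_measure.
      by rewrite -[X in measurable X]setTI; exact: mzeta.
    by rewrite -mulrA [RHS]EFinM fineK// muleC.
  - by rewrite (perm_uniq pe).
  - by move=> i; rewrite (perm_mem pe); exact: jsJ.
  - by move=> i; rewrite /C'; case: ifP.
  - exact: mF.
  - by move=> i x ijs; apply: F0; rewrite inE ijs orbT.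
  - by move=> i ijs; apply: iF; rewrite inE ijs orbT.
have Fj0 x : 0 <= F j x by apply: F0; rewrite inE eqxx.
have mFj : measurable_fun setT (fun x => (F j x)%:E) by exact/measurable_EFinP.
have iFj : P.-integrable setT (fun w => (F j (zeta j w))%:E) by apply: iF; rewrite inE eqxx.
(* By [IHW], c times the law of [zeta j] is the image of the measure with density W; integrating F_j
   against both gives the product formula. *)
have := @integral_weight _ _ _ _ _ (mscale (NngNum c0) (pushforward P (zeta j))) P (zeta j) W
  (mzeta j) mW _ IHW (fun x => (F j x)%:E) mFj _.
have W0 w : 0 <= W w by rewrite mulr_ge0.
have Fj0' (x : R) : (0 <= (F j x)%:E)%E by rewrite lee_fin.
move=> /(_ (mzeta j) W0 Fj0'); rewrite ge0_integral_mscale//.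
rewrite ge0_integral_pushforward//.
move=> h; transitivity (\int[P]_w ((F j (zeta j w))%:E * (W w)%:E))%E.
  apply: eq_integral => w _; rewrite -EFinM /W /fun_part big_cons.
  by rewrite mulrCA.
rewrite -h big_cons /= preimage_setT.
have -> : (\int[P]_w (F j (zeta j w))%:E = (mean F j)%:E)%E.
  by rewrite /mean /Rintegral fineK//; exact: integrable_fin_num iFj.
by rewrite -EFinM mulrC /c mulrCA.
Qed.

(** Induction on the list of signed factors: F_j is the difference of its positive part [G 1 j] and
    negative part [G (-1) j], and each of them moves j to the list of nonnegative factors. *)
Let product_signed js1 js2 (F : I -> R -> R) :
  uniq (js1 ++ js2) -> (forall j, j \in js1 ++ js2 -> J j) ->
  (forall j, measurable_fun setT (F j)) ->
  (forall j x, j \in js2 -> 0 <= F j x) ->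
  (forall j, j \in js1 ++ js2 -> P.-integrable setT (fun w => (F j (zeta j w))%:E)) ->
  P.-integrable setT (fun w => (fun_part js1 F w * fun_part js2 F w)%:E) /\
  \int[P]_w (fun_part js1 F w * fun_part js2 F w) =
   \prod_(j <- js1) mean F j * \prod_(j <- js2) mean F j.
Proof.
elim: js1 js2 F => [|j js1 IH] js2 F ujs jsJ mF F0 iF.
  have fp0 w : 0 <= fun_part js2 F w.
    rewrite /fun_part big_seq_cond; apply: prodr_ge0 => i /andP[ijs _].
    exact: F0.
  have h := product_ge0 ujs jsJ (fun=> measurableT) mF F0 iF.
  have {}h : (\int[P]_w (fun_part [::] F w * fun_part js2 F w)%:E =
      (\prod_(j <- [::]) mean F j * \prod_(j <- js2) mean F j)%:E)%E.
    rewrite !big_nil mul1r in h *; rewrite -h; apply: eq_integral => w _.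
    by rewrite /indic_part /fun_part !big_nil.
  split; last by rewrite /Rintegral h.
  apply/integrableP; split.
    by apply/measurable_EFinP; apply: measurable_funM; exact: measurable_fun_part.
  have fn0 w : 0 <= fun_part [::] F w by rewrite /fun_part big_nil.
  by under eq_integral do rewrite gee0_abs ?lee_fin ?mulr_ge0//; rewrite h ltry.
have jnotin : j \notin js1 ++ js2 by case/andP: ujs.
have iFj : P.-integrable setT (fun w => (F j (zeta j w))%:E) by apply: iF; rewrite inE eqxx.
pose G (e : R) i x := if i == j then Num.max (e * F j x) 0 else F i x.
have eqG (K : I -> (R -> R) -> R) e js : j \notin js ->
    \prod_(i <- js) K i (G e i) = \prod_(i <- js) K i (F i).
  move=> jjs; rewrite big_seq_cond [RHS]big_seq_cond; apply: eq_bigr => i /andP[ijs _].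
  congr (K i _); apply/funext => x; rewrite /G; case: eqP => // ij.
  by move: jjs; rewrite -ij ijs.
have [j1 j2] : j \notin js1 /\ j \notin js2.
  by move: jnotin; rewrite mem_cat negb_or => /andP.
have pe : perm_eq (js1 ++ j :: js2) ((j :: js1) ++ js2).
  by rewrite -[j :: js2]cat1s perm_catCA.
have mG e i : measurable_fun setT (G e i).
  rewrite /G; case: eqP => _ //.
  by apply: measurable_maxr => //; apply: measurable_funM.
have iG e : e ^+ 2 = 1 -> P.-integrable setT (fun w => (G e j (zeta j w))%:E).
  move=> e2; apply: le_integrable iFj => //.
    by apply/measurable_EFinP; exact: measurableT_comp.
  move=> w _; rewrite !abse_EFin lee_fin /G eqxx.
  have e1 : `|e| = 1 by apply/eqP; rewrite -sqr_norm_eq1 e2.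
  have : `|e * F j (zeta j w)| = `|F j (zeta j w)| by rewrite normrM e1 mul1r.
  case: (ltP (e * F j (zeta j w)) 0) => h; first by rewrite normr0.
  by move=> ->.
have IHe e : e ^+ 2 = 1 ->
  P.-integrable setT (fun w => (fun_part js1 F w * (G e j (zeta j w) * fun_part js2 F w))%:E) /\
  \int[P]_w (fun_part js1 F w * (G e j (zeta j w) * fun_part js2 F w)) =
   \prod_(j <- js1) mean F j * (mean (G e) j * \prod_(j <- js2) mean F j).
  move=> e2; have := IH (j :: js2) (G e).
  rewrite (perm_uniq pe) => /(_ ujs).
  have h1 i : i \in js1 ++ j :: js2 -> J i by rewrite (perm_mem pe); exact: jsJ.
  have h2 i x : i \in j :: js2 -> 0 <= G e i x.
    rewrite inE /G; case: eqP => [_ _|_ /= ijs]; last exact: F0.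
    by rewrite le_max lexx orbT.
  have h3 i : i \in js1 ++ j :: js2 -> P.-integrable setT (fun w => (G e i (zeta i w))%:E).
    have [->|ij] := eqVneq i j; first by move=> _; exact: iG.
    by rewrite (perm_mem pe) /G (negbTE ij); exact: iF.
  move=> /(_ h1 (mG e) h2 h3).
  rewrite big_cons (eqG (fun i D => \int[P]_w D (zeta i w)))//.
  rewrite (eqG (fun i D => \int[P]_w D (zeta i w)))//.
  have E js w : j \notin js -> fun_part js (G e) w = fun_part js F w.
    by move=> jjs; rewrite /fun_part (eqG (fun i D => D (zeta i w))).
  have E2 : (fun w => fun_part js1 (G e) w * fun_part (j :: js2) (G e) w) =
     fun w => fun_part js1 F w * (G e j (zeta j w) * fun_part js2 F w).
    by apply/funext => w; rewrite fun_part_cons !E.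
  by rewrite E2; have -> := congr1 (fun h => (fun w => (h w)%:E)) E2.
have sqN1 : (-1) ^+ 2 = 1 :> R by rewrite sqrrN expr1n.
have [ip mp] := IHe 1 (expr1n _ 2); have [im mm] := IHe (-1) sqN1.
have split_F x : F j x = G 1 j x - G (-1) j x.
  by rewrite /G eqxx mul1r mulN1r; case: (ltP (F j x) 0); case: (ltP (- F j x) 0); lra.
have E : (fun w => fun_part (j :: js1) F w * fun_part js2 F w) =
    fun w => fun_part js1 F w * (G 1 j (zeta j w) * fun_part js2 F w) -
             fun_part js1 F w * (G (-1) j (zeta j w) * fun_part js2 F w).
  by apply/funext => w; rewrite fun_part_cons split_F; ring.
split.
  have -> := congr1 (fun h => (fun w => (h w)%:E)) E.
  by under eq_fun do rewrite EFinB; exact: integrableB.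
rewrite E RintegralB// mp mm big_cons.
have -> : mean F j = mean (G 1) j - mean (G (-1)) j.
  rewrite /mean -RintegralB//; last 2 first.
  - by apply: iG; rewrite expr1n.
  - by apply: iG; rewrite sqrrN expr1n.
  by apply: eq_Rintegral => w _.
by ring.
Qed.

Lemma independent_product js (F : I -> R -> R) :
  uniq js -> (forall j, j \in js -> J j) -> (forall j, measurable_fun setT (F j)) ->
  (forall j, j \in js -> P.-integrable setT (fun w => (F j (zeta j w))%:E)) ->
  P.-integrable setT (fun w => (\prod_(j <- js) F j (zeta j w))%:E) /\
  \int[P]_w (\prod_(j <- js) F j (zeta j w)) = \prod_(j <- js) \int[P]_w F j (zeta j w).
Proof.
move=> ujs jsJ mF iF.
have E : (fun w => fun_part js F w * fun_part [::] F w) =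
    fun w => \prod_(j <- js) F j (zeta j w).
  by apply/funext => w; rewrite /fun_part big_nil mulr1.
have := @product_signed js [::] F; rewrite cats0 big_nil mulr1 => /(_ ujs jsJ mF _ iF)[//|].
rewrite E => ip mp; split => //.
by have <- := congr1 (fun h => (fun w => (h w)%:E)) E.
Qed.

End independent_products.

(** * Gaussian moments *)

Section gaussian_moments.
Context {R : realType}.
Notation mu := (@lebesgue_measure R).
Variables (c k : R).
Hypotheses (c0 : 0 <= c) (k0 : 0 < k).
Let g (x : R) : R := c * expR (- (k * x ^+ 2)).

Let g_ge0 x : 0 <= g x. Proof. by rewrite mulr_ge0 ?expR_ge0. Qed.

Let is_derive_g x : is_derive x (1 : R) g (- (2 * k * x) * g x).
Proof.
have d1 : is_derive x 1 (fun x : R => - (k * x ^+ 2)) (- (k * (2 * x))).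
  have h := is_deriveN (is_deriveZ k (is_deriveM (is_derive_id x 1) (is_derive_id x 1))).
  by apply: (is_derive_eq h); rewrite /GRing.scale /=; ring.
have d2 := @is_derive1_comp _ expR (fun x => - (k * x ^+ 2)) x _ _ (is_derive_expR _) d1.
apply: (is_derive_eq (is_deriveZ c d2)).
by rewrite /GRing.scale /g /=; ring.
Qed.

Let continuous_g : continuous g.
Proof. by move=> x; apply: is_derive_continuous (is_derive_g x). Qed.

Let measurable_g (B : set R) : measurable_fun B g.
Proof. by apply: measurable_funTS; exact: continuous_measurable_fun. Qed.

Let cvg_g : g x @[x --> +oo%R] --> 0.
Proof.
rewrite -(mulr0 c); apply: cvgM; first exact: cvg_cst.
apply: (cvg_comp (fun x => k * x ^+ 2) (fun x => expR (- x))); last exact: cvgr_expR.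
by apply: gt0_cvgMry => //; exact: cvgr_expr2.
Qed.

Lemma gaussian_integral_id y : 0 <= y ->
  (\int[mu]_(x in `[y, +oo[) (x * g x)%:E = (g y / (2 * k))%:E)%E.
Proof.
move=> y0; have -> : (g y / (2 * k))%:E = (0%:E - (- (2 * k)^-1 * g y)%:E)%E.
  by rewrite -EFinB; congr EFin; ring.
have dF x : is_derive x (1 : R) (fun x => - (2 * k)^-1 * g x) (x * g x).
  apply: (is_derive_eq (is_deriveZ (- (2 * k)^-1) (is_derive_g x))).
  by rewrite /GRing.scale /=; field; rewrite ?gt_eqF.
apply: (@ge0_continuous_FTC2y _ _ (fun x => - (2 * k)^-1 * g x)).
- by move=> x yx; rewrite mulr_ge0// (le_trans y0).
- apply: continuous_subspaceT => x.
  by apply: cvgM; [exact: cvg_id|exact: continuous_g].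
- rewrite -(mulr0 (- (2 * k)^-1)); apply: cvgM; first exact: cvg_cst.
  exact: cvg_g.
- by move=> x _; have [] := dF x.
- have : {for y, continuous (fun x => - (2 * k)^-1 * g x)} by exact: is_derive_continuous (dF y).
  exact: cvg_at_right_filter.
- by move=> x _; rewrite derive1E; have [] := dF x.
Qed.

Let trapezoid (p : R * R) : R := if 0 <= p.2 <= p.1 then p.1 * g p.1 else 0.

Let trapezoid_ge0 p : (0 <= (trapezoid p)%:E)%E.
Proof.
rewrite lee_fin /trapezoid; case: ifP => // /andP[h1 h2].
by rewrite mulr_ge0// (le_trans h1).
Qed.

Let measurable_trapezoid : measurable_fun setT (fun p => (trapezoid p)%:E).
Proof.
apply/measurable_EFinP; apply: measurable_fun_ifT => //.
  by apply: measurable_and; apply: measurable_fun_ler.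
by apply: measurable_funM => //; apply: measurableT_comp.
Qed.

(* Tonelli's theorem for [x g(x)] over [0 <= y <= x]. *)
Lemma gaussian_integral_sqr_half :
  (\int[mu]_(x in `[0%R, +oo[) (x ^+ 2 * g x)%:E =
   (2 * k)^-1%:E * \int[mu]_(x in `[0%R, +oo[) (g x)%:E)%E.
Proof.
have ray (f : R -> R) y : (\int[mu]_(x in `[y, +oo[) (f x)%:E =
    \int[mu]_x (if y <= x then f x else 0)%:E)%E.
  rewrite integral_mkcond; apply: eq_integral => x _; rewrite patchE.
  case: ifPn => [|/negP]; rewrite inE /= in_itv/= andbT; first by move=> ->.
  by case: ifP.
have := @fubini_tonelli _ _ _ _ _ mu mu (fun p => (trapezoid p)%:E) measurable_trapezoid trapezoid_ge0.
under eq_integral => x _.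
  rewrite (_ : (\int[mu]_y (trapezoid (x, y))%:E)%E =
    (if 0 <= x then x ^+ 2 * g x else 0)%:E); last first.
    have [x0|x0] := leP 0 x; last first.
      rewrite integral0_eq// => y _; rewrite /trapezoid /=; case: ifP => // /andP[h1 h2].
      by have := le_lt_trans (le_trans h1 h2) x0; rewrite ltxx.
    transitivity (\int[mu]_(y in `[0%R, x]) (cst (x * g x)%:E y))%E.
      rewrite [RHS]integral_mkcond; apply: eq_integral => y _; rewrite patchE /trapezoid /=.
      by rewrite mem_setE in_itv/=; case: ifP.
    rewrite integral_cst//.
    rewrite [X in (_ * X)%E]lebesgue_measure_itv/= lte_fin oppr0 adde0.
    case: ltP => [_|h]; first by rewrite -EFinM; congr EFin; ring.
    have -> : x = 0 by apply/eqP; rewrite eq_le h x0.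
    by rewrite mule0 expr0n mul0r.
  over.
under [in RHS]eq_integral => y _.
  rewrite (_ : (\int[mu]_x (trapezoid (x, y))%:E)%E =
    ((2 * k)^-1%:E * (if 0 <= y then g y else 0)%:E)%E); last first.
    have [y0|y0] := leP 0 y; last first.
      rewrite mule0 integral0_eq// => x _; rewrite /trapezoid /=; case: ifP => // /andP[h1 _].
      by have := le_lt_trans h1 y0; rewrite ltxx.
    rewrite -EFinM mulrC -gaussian_integral_id// ray.
    by apply: eq_integral => x _; rewrite /trapezoid /= y0.
  over.
rewrite -ray ge0_integralZl_EFin//; first last.
- by rewrite invr_ge0 mulr_ge0// ltW.
- apply/measurable_EFinP; apply: measurable_fun_ifT => //.
    exact: measurable_fun_ler.
  exact: measurable_g.
- by move=> y _; case: ifP; rewrite lee_fin.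
by rewrite -ray.
Qed.

Lemma gaussian_integral_sqr :
  (\int[mu]_x (x ^+ 2 * g x)%:E = (2 * k)^-1%:E * \int[mu]_x (g x)%:E)%E.
Proof.
have evg x : g x = g (- x) by rewrite /g sqrrN.
rewrite (@ge0_symfun_integralT _ (fun x => x ^+ 2 * g x)); first last.
- by move=> x /=; rewrite sqrrN evg.
- by move=> x; apply: cvgM; [exact: exprn_continuous|exact: continuous_g].
- by move=> x; rewrite mulr_ge0 ?sqr_ge0.
rewrite ge0_symfun_integralT//.
rewrite -set_itvcy gaussian_integral_sqr_half !muleA; congr (_ * _)%E.
exact: muleC.
Qed.

Lemma gaussian_integral_pos :
  (\int[mu]_x (Num.max x 0 * g x)%:E = (c / (2 * k))%:E)%E.
Proof.
transitivity (\int[mu]_(x in `[0%R, +oo[) (x * g x)%:E)%E.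
  rewrite [RHS]integral_mkcond; apply: eq_integral => x _; rewrite patchE.
  case: ifPn => [|/negP]; rewrite inE /= in_itv/= andbT.
    by move=> x0; rewrite max_l.
  by move=> /negP; rewrite -ltNge => x0; rewrite max_r ?mul0r// ltW.
by rewrite gaussian_integral_id// /g expr0n mulr0 oppr0 expR0 mulr1.
Qed.

Lemma gaussian_integral_abs :
  (\int[mu]_x (`|x| * g x)%:E = (2 * (c / (2 * k)))%:E)%E.
Proof.
have evg x : g x = g (- x) by rewrite /g sqrrN.
rewrite (@ge0_symfun_integralT _ (fun x => `|x| * g x)); first last.
- by move=> x /=; rewrite normrN evg.
- by move=> x; apply: cvgM; [exact: norm_continuous|exact: continuous_g].
- by move=> x; rewrite mulr_ge0.
rewrite EFinM; congr (_ * _)%E.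
transitivity (\int[mu]_(x in `[0%R, +oo[) (x * g x)%:E)%E.
  rewrite -set_itvcy; apply: eq_integral => x.
  by rewrite inE /= in_itv/= andbT => x0; rewrite ger0_norm.
by rewrite gaussian_integral_id// /g expr0n mulr0 oppr0 expR0 mulr1.
Qed.

End gaussian_moments.

Section normal_law.
Context {R : realType} {d : measure_display} {Omega : measurableType d}.
Variables (P : probability Omega R) (X : Omega -> R) (s : R).
Notation mu := (@lebesgue_measure R).
Hypotheses (s0 : 0 < s) (mX : measurable_fun setT X).
Hypothesis law : forall C, measurable C -> P (X @^-1` C) = normal_prob 0 s C.

Lemma integral_normal_law (F : R -> R) : measurable_fun setT F -> (forall x, 0 <= F x) ->
  (\int[P]_w (F (X w))%:E = \int[mu]_x (F x * normal_pdf 0 s x)%:E)%E.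
Proof.
move=> mF F0; have mEF : measurable_fun setT (fun x => (F x)%:E) by exact/measurable_EFinP.
have F0' x : (0 <= (F x)%:E)%E by rewrite lee_fin.
have dens B : measurable B -> P (X @^-1` B) =
    (\int[mu]_x ((\1_B (id x))%:E * (normal_pdf 0 s x)%:E))%E.
  move=> mB; rewrite law// /normal_prob integral_mkcond; apply: eq_integral => x _.
  by rewrite patchE indicE; case: (x \in B); rewrite ?mul1e ?mul0e.
have := @integral_weight _ _ _ _ _ (pushforward P X) mu id (normal_pdf 0 s)
  _ _ _ dens _ mEF F0'.
move=> /(_ mX (@measurable_id _ _ _) (measurable_normal_pdf 0 s) (normal_pdf_ge0 0 s)).
by rewrite ge0_integral_pushforward// preimage_setT.
Qed.

Let c := normal_peak s.
Let k := (s ^+ 2 *+ 2)^-1.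

Let pdfE x : normal_pdf 0 s x = c * expR (- (k * x ^+ 2)).
Proof. rewrite normal_pdfE ?gt_eqF// /normal_fun subr0; congr (_ * expR _); rewrite -/k.
by rewrite mulNr mulrC. Qed.

Let c_ge0 : 0 <= c. Proof. exact: normal_peak_ge0. Qed.

Let k_gt0 : 0 < k. Proof. by rewrite invr_gt0 pmulrn_lgt0// exprn_gt0. Qed.

Let kE : (2 * k)^-1 = s ^+ 2.
Proof. by rewrite /k; field; rewrite gt_eqF. Qed.

Lemma normal_law_sqr : (\int[P]_w (X w ^+ 2)%:E = (s ^+ 2)%:E)%E.
Proof.
rewrite (@integral_normal_law (fun x => x ^+ 2)); last 2 first.
- exact: exprn_measurable.
- by move=> x; exact: sqr_ge0.
under eq_integral do rewrite pdfE.
rewrite gaussian_integral_sqr// kE; under eq_integral do rewrite -pdfE.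
by rewrite integral_normal_pdf mule1.
Qed.

(** The mean is reduced to integrals of nonnegative functions through X = 2 max(X, 0) - |X|, whose
    two terms have equal integrals. *)
Lemma normal_law_mean : P.-integrable setT (fun w => (X w)%:E) /\ \int[P]_w X w = 0.
Proof.
have absX : (\int[P]_w `|X w|%:E = (2 * (c / (2 * k)))%:E)%E.
  rewrite (@integral_normal_law (fun x => `|x|))//.
  by under eq_integral do rewrite pdfE; rewrite gaussian_integral_abs.
have posX : (\int[P]_w (Num.max (X w) 0)%:E = (c / (2 * k))%:E)%E.
  rewrite (@integral_normal_law (fun x => Num.max x 0)); last 2 first.
  - by apply: measurable_maxr.
  - by move=> x; rewrite le_max lexx orbT.
  by under eq_integral do rewrite pdfE; rewrite gaussian_integral_pos.
have iX : P.-integrable setT (fun w => (X w)%:E).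
  apply/integrableP; split; first exact/measurable_EFinP.
  by under eq_integral do rewrite abse_EFin; rewrite absX ltry.
split => //.
have iabs : P.-integrable setT (fun w => `|X w|%:E) by exact: integrable_norm.
have ipos : P.-integrable setT (fun w => (Num.max (X w) 0)%:E).
  apply: le_integrable iX => //.
    by apply/measurable_EFinP; exact: measurable_maxr.
  move=> w _; rewrite !abse_EFin lee_fin; case: (ltP (X w) 0) => h //.
  by rewrite normr0.
have -> : \int[P]_w X w = \int[P]_w (2 * Num.max (X w) 0) - \int[P]_w `|X w|.
  rewrite -RintegralB//; last first.
    exact: (integrableZl measurableT 2 ipos).
  apply: eq_Rintegral => w _; case: (ltP (X w) 0) => h.
    by rewrite ltr0_norm//; ring.
  by rewrite ger0_norm//; ring.
by rewrite RintegralZl// /Rintegral absX posX /=; ring.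
Qed.

End normal_law.

Section scalar_l2.
Context {R : realType} {d : measure_display} {T : measurableType d}.
Variable mu : {measure set T -> \bar R}.
Implicit Types X Y : T -> R^o.

Lemma sqint_scalarP X : sqint mu X <->
  measurable_fun setT (X : T -> R) /\ (\int[mu]_w (X w ^+ 2)%:E < +oo)%E.
Proof.
have E : (\int[mu]_w (`|X w| ^+ 2)%:E = \int[mu]_w (X w ^+ 2)%:E)%E.
  by apply: eq_integral => w _; rewrite real_normK ?num_real.
split => -[mX X2].
  split; last by rewrite -E.
  by have := mX (1 : R^o); under eq_fun do rewrite /ip /= mulr1.
by split; [move=> v; exact: measurable_funM|rewrite E].
Qed.

Lemma l2dot_scalarE X Y : l2dot mu X Y = \int[mu]_w (X w * Y w).
Proof. by []. Qed.

End scalar_l2.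

(** * Double integrals of step kernels *)

Section refinement.
Context {R : realType}.
Implicit Types (L : seq R) (f : R -> R).

(* The endpoints of all intervals involved are collected in one subdivision, whose
   increments are jointly independent. *)
Definition refine_pt L k : R := nth 0 (sort <=%O (undup L)) k.

Definition refine_size L : nat := (size (undup L)).-1.

Let srt L := sort <=%O (undup L).

Let srt_sorted L : sorted <%O (srt L).
Proof. by rewrite sort_lt_sorted undup_uniq. Qed.

Lemma refine_pt_lt L k : (k < refine_size L)%N -> refine_pt L k < refine_pt L k.+1.
Proof.
rewrite /refine_size ltn_predRL => kL; rewrite /refine_pt lt_sorted_ltn_nth ?srt_sorted//.
  by rewrite inE size_sort (ltn_trans _ kL).
by rewrite inE size_sort.
Qed.

Lemma refine_subdivision L (T : R) : L != [::] -> (forall x, x \in L -> 0 <= x <= T) ->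
  subdivision T (refine_size L) (refine_pt L).
Proof.
move=> L0 LT; have sz : (refine_size L < size (undup L))%N.
  rewrite /refine_size prednK// lt0n size_eq0; apply: contra L0 => /eqP uL.
  by have := undup_nil uL; move=> ->.
have mem k : (k < size (undup L))%N -> refine_pt L k \in L.
  by move=> kL; rewrite -mem_undup -(mem_sort <=%O) mem_nth// size_sort.
split.
- by have /LT/andP[] := mem 0%N (leq_ltn_trans (leq0n _) sz).
- by move=> k kL; exact/ltW/refine_pt_lt.
- by have /LT/andP[] := mem _ sz.
Qed.

(** Tells whether the k-th cell of the refinement lies in ]a, b]: when b is a point of L, a cell
    that starts before b also ends by b. *)
Definition block L (a b : R) k : R := (a <= refine_pt L k < b)%R%:R.

Lemma refine_telescope L a b f : a \in L -> b \in L -> a <= b ->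
  f b - f a = \sum_(k < refine_size L) block L a b k * (f (refine_pt L k.+1) - f (refine_pt L k)).
Proof.
move=> aL bL ab.
have mem x : x \in L -> (index x (srt L) < size (undup L))%N /\ refine_pt L (index x (srt L)) = x.
  move=> xL; have xs : x \in srt L by rewrite mem_sort mem_undup.
  split; last by rewrite /refine_pt nth_index.
  by rewrite -[X in (_ < X)%N](size_sort <=%O) index_mem.
have [ia ea] := mem _ aL; have [ib eb] := mem _ bL.
set i := index a _ in ia ea; set j := index b _ in ib eb.
have le_nth x k : (x < size (undup L))%N -> (k < size (undup L))%N ->
    (refine_pt L x <= refine_pt L k) = (x <= k)%N.
  by move=> xL kL; rewrite /refine_pt lt_sorted_leq_nth ?srt_sorted ?inE ?size_sort.
have ij : (i <= j)%N by rewrite -le_nth// ea eb.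
have jN : (j <= refine_size L)%N.
  by rewrite /refine_size -ltnS prednK// (leq_ltn_trans _ ib).
rewrite -[in LHS]ea -[in LHS]eb -(telescope_sumr (fun k => f (refine_pt L k)) ij).
rewrite (big_nat_widen _ _ _ _ _ jN) big_geq_mkord big_mkcond /=.
apply: eq_bigr => k _; rewrite /block.
have kL : (k < size (undup L))%N.
  by apply: leq_trans (ltn_ord k) _; rewrite /refine_size leq_pred.
have -> : (a <= refine_pt L k) = (i <= k)%N by rewrite -{1}ea le_nth.
have -> : (refine_pt L k < b) = (k < j)%N by rewrite ltNge -{1}eb le_nth// -ltnNge.
rewrite andbC.
by case: ifP => _; rewrite ?mul1r ?mul0r.
Qed.

(** The length of the intersection of ]a, b] and ]a', b']. *)
Definition overlap (a b a' b' : R) : R := Num.max 0 (Num.min b b' - Num.max a a').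

Lemma refine_overlap L a b a' b' : a \in L -> b \in L -> a' \in L -> b' \in L ->
  \sum_(k < refine_size L) block L a b k * block L a' b' k *
    (refine_pt L k.+1 - refine_pt L k) = overlap a b a' b'.
Proof.
move=> aL bL a'L b'L.
have E k : block L a b k * block L a' b' k = block L (Num.max a a') (Num.min b b') k.
  by rewrite /block -natrM mulnb ge_max lt_min andbACA.
under eq_bigr do rewrite E.
rewrite /overlap; have [h|h] := leP (Num.max a a') (Num.min b b').
  have mL : Num.max a a' \in L by rewrite /Num.max; case: ifP.
  have mL' : Num.min b b' \in L by rewrite /Num.min; case: ifP.
  by rewrite [RHS]max_r ?subr_ge0//; exact: esym (refine_telescope (fun x => x) mL mL' h).
rewrite [RHS]max_l ?subr_le0 ?ltW//; apply: big1 => k _; rewrite /block.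
case: andP => [[h1 h2]|]; last by rewrite mul0r.
by have := lt_trans (le_lt_trans h1 h2) h; rewrite ltxx.
Qed.

Lemma refine_disjoint L a b a' b' k : b <= a' \/ b' <= a -> block L a b k * block L a' b' k = 0.
Proof.
move=> h; rewrite /block -natrM mulnb.
case: andP => // -[/andP[h1 h2] /andP[h3 h4]].
by case: h => h; [have := lt_le_trans h2 (le_trans h h3)|have := lt_le_trans h4 (le_trans h h1)];
  rewrite ltxx.
Qed.

End refinement.

Section subdivisions.
Context {R : realType}.
Variables (T : R) (n : nat) (tau : nat -> R).
Hypothesis sub : subdivision T n tau.

Lemma subdivision_mono (j k : nat) : (j <= k <= n)%N -> tau j <= tau k.
Proof.
case: sub => _ mono _ /andP[]; elim: k => [|k IH]; first by rewrite leqn0 => /eqP ->.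
rewrite leq_eqVlt => /predU1P[->//|jk] kn.
by apply: le_trans (mono k kn); apply: IH => //; exact: ltnW.
Qed.

Lemma subdivision_bounds (i : nat) : (i < n)%N ->
  [/\ 0 <= tau i, tau i <= tau i.+1 & tau i.+1 <= T].
Proof.
move=> ilt; case: sub => t0 mono tn; split.
- by apply: le_trans t0 _; apply: subdivision_mono; rewrite leq0n ltnW.
- exact: mono.
- by apply: le_trans tn; apply: subdivision_mono; rewrite ilt leqnn.
Qed.

End subdivisions.

(** * Moments of Brownian increments and Wick's formula *)

Section brownian_moments.
Context {R : realType} {d : measure_display} {Omega : measurableType d}.
Variables (P : probability Omega R) (T : R) (B : R -> {RV P >-> R}).
Hypothesis BM : brownian_motion T B.
Implicit Types (s t : R).

Definition increment s t (w : Omega) : R := B t w - B s w.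

Lemma measurable_increment s t : measurable_fun setT (increment s t).
Proof. exact: measurable_funB. Qed.

Lemma increment_moments s t : 0 <= s -> s <= t -> t <= T ->
  [/\ P.-integrable setT (fun w => (increment s t w)%:E),
      P.-integrable setT (fun w => (increment s t w ^+ 2)%:E),
      \int[P]_w increment s t w = 0 &
      \int[P]_w (increment s t w ^+ 2) = t - s].
Proof.
move=> s0 st tT; move: (st); rewrite le_eqVlt => /predU1P[<-|slt].
  have E : increment s s = cst 0 by apply/funext => w; rewrite /increment subrr.
  have E2 : (fun w => increment s s w ^+ 2) = cst 0.
    by apply/funext => w; rewrite E /= expr0n.
  split.
  - by rewrite E; exact: finite_measure_integrable_cst.
  - rewrite (_ : (fun w => _) = cst 0%:E); last by apply/funext => w; rewrite E /= expr0n.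
    exact: finite_measure_integrable_cst.
  - by rewrite E Rintegral_cst// mul0r.
  - by rewrite E2 Rintegral_cst// mul0r subrr.
have s_gt0 : 0 < Num.sqrt (t - s) by rewrite sqrtr_gt0 subr_gt0.
have law C : measurable C -> P (increment s t @^-1` C) = normal_prob 0 (Num.sqrt (t - s)) C.
  by case: BM => _ _ + _ => /(_ s t s0 slt tT C).
have [i1 m1] := normal_law_mean s_gt0 (measurable_increment s t) law.
have m2 := normal_law_sqr s_gt0 (measurable_increment s t) law.
rewrite sqr_sqrtr ?subr_ge0// in m2.
split => //; last by rewrite /Rintegral m2.
apply/integrableP; split.
  by apply/measurable_EFinP; apply: measurable_funX; exact: measurable_increment.
by under eq_integral do rewrite gee0_abs ?lee_fin ?sqr_ge0//; rewrite m2 ltry.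
Qed.

Section subdivision_moments.
Variables (n : nat) (tau : nat -> R).
Hypothesis sub : subdivision T n tau.
Let delta i := increment (tau i) (tau i.+1).
Let len i := tau i.+1 - tau i.

(** Moments of a centered increment of variance [tau i.+1 - tau i]; the default branch is meant for
    m = 2, the largest exponent in [mixed_moment]. *)
Definition increment_moment i (m : nat) : R :=
  match m with 0%N => 1 | 1%N => 0 | _ => tau i.+1 - tau i end.

Lemma mixed_moment (m : nat -> nat) : (forall i, (m i <= 2)%N) ->
  P.-integrable setT (fun w => (\prod_(i <- iota 0 n) delta i w ^+ m i)%:E) /\
  \int[P]_w (\prod_(i <- iota 0 n) delta i w ^+ m i) =
    \prod_(i <- iota 0 n) increment_moment i (m i).
Proof.
move=> m2.
have mom i : (i < n)%N -> P.-integrable setT (fun w => (delta i w ^+ m i)%:E) /\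
    \int[P]_w (delta i w ^+ m i) = increment_moment i (m i).
  move=> /(subdivision_bounds sub)[h1 h2 h3]; have [i1 i2 e1 e2] := increment_moments h1 h2 h3.
  rewrite /increment_moment; case: (m i) (m2 i) => [|[|[|//]]] _ /=.
  - split; first exact: finite_measure_integrable_cst.
    by rewrite -[LHS]/(\int[P]_w cst 1 w) Rintegral_cst// [X in fine X]probability_setT mulr1.
  - by [].
  - by [].
have ind (js : seq nat) (C : nat -> set R) : uniq js ->
    (forall j, j \in js -> [set i | (i < n)%N] j) -> (forall j, measurable (C j)) ->
    P (\bigcap_(j in [set` js]) (delta j @^-1` C j)) = (\prod_(j <- js) P (delta j @^-1` C j))%E.
  move=> ujs jsn mC; case: BM => _ _ _ /(_ n tau sub js (fun j => delta j @^-1` C j) ujs); apply.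
  by move=> j /jsn jn; split => //; exists (C j).
have mdelta i : measurable_fun setT (delta i) by exact: measurable_increment.
have lt_n i : i \in iota 0 n -> (i < n)%N by rewrite mem_iota.
have [ip ep] := @independent_product _ _ _ P _ _ delta mdelta ind (iota 0 n)
  (fun i x => x ^+ m i) (iota_uniq 0 n) lt_n
  (fun i => exprn_measurable (m i)) (fun i h => (mom i (lt_n i h)).1).
split => //; rewrite ep big_seq_cond [RHS]big_seq_cond; apply: eq_bigr => i.
by rewrite andbT => /lt_n /mom[].
Qed.

Let prod_select (I : eqType) (s : seq I) (F : I -> R) r : r \in s -> uniq s ->
  \prod_(i <- s) F i ^+ (i == r) = F r.
Proof.
move=> rs us; rewrite (bigD1_seq r)//= eqxx expr1 big1 ?mulr1// => i /negbTE ->.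
by rewrite expr0.
Qed.

(** As r and s differ, and p and q differ, no increment occurs more than twice. An increment
    occurring exactly once annihilates the expectation, so the two pairs must match, in one order or
    the other. *)
Lemma increment_moment4 (r s p q : nat) : (r < n)%N -> (s < n)%N -> (p < n)%N -> (q < n)%N ->
  r != s -> p != q ->
  P.-integrable setT (fun w => (delta r w * delta s w * (delta p w * delta q w))%:E) /\
  \int[P]_w (delta r w * delta s w * (delta p w * delta q w)) =
    len r * len s * ((p == r)%:R * (q == s)%:R + (p == s)%:R * (q == r)%:R).
Proof.
move=> rn sn pn qn rs pq.
pose m i := ((i == r) + (i == s) + ((i == p) + (i == q)))%N.
have m2 i : (m i <= 2)%N.
  rewrite /m; have [->|ir] := eqVneq i r; have [|is_] := eqVneq _ s;
    have [|ip] := eqVneq _ p; have [|iq] := eqVneq _ q => //; move=> *; subst;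
    by rewrite ?eqxx in rs pq *.
have E : (fun w => \prod_(i <- iota 0 n) delta i w ^+ m i) =
    (fun w => delta r w * delta s w * (delta p w * delta q w)).
  apply/funext => w; rewrite /m.
  under eq_bigr do rewrite !exprD.
  by rewrite !big_split /= !prod_select ?mem_iota ?iota_uniq//.
have [im em] := mixed_moment m2.
rewrite E in em; have -> := esym (congr1 (fun h => (fun w => (h w)%:E)) E).
split => //; rewrite em {em E im}.
have vanish x : (x < n)%N -> m x = 1%N -> \prod_(i <- iota 0 n) increment_moment i (m i) = 0.
  by move=> xn mx; rewrite (bigD1_seq x) ?mem_iota ?iota_uniq//= mx mul0r.
have full : (forall i, m i = ((i == r) + (i == s)).*2) ->
    \prod_(i <- iota 0 n) increment_moment i (m i) = len r * len s.
  move=> mE; rewrite -(@prod_select _ (iota 0 n) len r) ?mem_iota ?iota_uniq//.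
  rewrite -(@prod_select _ (iota 0 n) len s) ?mem_iota ?iota_uniq// -big_split.
  apply: eq_bigr => i _; rewrite mE /=; have [->|ir] := eqVneq i r.
    by rewrite (negbTE rs) /= expr0 mulr1 expr1.
  by have [->|is_] := eqVneq i s; rewrite /= ?expr0 ?expr1 ?mul1r ?mulr1.
have [pr|npr] := eqVneq p r; have [qs|nqs] := eqVneq q s.
- rewrite full; last by move=> i; rewrite /m pr qs addnn.
  by rewrite pr qs (eq_sym s r) (negbTE rs) /=; ring.
- rewrite (vanish q)//; last by rewrite /m -pr (eq_sym q p) (negbTE pq) (negbTE nqs) eqxx.
  by rewrite -pr (eq_sym q p) (negbTE pq) /=; ring.
- rewrite (vanish p)//; last by rewrite /m -qs (negbTE npr) (negbTE pq) eqxx.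
  by rewrite -qs (negbTE pq) /=; ring.
- have [ps|nps] := eqVneq p s; last first.
    rewrite (vanish p)//=; first by ring.
    by rewrite /m (negbTE npr) (negbTE nps) (negbTE pq) eqxx.
  have [qr|nqr] := eqVneq q r.
    by rewrite full /=; [ring|move=> i; rewrite /m ps qr (addnC (i == s)) addnn].
  rewrite (vanish q)//=; first by ring.
  by rewrite /m (negbTE nqr) (negbTE nqs) (eq_sym q p) (negbTE pq) eqxx.
Qed.

Lemma increment_moment2 (r s : nat) : (r < n)%N -> (s < n)%N -> r != s ->
  \int[P]_w (delta r w * delta s w) = 0.
Proof.
move=> rn sn rs.
pose m i := ((i == r) + (i == s))%N.
have m2 i : (m i <= 2)%N by rewrite /m; case: eqP; case: eqP.
have E : (fun w => \prod_(i <- iota 0 n) delta i w ^+ m i) = (fun w => delta r w * delta s w).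
  apply/funext => w; rewrite /m.
  under eq_bigr do rewrite !exprD.
  by rewrite !big_split /= !prod_select ?mem_iota ?iota_uniq//.
have [_] := mixed_moment m2; rewrite E => ->.
by rewrite (bigD1_seq r) ?mem_iota ?iota_uniq//= /m eqxx (negbTE rs) mul0r.
Qed.

Lemma sqint_increment_mul (r s : nat) : (r < n)%N -> (s < n)%N -> r != s ->
  sqint P (fun w => delta r w * delta s w : R^o).
Proof.
move=> rn sn rs; apply/sqint_scalarP; split.
  by apply: measurable_funM; exact: measurable_increment.
have [/integrableP[_ +] _] := increment_moment4 rn sn rn sn rs rs.
rewrite (_ : (fun w => `|_|%E) = fun w => ((delta r w * delta s w) ^+ 2)%:E)//.
by apply/funext => w; rewrite gee0_abs -?expr2// lee_fin sqr_ge0.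
Qed.

End subdivision_moments.

Lemma sqint_cst (c : R^o) : sqint P (fun=> c).
Proof.
apply: sqintP; first exact: weakly_measurable_cst.
exact: finite_measure_integrable_cst.
Qed.

Definition increment_mul (I K : R * R) (w : Omega) : R^o :=
  increment I.1 I.2 w * increment K.1 K.2 w.

Definition interval_in (I : R * R) : Prop := [/\ 0 <= I.1, I.1 <= I.2 & I.2 <= T].

Definition separated (I K : R * R) : Prop := I.2 <= K.1 \/ K.2 <= I.1.

Let wick_expand (L : seq R) (I K : R * R) : separated I K ->
  I.1 \in L -> I.2 \in L -> K.1 \in L -> K.2 \in L -> I.1 <= I.2 -> K.1 <= K.2 ->
  increment_mul I K = fun w => \sum_(r < refine_size L) \sum_(s < refine_size L | s != r)
    (block L I.1 I.2 r * block L K.1 K.2 s) *: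
      (increment (refine_pt L r) (refine_pt L r.+1) w *
       increment (refine_pt L s) (refine_pt L s.+1) w : R^o).
Proof.
move=> sep i1 i2 k1 k2 I12 K12; apply/funext => w; rewrite /increment_mul /increment.
rewrite (refine_telescope (fun x => B x w) i1 i2 I12).
rewrite (refine_telescope (fun x => B x w) k1 k2 K12) mulr_suml.
apply: eq_bigr => r _; rewrite mulr_sumr [LHS](bigD1 r)//=.
rewrite [X in X + _](_ : _ = 0) ?add0r; last first.
  rewrite mulrACA; have -> := refine_disjoint L r sep.
  by rewrite mul0r.
by apply: eq_bigr => s _; rewrite /GRing.scale /= mulrACA.
Qed.

Let wick_points (I K I' K' : R * R) : seq R :=
  [:: I.1; I.2; K.1; K.2; I'.1; I'.2; K'.1; K'.2].

(** Both products are expanded over the cells of one common refinement, where [increment_moment4]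
    leaves the two matchings of cell pairs. The sums of cell lengths then factor into overlaps. *)
Lemma wick (I K I' K' : R * R) :
  interval_in I -> interval_in K -> interval_in I' -> interval_in K' ->
  separated I K -> separated I' K' ->
  [/\ sqint P (increment_mul I K), \int[P]_w increment_mul I K w = 0 &
   l2dot P (increment_mul I K) (increment_mul I' K') =
    overlap I.1 I.2 I'.1 I'.2 * overlap K.1 K.2 K'.1 K'.2 +
    overlap I.1 I.2 K'.1 K'.2 * overlap K.1 K.2 I'.1 I'.2].
Proof.
move=> [i0 i1 i2] [k0 k1 k2] [i0' i1' i2'] [k0' k1' k2'] sIK sIK'.
pose L := wick_points I K I' K'.
have LT x : x \in L -> 0 <= x <= T.
  rewrite !inE => /or4P[/eqP->|/eqP->|/eqP->|/or4P[/eqP->|/eqP->|/eqP->|/orP[]/eqP->]];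
  apply/andP; split; lra.
have sub := refine_subdivision (isT : L != [::]) LT.
have memL x : x \in L -> x \in L by [].
have [I1 I2 K1 K2] : [/\ I.1 \in L, I.2 \in L, K.1 \in L & K.2 \in L].
  by rewrite !inE !eqxx ?orbT.
have [I1' I2' K1' K2'] : [/\ I'.1 \in L, I'.2 \in L, K'.1 \in L & K'.2 \in L].
  by rewrite !inE !eqxx ?orbT.
set N := refine_size L in sub.
pose X (r s : nat) (w : Omega) : R^o :=
  increment (refine_pt L r) (refine_pt L r.+1) w * increment (refine_pt L s) (refine_pt L s.+1) w.
have sX (r s : 'I_N) : s != r -> sqint P (X r s).
  by move=> sr; apply: (sqint_increment_mul sub) => //; rewrite eq_sym.
have sXZ (c : R) (r s : 'I_N) : s != r -> sqint P (fun w => c *: X r s w).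
  by move=> sr; apply: (sqintZ separable_scalars); exact: sX.
have sXs (c : 'I_N -> 'I_N -> R) (r : 'I_N) :
    sqint P (fun w => \sum_(s < N | s != r) c r s *: X r s w).
  by apply: (sqint_sum separable_scalars) => s sr; exact: sXZ.
have EIK := wick_expand sIK I1 I2 K1 K2 i1 k1.
have EIK' := wick_expand sIK' I1' I2' K1' K2' i1' k1'.
pose c J1 J2 (r s : 'I_N) : R := block L J1.1 J1.2 r * block L J2.1 J2.2 s.
have {}EIK : increment_mul I K = fun w => \sum_(r < N) \sum_(s < N | s != r) c I K r s *: X r s w by [].
have {}EIK' : increment_mul I' K' = fun w => \sum_(r < N) \sum_(s < N | s != r) c I' K' r s *: X r s w by [].
pose len (r : 'I_N) : R := refine_pt L r.+1 - refine_pt L r.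
have crr (r : 'I_N) : c I K r r = 0 by exact: refine_disjoint.
have cE J1 J2 (r s : 'I_N) : c J1 J2 r s = block L J1.1 J1.2 r * block L J2.1 J2.2 s by [].
have dotX (r s p q : 'I_N) : s != r -> q != p -> l2dot P (X r s) (X p q) =
    len r * len s * ((p == r)%:R * (q == s)%:R + (p == s)%:R * (q == r)%:R).
  move=> sr qp; rewrite -!val_eqE.
  have rs : val r != val s by rewrite val_eqE eq_sym.
  have pq : val p != val q by rewrite val_eqE eq_sym.
  exact: (increment_moment4 sub (ltn_ord r) (ltn_ord s) (ltn_ord p) (ltn_ord q) rs pq).2.
have meanX (r s : 'I_N) : s != r -> l2dot P (X r s) (fun=> 1 : R^o) = 0.
  move=> sr; have rs : val r != val s by rewrite val_eqE eq_sym.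
  rewrite -[RHS](increment_moment2 sub (ltn_ord r) (ltn_ord s) rs).
  by apply: eq_Rintegral => w _; rewrite /ip /= mulr1.
have s1 := sqint_cst (1 : R^o).
clearbody c X.
split.
- by rewrite EIK; apply: (sqint_sum separable_scalars) => r _.
- have -> : \int[P]_w increment_mul I K w = l2dot P (increment_mul I K) (fun=> 1 : R^o).
    by apply: eq_Rintegral => w _; rewrite /ip /= mulr1.
  rewrite EIK (l2dot_suml separable_scalars)//; apply: big1 => r _.
  rewrite (l2dot_suml separable_scalars)//; last by move=> s; exact: sXZ.
  apply: big1 => s sr; rewrite (l2dotZl separable_scalars) ?meanX ?mulr0//; exact: sX.
rewrite EIK EIK' (l2dot_suml separable_scalars)//; last first.
  by apply: (sqint_sum separable_scalars) => r _.
transitivity (\sum_(r < N) \sum_(s < N | s != r)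
    c I K r s * (len r * len s * (c I' K' r s + c I' K' s r))).
  apply: eq_bigr => r _; rewrite (l2dot_suml separable_scalars)//; last 2 first.
  - by move=> s; exact: sXZ.
  - by apply: (sqint_sum separable_scalars) => p _.
  apply: eq_bigr => s sr; rewrite (l2dotZl separable_scalars)//; last 2 first.
  - exact: sX.
  - by apply: (sqint_sum separable_scalars) => p _.
  congr (_ * _); rewrite (l2dot_sumr separable_scalars)//; last exact: sX.
  transitivity (\sum_(p < N) \sum_(q < N | q != p) (len r * len s * c I' K' p q) *
      ((p == r)%:R * (q == s)%:R + (p == s)%:R * (q == r)%:R)).
    apply: eq_bigr => p _; rewrite (l2dot_sumr separable_scalars)//; last 2 first.
    - by move=> q; exact: sXZ.
    - exact: sX.
    apply: eq_bigr => q qp; rewrite (l2dotZr separable_scalars)//; [|exact: sX..].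
    by rewrite dotX// mulrA [in LHS]mulrC; ring.
  have select (x y : 'I_N) : y != x -> \sum_(p < N) \sum_(q < N | q != p)
      (len r * len s * c I' K' p q) * ((p == x)%:R * (q == y)%:R) = len r * len s * c I' K' x y.
    move=> yx; rewrite (bigD1 x)//= [X in _ + X]big1 ?addr0; last first.
      by move=> p /negbTE px; apply: big1 => q _; rewrite px mul0r mulr0.
    rewrite (bigD1 y)//= big1 ?addr0; last first.
      by move=> q /andP[_ /negbTE qy]; rewrite qy !mulr0.
    by rewrite !eqxx !mulr1.
  rewrite [RHS]mulrDr -(select r s)// -(select s r) 1?eq_sym// -big_split /=.
  by apply: eq_bigr => p _; rewrite -big_split; apply: eq_bigr => q _; rewrite mulrDr.
rewrite -(refine_overlap I1 I2 I1' I2') -(refine_overlap K1 K2 K1' K2').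
rewrite -(refine_overlap I1 I2 K1' K2') -(refine_overlap K1 K2 I1' I2').
rewrite !big_distrlr /= -big_split /=; apply: eq_bigr => r _.
(* The products of overlaps range over all pairs of cells; their diagonal terms contain [c I K r r],
   which vanishes because I and K are separated. *)
rewrite -big_split /= [RHS](bigD1 r)//= [X in X + _](_ : _ = 0) ?add0r; last first.
  transitivity (c I K r r * (block L I'.1 I'.2 r * block L K'.1 K'.2 r * (len r * len r) *+ 2)).
    by rewrite cE /len; ring.
  by rewrite crr mul0r.
by apply: eq_bigr => s _; rewrite !cE /len; ring.
Qed.

End brownian_moments.

Section double_sums.
Context {R : realType} {d : measure_display} {T : measurableType d}.
Variable mu : {measure set T -> \bar R}.

Definition offdiag_sum n (a : nat -> nat -> R) (X : nat -> nat -> T -> R^o) (w : T) : R^o :=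
  \sum_(i < n) \sum_(j < n | j != i) a i j *: X i j w.

Lemma sqint_offdiag_sum n a (X : nat -> nat -> T -> R^o) : (forall i j : 'I_n, j != i -> sqint mu (X i j)) ->
  sqint mu (offdiag_sum n a X).
Proof.
move=> sX; apply: (sqint_sum separable_scalars) => i _.
apply: (sqint_sum separable_scalars) => j ji.
by apply: (sqintZ separable_scalars); exact: sX.
Qed.

Lemma l2dot_offdiag_sum n m a b (X Y : nat -> nat -> T -> R^o) :
  (forall i j : 'I_n, j != i -> sqint mu (X i j)) ->
  (forall i j : 'I_m, j != i -> sqint mu (Y i j)) ->
  l2dot mu (offdiag_sum n a X) (offdiag_sum m b Y) =
  \sum_(i < n) \sum_(j < n | j != i) \sum_(k < m) \sum_(l < m | l != k)
    a i j * b k l * l2dot mu (X i j) (Y k l).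
Proof.
move=> sX sY; have sS : separable (R^o : hilbertType R) by exact: separable_scalars.
have sXZ (c : R) (i j : 'I_n) : j != i -> sqint mu (fun w => c *: X i j w).
  by move=> ji; apply: (sqintZ sS); exact: sX.
have sYZ (c : R) (i j : 'I_m) : j != i -> sqint mu (fun w => c *: Y i j w).
  by move=> ji; apply: (sqintZ sS); exact: sY.
have sYs (k : 'I_m) : sqint mu (fun w => \sum_(l < m | l != k) b k l *: Y k l w).
  by apply: (sqint_sum sS) => l; exact: sYZ.
have sYss := sqint_offdiag_sum b sY.
rewrite (l2dot_suml sS)//; last by move=> i _; apply: (sqint_sum sS) => j; exact: sXZ.
apply: eq_bigr => i _; rewrite (l2dot_suml sS)//; last by move=> j; exact: sXZ.
apply: eq_bigr => j ji; rewrite (l2dot_sumr sS)//; last exact: sXZ.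
apply: eq_bigr => k _; rewrite (l2dot_sumr sS)//; [|by move=> l; exact: sYZ|exact: sXZ].
apply: eq_bigr => l lk; rewrite (l2dotZl sS)//; [|exact: sX|exact: sYZ].
by rewrite (l2dotZr sS) ?mulrA//; [exact: sX|exact: sY].
Qed.

End double_sums.

Section boxes.
Context {R : realType}.
Notation mu := (@lebesgue_measure R).
Local Notation m2 := (mu \x mu)%E.

Definition box (I K : R * R) (p : R * R) : R^o :=
  \1_(`]I.1, I.2]) p.1 * \1_(`]K.1, K.2]) p.2.

Lemma measurable_box I K : measurable_fun setT (box I K).
Proof. by apply: measurable_funM; apply: measurableT_comp. Qed.

Lemma integral_overlap (I I' : R * R) :
  (\int[mu]_x (\1_(`]I.1, I.2]) x * \1_(`]I'.1, I'.2]) x)%:E =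
   (overlap I.1 I.2 I'.1 I'.2)%:E)%E.
Proof.
have E : `]I.1, I.2] `&` `]I'.1, I'.2] = `]Num.max I.1 I'.1, Num.min I.2 I'.2]%classic.
  by apply/seteqP; split=> x /=; rewrite !in_itv/= gt_max le_min andbACA => /andP.
under eq_integral do rewrite -[_ * _]/((\1_(_ : set R) \* \1_(_ : set R)) _) -indicI E.
rewrite integral_indic//.
rewrite setIT [LHS]lebesgue_measure_itv/= lte_fin /overlap.
case: ltP => h; first by rewrite -EFinD [in RHS]max_r// subr_ge0 ltW.
by congr EFin; rewrite [RHS]max_l// subr_le0.
Qed.

Lemma integral_box I K I' K' : (\int[m2]_p (box I K p * box I' K' p)%:E =
  (overlap I.1 I.2 I'.1 I'.2 * overlap K.1 K.2 K'.1 K'.2)%:E)%E.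
Proof.
have mi (J J' : R * R) : 
    measurable_fun setT (fun x => (\1_(`]J.1, J.2]) x * \1_(`]J'.1, J'.2]) x : R)%:E).
  by apply/measurable_EFinP; apply: measurable_funM.
have i0 (J J' : R * R) x : (0 <= (\1_(`]J.1, J.2]) x * \1_(`]J'.1, J'.2]) x : R)%:E)%E.
  by rewrite lee_fin mulr_ge0.
have := @integral_product_fun _ _ _ _ _ mu mu setT setT
  (fun x => (\1_(`]I.1, I.2]) x * \1_(`]I'.1, I'.2]) x)%:E)
  (fun x => (\1_(`]K.1, K.2]) x * \1_(`]K'.1, K'.2]) x)%:E) measurableT measurableT
  (mi _ _) (mi _ _) (i0 _ _) (i0 _ _).
rewrite !integral_overlap setXTT EFinM => <-.
by apply: eq_integral => p _; rewrite -EFinM /box mulrACA.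
Qed.

Lemma sqint_box I K : sqint m2 (box I K).
Proof.
apply/sqint_scalarP; split; first exact: measurable_box.
by under eq_integral do rewrite expr2; rewrite integral_box ltry.
Qed.

Lemma l2dot_box I K I' K' : l2dot m2 (box I K) (box I' K') =
  overlap I.1 I.2 I'.1 I'.2 * overlap K.1 K.2 K'.1 K'.2.
Proof. by rewrite /l2dot /Rintegral [X in fine X]integral_box. Qed.

End boxes.

(** * The isometry for off-diagonal step kernels *)

Section step_isometry.
Context {R : realType} {d : measure_display} {Omega : measurableType d}.
Variables (P : probability Omega R) (T : R) (B : R -> {RV P >-> R}).
Hypothesis BM : brownian_motion T B.
Notation mu := (@lebesgue_measure R).
Local Notation m2 := (mu \x mu)%E.
Implicit Types (n m : nat) (tau sigma : nat -> R) (a b : nat -> nat -> R).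

Let cell tau i : R * R := (tau i, tau i.+1).

Let cell_in n tau i : subdivision T n tau -> (i < n)%N -> interval_in T (cell tau i).
Proof. by move=> sub ilt; have [] := subdivision_bounds sub ilt. Qed.

Let cell_separated n tau i j : subdivision T n tau -> (i < n)%N -> (j < n)%N -> i != j ->
  separated (cell tau i) (cell tau j).
Proof.
move=> sub ilt jlt; rewrite neq_ltn => /orP[ij|ij].
  by left; apply: (subdivision_mono sub); rewrite ij ltnW.
by right; apply: (subdivision_mono sub); rewrite ij ltnW.
Qed.

Lemma offdiag_step_sum n tau a : offdiag_step n tau a =
  offdiag_sum n a (fun i j => box (cell tau i) (cell tau j)).
Proof.
apply/funext => p; apply: eq_bigr => i _; apply: eq_bigr => j _.
by rewrite /box /GRing.scale /= mulrA.
Qed.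

Lemma offdiag_integral_sum n tau a : offdiag_integral (fun t => B t) n tau a =
  offdiag_sum n a (fun i j => increment_mul B (cell tau i) (cell tau j)).
Proof.
apply/funext => w; apply: eq_bigr => i _; apply: eq_bigr => j _.
by rewrite /increment_mul /increment /GRing.scale /= mulrA.
Qed.

Let swap (p : R * R) := (p.2, p.1).

Let offdiag_step_swap n tau a : offdiag_step n tau a \o swap =
  offdiag_sum n a (fun i j => box (cell tau j) (cell tau i)).
Proof.
apply/funext => p; rewrite /= offdiag_step_sum.
by apply: eq_bigr => i _; apply: eq_bigr => j _; rewrite /box /swap /= mulrC.
Qed.

Lemma sqint_offdiag_step n tau a : sqint m2 (offdiag_step n tau a : R * R -> R^o).
Proof. by rewrite offdiag_step_sum; apply: sqint_offdiag_sum => i j _; exact: sqint_box. Qed.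

Let sqint_cells n tau (i j : 'I_n) : subdivision T n tau -> j != i ->
  sqint P (increment_mul B (cell tau i) (cell tau j)).
Proof.
move=> sub ji; have ci := cell_in sub (ltn_ord i); have cj := cell_in sub (ltn_ord j).
have sep : separated (cell tau i) (cell tau j).
  by apply: (cell_separated sub) => //; rewrite eq_sym.
by have [] := wick BM ci cj ci cj sep sep.
Qed.

Lemma sqint_offdiag_integral n tau a : subdivision T n tau ->
  sqint P (offdiag_integral (fun t => B t) n tau a : Omega -> R^o).
Proof.
move=> sub; rewrite offdiag_integral_sum; apply: sqint_offdiag_sum => i j.
exact: sqint_cells.
Qed.

Lemma mean_offdiag_integral n tau a : subdivision T n tau ->
  l2dot P (offdiag_integral (fun t => B t) n tau a : Omega -> R^o) (fun=> 1 : R^o) = 0.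
Proof.
move=> sub; rewrite offdiag_integral_sum.
have W (i j : 'I_n) : j != i ->
    sqint P (increment_mul B (cell tau i) (cell tau j)) /\
    \int[P]_w increment_mul B (cell tau i) (cell tau j) w = 0.
  move=> ji; have ci := cell_in sub (ltn_ord i); have cj := cell_in sub (ltn_ord j).
  have sep : separated (cell tau i) (cell tau j).
    by apply: (cell_separated sub) => //; rewrite eq_sym.
  by have [] := wick BM ci cj ci cj sep sep.
have sS : separable (R^o : hilbertType R) by exact: separable_scalars.
have s1 := sqint_cst P (1 : R^o).
have sXZ (c : R) (i j : 'I_n) : j != i ->
    sqint P (fun w => c *: increment_mul B (cell tau i) (cell tau j) w).
  by move=> ji; apply: (sqintZ sS); exact: (W i j ji).1.
rewrite (l2dot_suml sS)//; last by move=> i _; apply: (sqint_sum sS) => j; exact: sXZ.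
apply: big1 => i _; rewrite (l2dot_suml sS)//; last by move=> j; exact: sXZ.
apply: big1 => j ji; rewrite (l2dotZl sS)//; last exact: (W i j ji).1.
rewrite /l2dot; under eq_Rintegral do rewrite /ip /= mulr1.
by rewrite (W i j ji).2 mulr0.
Qed.

(** The two matchings in Wick's formula pair the first kernel with the second one and with its
    reflection. For a symmetric kernel both agree and give the usual factor 2. *)
Lemma offdiag_isometry n m tau sigma a b : subdivision T n tau -> subdivision T m sigma ->
  l2dot P (offdiag_integral (fun t => B t) n tau a : Omega -> R^o)
          (offdiag_integral (fun t => B t) m sigma b) =
  l2dot m2 (offdiag_step n tau a : R * R -> R^o) (offdiag_step m sigma b) +
  l2dot m2 (offdiag_step n tau a : R * R -> R^o) (offdiag_step m sigma b \o swap).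
Proof.
move=> sub sub'; rewrite !offdiag_integral_sum offdiag_step_swap !offdiag_step_sum.
have W (i j : 'I_n) (k l : 'I_m) : j != i -> l != k ->
   l2dot P (increment_mul B (cell tau i) (cell tau j)) (increment_mul B (cell sigma k) (cell sigma l)) =
   l2dot m2 (box (cell tau i) (cell tau j)) (box (cell sigma k) (cell sigma l)) +
   l2dot m2 (box (cell tau i) (cell tau j)) (box (cell sigma l) (cell sigma k)).
  move=> ji lk; rewrite eq_sym in ji; rewrite eq_sym in lk.
  have ci := cell_in sub (ltn_ord i); have cj := cell_in sub (ltn_ord j).
  have ck := cell_in sub' (ltn_ord k); have cl := cell_in sub' (ltn_ord l).
  have sep := cell_separated sub (ltn_ord i) (ltn_ord j) ji.
  have sep' := cell_separated sub' (ltn_ord k) (ltn_ord l) lk.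
  by have [_ _ ->] := wick BM ci cj ck cl sep sep'; rewrite !l2dot_box.
rewrite !l2dot_offdiag_sum; try by move=> *; exact: sqint_box.
- rewrite -big_split; apply: eq_bigr => i _; rewrite -big_split; apply: eq_bigr => j ji.
  rewrite -big_split; apply: eq_bigr => k _; rewrite -big_split; apply: eq_bigr => l lk /=.
  by rewrite W// mulrDr.
- by move=> i j; exact: sqint_cells.
- by move=> i j; exact: sqint_cells.
Qed.

End step_isometry.

(** * Covariance of the Rosenblatt process *)

Section sigma_finite_product.
Context d1 d2 (T1 : measurableType d1) (T2 : measurableType d2) (R : realType).
Variable m1 : {sigma_finite_measure set T1 -> \bar R}.
Variable m2 : {sigma_finite_measure set T2 -> \bar R}.
Local Open Scope ereal_scope.
Lemma sigma_finite_product : sigma_finite setT (m1 \x m2).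
Proof.
have /sigma_finiteP[F [TF ndF Foo]] := sigma_finiteT m1.
have /sigma_finiteP[G [TG ndG Goo]] := sigma_finiteT m2.
exists (fun n => F n `*` G n) => [|k]; last first.
  have [mF Fk] := Foo k; have [mG Gk] := Goo k; split; first exact: measurableX.
  by rewrite product_measure1E// lte_mul_pinfty// ge0_fin_numE.
rewrite -setXTT TF TG; apply/seteqP; split=> [[x y] /= [[n _ Fx] [k _ Gy]]|[x y] [n _ /= []]].
  exists (maxn n k) => //; split.
  - by have /subsetPset := ndF _ _ (leq_maxl n k); exact.
  - by have /subsetPset := ndG _ _ (leq_maxr n k); exact.
by move=> Fx Gy; split; exists n.
Qed.
(** Packed so that Tonelli's theorem can take the plane, with its product measure, as a single
    factor. *)
Definition sigma_product : {sigma_finite_measure set (T1 * T2)%type -> \bar R} :=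
  HB.pack (m1 \x m2) (Measure_isSigmaFinite.Build _ _ _ (m1 \x m2) sigma_finite_product).
End sigma_finite_product.

Section tonelli_pairs.
Context {R : realType} {d1 d2 d3 d4 : measure_display}.
Context {T1 : measurableType d1} {T2 : measurableType d2}.
Context {T3 : measurableType d3} {T4 : measurableType d4}.
Variables (m1 : {sigma_finite_measure set T1 -> \bar R}) (m2 : {sigma_finite_measure set T2 -> \bar R}).
Variables (m3 : {sigma_finite_measure set T3 -> \bar R}) (m4 : {sigma_finite_measure set T4 -> \bar R}).
Local Open Scope ereal_scope.

Lemma tonelli_pairs (f : (T1 * T2) * (T3 * T4) -> \bar R) :
  measurable_fun setT f -> (forall z, 0 <= f z) ->
  \int[m1 \x m2]_x \int[m3 \x m4]_y f (x, y) = \int[m3 \x m4]_y \int[m1 \x m2]_x f (x, y).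
Proof.
move=> mf f0.
exact: (@fubini_tonelli _ _ _ _ _ (sigma_product m1 m2) (sigma_product m3 m4) f mf f0).
Qed.

End tonelli_pairs.

Section swap_invariance.
Context {R : realType}.
Notation mu := (@lebesgue_measure R).
Local Notation m2 := (mu \x mu)%E.

Definition swap_pair (p : R * R) : R * R := (p.2, p.1).

Lemma measurable_swap_pair : measurable_fun setT swap_pair.
Proof. by apply: measurable_fun_pair. Qed.

Lemma integral_swap (h : R * R -> \bar R) : measurable_fun setT h -> (forall p, (0 <= h p)%E) ->
  (\int[m2]_p h (swap_pair p) = \int[m2]_p h p)%E.
Proof.
move=> mh h0; have mhs : measurable_fun setT (fun p => h (swap_pair p)).
  by apply: measurableT_comp => //; exact: measurable_swap_pair.
by rewrite fubini_tonelli1//= [RHS]fubini_tonelli2.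
Qed.

Lemma sqint_swap (f : R * R -> R^o) : sqint m2 f -> sqint m2 (f \o swap_pair : R * R -> R^o).
Proof.
move=> /sqint_scalarP[mf f2]; apply/sqint_scalarP; split.
  by apply: measurableT_comp => //; exact: measurable_swap_pair.
rewrite (integral_swap (h := fun p => (f p ^+ 2)%:E))//.
  by apply/measurable_EFinP; exact: measurable_funX.
by move=> p; rewrite lee_fin sqr_ge0.
Qed.

Lemma l2to_swap (fn : nat -> R * R -> R^o) (f : R * R -> R^o) :
  (forall n, sqint m2 (fn n)) -> sqint m2 f -> l2to m2 fn f ->
  l2to m2 (fun n => fn n \o swap_pair : R * R -> R^o) (f \o swap_pair : R * R -> R^o).
Proof.
move=> fn2 f2; rewrite /l2to.
suff -> : (fun n => l2dot m2 (fun p => (fn n p - f p : R^o)) (fun p => fn n p - f p)) =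
  (fun n => l2dot m2 (fun p => ((fn n \o swap_pair) p - (f \o swap_pair) p : R^o))
     (fun p => (fn n \o swap_pair) p - (f \o swap_pair) p)) by [].
apply/funext => n; have [md _] := (sqint_scalarP _ _).1 (sqintB separable_scalars (fn2 n) f2).
rewrite /l2dot /Rintegral; congr fine; apply/esym.
apply: (integral_swap (h := fun p => ((fn n p - f p) * (fn n p - f p))%:E)).
  by apply/measurable_EFinP; exact: measurable_funM.
by move=> p; rewrite lee_fin -expr2 sqr_ge0.
Qed.

End swap_invariance.

Section double_wiener.
Context {R : realType} {d : measure_display} {Omega : measurableType d}.
Variables (P : probability Omega R) (T : R) (B : R -> {RV P >-> R}).
Hypothesis BM : brownian_motion T B.
Notation mu := (@lebesgue_measure R).
Local Notation m2 := (mu \x mu)%E.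

Lemma measurable_square (t : R) : measurable (square t).
Proof. by apply: measurableX; exact: measurable_itv. Qed.

Lemma offdiag_step_outside (t : R) n tau a p : subdivision t n tau -> ~ square t p ->
  offdiag_step n tau a p = 0.
Proof.
move=> sub np; apply: big1 => i _; apply: big1 => j _.
have out (x : R) (k : 'I_n) : ~ (`[0, t]%classic x) -> \1_(`]tau k, tau k.+1]) x = 0 :> R.
  move=> xt; rewrite indicE memNset//= in_itv/= => /andP[h1 h2]; apply: xt.
  have [k0 _ k1] := subdivision_bounds sub (ltn_ord k).
  by rewrite /= in_itv/= (le_trans k0 (ltW h1)) (le_trans h2 k1).
have [h|h] := pselect (`[0, t]%classic p.1).
  have h2 : ~ `[0, t]%classic p.2 by move=> h2; apply: np.
  by rewrite (out p.2)// mulr0.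
by rewrite (out p.1)// mulr0 mul0r.
Qed.

Lemma subdivision_le (s t : R) n tau : s <= t -> subdivision s n tau -> subdivision t n tau.
Proof. by move=> st [h1 h2 h3]; split => //; exact: le_trans h3 st. Qed.

(** Extension by zero puts the kernels of all times into one space L^2 over the plane, where
    covariances between different times are inner products. *)
Definition cut_kernel (t : R) (f : R * R -> R) : R * R -> R^o := f \_ (square t).

Lemma double_wiener_approx t (f : R * R -> R) (Y : Omega -> R) : t <= T -> double_wiener_integral P (fun t => B t : Omega -> R) t f Y ->
  [/\ sqint m2 (cut_kernel t f), sqint P (Y : Omega -> R^o) &
   exists n tau a, [/\ forall k, subdivision T (n k) (tau k),
     l2to m2 (fun k => offdiag_step (n k) (tau k) (a k) : R * R -> R^o) (cut_kernel t f) &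
     l2to P (fun k => offdiag_integral (fun t => B t) (n k) (tau k) (a k) : Omega -> R^o)
       (Y : Omega -> R^o)]].
Proof.
move=> tT [mf f2 mY [n [tau [a [sub cf cY]]]]].
have mS := measurable_square t.
have sS : separable (R^o : hilbertType R) by exact: separable_scalars.
have sub' k := subdivision_le tT (sub k).
have c2 : sqint m2 (cut_kernel t f).
  apply/sqint_scalarP; split; first exact/(measurable_restrictT f mS).
  rewrite (_ : (fun p => (cut_kernel t f p ^+ 2)%:E) = (fun p => (f p ^+ 2)%:E) \_ (square t)).
    by rewrite -integral_mkcond.
  apply/funext => p; rewrite /cut_kernel !patchE; case: ifP => //.
  by rewrite expr0n.
have Y2 : sqint P (Y : Omega -> R^o).
  (* Convergence to 0 makes these extended integrals finite from some index on; Y is then at finite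
     distance from a square integrable variable. *)
  have [k] : exists k, (\int[P]_w ((Y w - offdiag_integral (fun t => B t) (n k) (tau k) (a k) w) ^+ 2)%:E < +oo)%E.
    have /fine_cvgP[[k _ /(_ k (leqnn k)) kf] _] := cY.
    by exists k; rewrite -ge0_fin_numE//; apply: integral_ge0 => w _; rewrite lee_fin sqr_ge0.
  move=> h; apply: (sqint_l2_close sS _ (sqint_offdiag_integral BM (a k) (sub' k))).
    by move=> v; exact: measurable_funM.
  apply: le_lt_trans h; rewrite le_eqVlt; apply/orP; left; apply/eqP.
  by apply: eq_integral => w _; rewrite real_normK ?num_real// -sqrrN opprB.
split => //; exists n, tau, a; split => //.
- apply/l2toP => //; first by move=> k; exact: sqint_offdiag_step.
  move: cf; rewrite (_ : (fun k => _) = (fun k => \int[m2]_p (`|(offdiag_step (n k) (tau k) (a k) p - cut_kernel t f p : R^o)| ^+ 2)%:E)%E)//.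
  apply/funext => k; rewrite integral_mkcond; apply: eq_integral => p _.
  rewrite real_normK ?num_real// /cut_kernel !patchE; case: ifPn => [_|]; first by rewrite -sqrrN opprB.
  rewrite notin_setE => np.
  by rewrite (offdiag_step_outside _ (sub k))// subr0 expr0n.
- apply: (l2toP sS (fun k => sqint_offdiag_integral BM (a k) (sub' k)) Y2).2.
  move: cY; rewrite (_ : (fun k => _) = (fun k => \int[P]_w (`|(offdiag_integral (fun t => B t) (n k) (tau k) (a k) w - Y w : R^o)| ^+ 2)%:E)%E)//.
  by apply/funext => k; apply: eq_integral => w _; rewrite real_normK ?num_real// -sqrrN opprB.
Qed.

Lemma double_wiener_mean t (f : R * R -> R) (Y : Omega -> R) : t <= T -> double_wiener_integral P (fun t => B t : Omega -> R) t f Y ->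
  l2dot P (Y : Omega -> R^o) (fun=> 1 : R^o) = 0.
Proof.
move=> tT /(double_wiener_approx tT)[_ Y2 [n [tau [a [sub _ cY]]]]].
have s1 := sqint_cst P (1 : R^o).
have := l2dot_cvg separable_scalars (fun k => sqint_offdiag_integral BM (a k) (sub k))
  (fun=> s1) Y2 s1 cY.
rewrite /l2to; under eq_fun do rewrite subrr.
rewrite (_ : (fun n => l2dot _ _ _) = fun=> 0); last by apply/funext => k; rewrite l2dot0l.
move=> /(_ (cvg_cst _)).
rewrite (_ : (fun n => _) = fun=> 0); last first.
  by apply/funext => k; rewrite (mean_offdiag_integral BM).
by move=> /(cvg_unique (@Rhausdorff R)); apply; exact: cvg_cst.
Qed.

Lemma double_wiener_cov t s (f g : R * R -> R) (Y Y' : Omega -> R) : t <= T -> s <= T ->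
  double_wiener_integral P (fun t => B t : Omega -> R) t f Y -> double_wiener_integral P (fun t => B t : Omega -> R) s g Y' ->
  l2dot P (Y : Omega -> R^o) (Y' : Omega -> R^o) =
  l2dot m2 (cut_kernel t f) (cut_kernel s g) + l2dot m2 (cut_kernel t f) (cut_kernel s g \o swap_pair : R * R -> R^o).
Proof.
move=> tT sT /(double_wiener_approx tT)[f2 Y2 [n [tau [a [sub cf cY]]]]].
move=> /(double_wiener_approx sT)[g2 Y2' [m [sigma [b [sub' cg cY']]]]].
have sS : separable (R^o : hilbertType R) by exact: separable_scalars.
have c1 := l2dot_cvg sS (fun k => sqint_offdiag_integral BM (a k) (sub k))
  (fun k => sqint_offdiag_integral BM (b k) (sub' k)) Y2 Y2' cY cY'.
have c2 := l2dot_cvg sS (fun k => sqint_offdiag_step (n k) (tau k) (a k))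
  (fun k => sqint_offdiag_step (m k) (sigma k) (b k)) f2 g2 cf cg.
have c3 := l2dot_cvg sS (fun k => sqint_offdiag_step (n k) (tau k) (a k))
  (fun k => sqint_swap (sqint_offdiag_step (m k) (sigma k) (b k))) f2 (sqint_swap g2) cf
  (l2to_swap (fun k => sqint_offdiag_step (m k) (sigma k) (b k)) g2 cg).
apply: (cvg_unique (@Rhausdorff R) c1).
rewrite (_ : (fun n => _) = fun k =>
  l2dot m2 (offdiag_step (n k) (tau k) (a k) : R * R -> R^o) (offdiag_step (m k) (sigma k) (b k)) +
  l2dot m2 (offdiag_step (n k) (tau k) (a k) : R * R -> R^o)
    (offdiag_step (m k) (sigma k) (b k) \o swap_pair)).
  exact: cvgD.
by apply/funext => k; rewrite (offdiag_isometry BM _ _ (sub k) (sub' k)).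
Qed.

End double_wiener.

(** * Inner products of Rosenblatt kernels *)

Section rosenblatt_kernel_cov.
Context {R : realType}.
Variable H : R.
Hypothesis H_range : 2^-1 < H < 1.
Notation mu := (@lebesgue_measure R).
Local Notation m2 := (mu \x mu)%E.
Let h := (H + 1) / 2.
Let phi u y := volterra h u y.

(* The kernel of the process is the finite part of this extended integral, to which
   Tonelli's theorem applies. *)
Definition ekernel (t : R) (p : R * R) : \bar R :=
  (\int[mu]_(u in `[0%R, t]) (phi u p.1 * phi u p.2)%:E)%E.

(** Since 0 to a nonzero power is 0, [dK] vanishes at both ends of [0, u]; the closed ranges in
    [rosenblatt_kernel] thus agree with the strict inequalities in [volterra]. *)
Let dK_null_left u : dK h u 0 = 0.
Proof.
rewrite /dK powR0 ?mulr0 ?mul0r//; move: H_range => /andP[h1 h2]; rewrite /h; apply/eqP; lra.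
Qed.

Let dK_null_right u : dK h u u = 0.
Proof.
rewrite /dK subrr powR0 ?mulr0//; move: H_range => /andP[h1 h2]; rewrite /h; apply/eqP; lra.
Qed.

Lemma rosenblatt_kernelE t p : square t p -> rosenblatt_kernel H t p = fine (ekernel t p).
Proof.
move=> [/=]; rewrite !in_itv/= => /andP[p10 p1t] /andP[p20 p2t].
rewrite /rosenblatt_kernel /Rintegral -/h /ekernel; congr fine.
rewrite integral_mkcond [RHS]integral_mkcond; apply: eq_integral => u _; rewrite !patchE.
rewrite !mem_setE !in_itv/= ge_max /phi /volterra.
have [ut|] := boolP (u <= t); rewrite ?andbF// !andbT.
have E y : 0 <= y -> (if 0 < y < u then dK h u y else 0) = if y <= u then dK h u y else 0.
  move=> y0; move: (y0); rewrite le_eqVlt => /predU1P[<-|yp]; first by rewrite ltxx dK_null_left !if_same.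
  rewrite yp /=; case: (ltgtP y u) => // ->.
  by rewrite dK_null_right.
rewrite !E//; case: (leP p.1 u) => h1; case: (leP p.2 u) => h2; rewrite /= ?mul0r ?mulr0 ?if_same//.
by rewrite (le_trans p10 h1).
Qed.

Lemma ekernel_ge0 t p : (0 <= ekernel t p)%E.
Proof. by apply: integral_ge0 => u _; rewrite lee_fin mulr_ge0 ?volterra_ge0. Qed.

Lemma ekernel_swap t p : ekernel t (swap_pair p) = ekernel t p.
Proof. by apply: eq_integral => u _; rewrite mulrC. Qed.

Lemma ekernel_outside t p : ~ square t p -> ekernel t p = 0%E.
Proof.
move=> np; apply: integral0_eq => u; rewrite /= in_itv/= => /andP[u0 ut].
congr EFin; rewrite /phi /volterra; case: ifP => [/andP[h1 h2]|]; last by rewrite mul0r.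
case: ifP => [/andP[h3 h4]|]; last by rewrite mulr0.
exfalso; apply: np; rewrite /square /= !in_itv/=.
by rewrite !ltW//= ?(lt_le_trans h2)// (lt_le_trans h4).
Qed.

Lemma cut_rosenblatt_kernel t : cut_kernel t (rosenblatt_kernel H t) = fun p => fine (ekernel t p).
Proof.
apply/funext => p; rewrite /cut_kernel patchE; case: ifPn; rewrite ?inE ?notin_setE => hp.
  exact: rosenblatt_kernelE.
by rewrite ekernel_outside.
Qed.

Let measurable_phi2 d (S : measurableType d) (f g k l : S -> R) :
  measurable_fun setT f -> measurable_fun setT g -> measurable_fun setT k -> measurable_fun setT l ->
  measurable_fun setT (fun x => (phi (f x) (g x) * phi (k x) (l x))%:E).
Proof.
move=> mf mg mk ml; apply/measurable_EFinP; apply: measurable_funM.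
  exact: (measurableT_comp (measurable_volterra h) (measurable_fun_pair mf mg)).
exact: (measurableT_comp (measurable_volterra h) (measurable_fun_pair mk ml)).
Qed.

Let m11 : measurable_fun setT (fun p : R * R * R => p.1.1).
Proof. exact: measurableT_comp. Qed.

Let m12 : measurable_fun setT (fun p : R * R * R => p.1.2).
Proof. exact: measurableT_comp. Qed.

Let phi2_ge0 a b c e : (0 <= (phi a b * phi c e)%:E)%E.
Proof. by rewrite lee_fin mulr_ge0 ?volterra_ge0. Qed.

Lemma measurable_ekernel t : measurable_fun setT (ekernel t).
Proof.
have := @measurable_integral_section _ _ _ (measurableTypeR R * measurableTypeR R)%type _ mu `[0%R, t]%classic
  (fun z => (phi z.2 z.1.1 * phi z.2 z.1.2)%:E) (measurable_itv _) _ _.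
by apply => [|z]; [exact: measurable_phi2|exact: phi2_ge0].
Qed.

Let gram (q : R * R) : \bar R := (\int[mu]_y (phi q.1 y * phi q.2 y)%:E)%E.

Let measurable_gram : measurable_fun setT gram.
Proof.
have := @measurable_integral_section _ _ _ (measurableTypeR R * measurableTypeR R)%type _ mu setT
  (fun z => (phi z.1.1 z.2 * phi z.1.2 z.2)%:E) measurableT _ _.
by apply => [|z]; [exact: measurable_phi2|exact: phi2_ge0].
Qed.

Let gram_ge0 q : (0 <= gram q)%E.
Proof. by apply: integral_ge0. Qed.

Let kern4 (z : (R * R) * (R * R)) : \bar R :=
  ((phi z.2.1 z.1.1 * phi z.2.1 z.1.2)%:E * (phi z.2.2 z.1.1 * phi z.2.2 z.1.2)%:E)%E.

Let measurable_kern4 : measurable_fun setT kern4.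
Proof.
by apply: emeasurable_funM; apply: measurable_phi2; apply: measurableT_comp => //; exact: measurableT_comp.
Qed.

Let kern4_ge0 z : (0 <= kern4 z)%E. Proof. exact: mule_ge0. Qed.

Let ekernel_mul t s p : (ekernel t p * ekernel s p =
  \int[m2]_(q in `[0%R, t] `*` `[0%R, s]) kern4 (p, q))%E.
Proof.
rewrite /ekernel -integral_product_fun//; last 2 first.
- exact: measurable_phi2.
- exact: measurable_phi2.
Qed.

Let gram_sqr q : (\int[m2]_p kern4 (p, q) = gram q * gram q)%E.
Proof.
have mg : measurable_fun setT (fun y => (phi q.1 y * phi q.2 y)%:E) by exact: measurable_phi2.
have g0 y : (0 <= (phi q.1 y * phi q.2 y)%:E)%E by exact: phi2_ge0.
have := @integral_product_fun _ _ _ (measurableTypeR R) (measurableTypeR R) mu mu setT setT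
  (fun y => (phi q.1 y * phi q.2 y)%:E) (fun y => (phi q.1 y * phi q.2 y)%:E)
  measurableT measurableT mg mg g0 g0.
rewrite setXTT => gE; rewrite -[RHS]gE; apply: eq_integral => p _.
by rewrite /kern4 -!EFinM mulrACA.
Qed.

(** Off the axes and the diagonal [volterra_gram] applies, and squaring |u - v|^(2h-2) yields |u -
    v|^(2H-2). The exceptional points are null in each row, and the row u = 0 is itself null. *)
Let integral_gram t s : (\int[m2]_(q in `[0%R, t] `*` `[0%R, s]) (gram q * gram q) =
   ((h * (2 * h - 1)) ^+ 2)%:E *
     \int[m2]_(p in `[0%R, t] `*` `[0%R, s]) (`|p.1 - p.2| `^ (2 * H - 2))%:E)%E.
Proof.
pose c := h * (2 * h - 1).
have [hH1 hH2] := andP H_range.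
have hh : 2^-1 < h < 1 by rewrite /h; apply/andP; split; lra.
have cE (u v : R) : 0 < u -> 0 < v -> u != v ->
    (gram (u, v) * gram (u, v) = (c ^+ 2 * `|u - v| `^ (2 * H - 2))%:E)%E.
  move=> u0 v0 uv; rewrite /gram /= volterra_gram// -EFinM; congr EFin.
  have -> : 2 * H - 2 = (2 * h - 2) + (2 * h - 2) by rewrite /h; field.
  rewrite [in RHS]powRD; last by apply/implyP => _; rewrite gt_eqF// normr_gt0 subr_eq0.
  by rewrite /c; ring.
have mk : measurable_fun setT (fun p : R * R => (`|p.1 - p.2| `^ (2 * H - 2))%:E).
  by apply/measurable_EFinP; exact: measurable_riesz_kernel.
rewrite tonelli_rectangle//; last first.
- by move=> q; rewrite mule_ge0.
- exact: emeasurable_funM.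
rewrite tonelli_rectangle//.
have c20 : 0 <= c ^+ 2 by exact: sqr_ge0.
have mrow u (D : set R) : measurable_fun D (fun v : R => (`|u - v| `^ (2 * H - 2))%:E).
  apply: measurable_funTS; apply: (measurableT_comp mk (g := fun v => (u, v))).
  exact: measurable_fun_pair.
have mgram u (D : set R) : measurable_fun D (fun v : R => gram (u, v)).
  apply: measurable_funTS; apply: (measurableT_comp measurable_gram (g := fun v => (u, v))).
  exact: measurable_fun_pair.
have inner u : 0 < u -> (\int[mu]_(v in `[0%R, s]) (gram (u, v) * gram (u, v)) =
    (c ^+ 2)%:E * \int[mu]_(v in `[0%R, s]) (`|u - v| `^ (2 * H - 2))%:E)%E.
  move=> u0; rewrite -ge0_integralZl_EFin//; last exact: mrow.
  apply: ae_eq_integral => //.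
  - by apply: emeasurable_funM; exact: mgram.
  - by apply: emeasurable_funM => //; exact: mrow.
  - exists [set 0; u]; split.
    + by apply: measurableU; exact: measurable_set1.
    + by apply: countable_lebesgue_measure0; apply: finite_set_countable.
    + move=> v /= /not_implyP[]; rewrite in_itv/= => /andP[v0 _] ne.
      apply: contrapT => nv; apply: ne; rewrite -EFinM; apply: cE => //.
        by rewrite lt_neqAle v0 andbT; apply/eqP => v00; apply: nv; left.
      by apply/eqP => uv; apply: nv; right.
have msec : measurable_fun setT (fun u : R => \int[mu]_(v in `[0%R, s]) (`|u - v| `^ (2 * H - 2))%:E)%E.
  apply: (@measurable_integral_section _ _ _ (measurableTypeR R) _ mu _
    (fun p => (`|p.1 - p.2| `^ (2 * H - 2))%:E)) => //.
rewrite -ge0_integralZl_EFin//; last 2 first.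
- by move=> u _; apply: integral_ge0 => v _; rewrite lee_fin powR_ge0.
- exact: measurable_funTS.
apply: ae_eq_integral => //.
- apply: measurable_funTS.
  apply: (@measurable_integral_section _ _ _ (measurableTypeR R) _ mu _
    (fun q => gram q * gram q)%E) => //; first exact: emeasurable_funM.
  by move=> q; rewrite mule_ge0.
- by apply: measurable_funTS; exact: emeasurable_funM.
- exists [set 0]; split => //; first exact: lebesgue_measure_set1.
  move=> u /= /not_implyP[]; rewrite in_itv/= => /andP[u0 _] ne.
  apply: contrapT => nu; apply: ne; apply: inner.
  by rewrite lt_neqAle u0 andbT; apply/eqP => u00; apply: nu.
Qed.


(** Tonelli exchanges the space variables (y1, y2) with the time variables (u, v). For fixed times
    the integral over y1 and y2 factors into the square of the Gram function. *)
Lemma integral_ekernel_mul t s :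
  (\int[m2]_p (ekernel t p * ekernel s p) =
   ((h * (2 * h - 1)) ^+ 2)%:E *
     \int[m2]_(p in `[0%R, t] `*` `[0%R, s]) (`|p.1 - p.2| `^ (2 * H - 2))%:E)%E.
Proof.
pose Q : set (R * R) := `[0%R, t] `*` `[0%R, s].
have mQ : measurable Q by apply: measurableX; exact: measurable_itv.
pose F (z : (R * R) * (R * R)) := (kern4 z * (\1_Q z.2)%:E)%E.
have mF : measurable_fun setT F.
  apply: emeasurable_funM => //; apply/measurable_EFinP.
  by apply: measurableT_comp => //; exact: measurable_indic.
have F0 z : (0 <= F z)%E by rewrite mule_ge0// lee_fin.
have toF (f : R * R -> \bar R) : (\int[m2]_(q in Q) f q = \int[m2]_q (f q * (\1_Q q)%:E))%E.
  rewrite integral_mkcond; apply: eq_integral => q _; rewrite patchE indicE.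
  by case: (q \in Q); rewrite ?mule1 ?mule0.
transitivity (\int[m2]_p \int[m2]_q F (p, q))%E.
  by apply: eq_integral => p _; rewrite ekernel_mul toF.
rewrite -integral_gram toF [LHS](tonelli_pairs mu mu mu mu mF F0).
apply: eq_integral => q _; rewrite -gram_sqr /F /=.
by rewrite ge0_integralZr//; exact: measurableT_comp.
Qed.

End rosenblatt_kernel_cov.

Section ae_scalar.
Context {R : realType} {d : measure_display} {T : measurableType d}.
Variable mu : {measure set T -> \bar R}.
Implicit Types X Y : T -> R^o.

Lemma l2dot_ae X X' Y Y' : sqint mu X -> sqint mu X' -> sqint mu Y -> sqint mu Y' ->
  {ae mu, forall w, X w = X' w} -> {ae mu, forall w, Y w = Y' w} ->
  l2dot mu X Y = l2dot mu X' Y'.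
Proof.
move=> X2 X2' Y2 Y2' eX eY; rewrite /l2dot /Rintegral; congr fine.
have m (A B : T -> R^o) : sqint mu A -> sqint mu B ->
    measurable_fun setT (fun w => (ip (A w) (B w))%:E).
  move=> [mA _] [mB _]; apply/measurable_EFinP.
  by apply: (measurable_ip separable_scalars).
apply: ae_eq_integral => //; [exact: m|exact: m|].
by move: eX eY; apply: filterS2 => w -> ->.
Qed.

Lemma sqint_ae X X' : measurable_fun setT (X : T -> R) -> sqint mu X' ->
  {ae mu, forall w, X w = X' w} -> sqint mu X.
Proof.
move=> mX /sqint_scalarP[mX' X2'] eX; apply/sqint_scalarP; split => //.
rewrite (ae_eq_integral (fun w => (X' w ^+ 2)%:E))//.
- by apply/measurable_EFinP; exact: measurable_funX.
- by apply/measurable_EFinP; exact: measurable_funX.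
- by move: eX; apply: filterS => w ->.
Qed.

End ae_scalar.

Section rosenblatt_covariance.
Context {R : realType} {d : measure_display} {Omega : measurableType d}.
Variables (P : probability Omega R) (H T : R).
Hypotheses (H_range : 2^-1 < H < 1) (T0 : 0 <= T).
Notation mu := (@lebesgue_measure R).
Local Notation m2 := (mu \x mu)%E.

Definition riesz_energy (A B : set R) : \bar R :=
  (\int[m2]_(p in A `*` B) (riesz_kernel (2 * H - 2) p)%:E)%E.

Lemma riesz_energy_ge0 A B : (0 <= riesz_energy A B)%E.
Proof. by apply: integral_ge0 => p _; rewrite lee_fin riesz_kernel_ge0. Qed.

Let a_range : -1 < 2 * H - 2 < 0.
Proof. by move: H_range => /andP[h1 h2]; apply/andP; split; lra. Qed.

Lemma riesz_energy_fin A B : measurable A -> measurable B ->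
  A `<=` `[0, T] -> B `<=` `[0, T] -> riesz_energy A B \is a fin_num.
Proof.
move=> mA mB AT BT; rewrite ge0_fin_numE ?riesz_energy_ge0//.
apply: le_lt_trans (integral_riesz_square a_range T0).
apply: ge0_subset_integral => //.
- exact: measurableX.
- exact: measurable_square.
- by apply/measurable_EFinP; apply: measurable_funTS; exact: measurable_riesz_kernel.
- by move=> p _; rewrite lee_fin riesz_kernel_ge0.
- by move=> p [/= /AT h1 /BT h2].
Qed.

Let h := (H + 1) / 2.

Let subT t : t <= T -> `[0, t] `<=` (`[0, T] : set R).
Proof. by move=> tT x; rewrite /= !in_itv/= => /andP[-> /le_trans]; exact. Qed.

Let ekernel_mul_fin t s : t <= T -> s <= T ->
  (\int[m2]_p (ekernel H t p * ekernel H s p) =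
   ((h * (2 * h - 1)) ^+ 2)%:E * riesz_energy `[0%R, t] `[0%R, s])%E /\
  (\int[m2]_p (ekernel H t p * ekernel H s p) < +oo)%E.
Proof.
move=> tT sT; rewrite integral_ekernel_mul//; split => //.
have f := riesz_energy_fin (measurable_itv `[0, t]) (measurable_itv `[0, s]) (subT tT) (subT sT).
by rewrite -[X in (_ * X)%E](fineK f) -EFinM ltry.
Qed.

(** Finite square integral implies finite almost everywhere, so passing to the real-valued kernel
    with [fine] loses nothing under the integral. *)
Let ekernel_ae_fin t : t <= T -> {ae m2, forall p, ekernel H t p \is a fin_num}.
Proof.
move=> tT; have [_ fi] := ekernel_mul_fin tT tT.
have mk : measurable_fun setT (ekernel H t) by exact: measurable_ekernel.
have : m2.-integrable setT (fun p => ekernel H t p * ekernel H t p)%E.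
  apply/integrableP; split; first exact: emeasurable_funM.
  by under eq_integral do rewrite gee0_abs ?mule_ge0 ?ekernel_ge0//.
move=> /(integrable_ae measurableT); apply: filterS => p /(_ I).
have := ekernel_ge0 H t p; case: (ekernel H t p) => [r| |] //.
Qed.

Lemma l2dot_rosenblatt_kernel t s : t <= T -> s <= T ->
  l2dot m2 (cut_kernel t (rosenblatt_kernel H t)) (cut_kernel s (rosenblatt_kernel H s)) =
  (h * (2 * h - 1)) ^+ 2 * fine (riesz_energy `[0, t] `[0, s]).
Proof.
move=> tT sT; have [e _] := ekernel_mul_fin tT sT.
rewrite !(cut_rosenblatt_kernel H_range) /l2dot /Rintegral.
transitivity (fine (\int[m2]_p (ekernel H t p * ekernel H s p)%E)); last first.
  rewrite [X in fine X]e fineM//.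
  by apply: riesz_energy_fin => //; exact: subT.
congr fine; apply: ae_eq_integral => //.
- apply/measurable_EFinP; apply: measurable_funM;
    by apply: measurableT_comp => //; exact: measurable_ekernel.
- by apply: emeasurable_funM; exact: measurable_ekernel.
- move: (ekernel_ae_fin tT) (ekernel_ae_fin sT).
  apply: (@filterS2 _ _ (ae_filter_ringOfSetsType m2)) => p f1 f2 _.
  by rewrite /ip /= EFinM !fineK.
Qed.

Variable z : R -> {RV P >-> R}.
Hypothesis rz : rosenblatt_process H T z.

(** The normalization of the process at work: the leading 2 counts the two matchings, which coincide
    since the kernel is symmetric, and the last square comes from the Gram function. *)
Let const_sqr : 2 * rosenblatt_const H ^+ 2 * (h * (2 * h - 1)) ^+ 2 = H * (2 * H - 1).
Proof.
have [h1 h2] := andP H_range.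
have p0 : 0 < H / (2 * (2 * H - 1)) by rewrite divr_gt0//; lra.
have e : (H / (2 * (2 * H - 1))) `^ (- 2^-1) ^+ 2 = (H / (2 * (2 * H - 1)))^-1.
  rewrite expr2 -powRD; last by rewrite (gt_eqF p0) implybT.
  have -> : - 2^-1 - 2^-1 = - 1 :> R by field.
  by rewrite powR_inv1// ltW.
rewrite /rosenblatt_const exprMn e /h.
by field; apply/and3P; split; apply/eqP => x0; lra.
Qed.

Lemma rosenblatt_covariance t s : 0 <= t <= T -> 0 <= s <= T ->
  [/\ sqint P (z t : Omega -> R^o), l2dot P (z t : Omega -> R^o) (fun=> 1 : R^o) = 0 &
   l2dot P (z t : Omega -> R^o) (z s : Omega -> R^o) =
   H * (2 * H - 1) * fine (riesz_energy `[0, t] `[0, s])].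
Proof.
move=> tT sT; have [B [BM zB]] := rz.
have [Y dY eY] := zB t tT; have [Y' dY' eY'] := zB s sT.
have [/andP[_ tT'] /andP[_ sT']] := (tT, sT).
have [_ Y2 _] := double_wiener_approx BM tT' dY.
have [_ Y2' _] := double_wiener_approx BM sT' dY'.
have sS : separable (R^o : hilbertType R) by exact: separable_scalars.
set c := rosenblatt_const H in eY eY'.
have cY2 : sqint P (fun w => c *: (Y w : R^o)) by exact: sqintZ.
have cY2' : sqint P (fun w => c *: (Y' w : R^o)) by exact: sqintZ.
have z2 : sqint P (z t : Omega -> R^o) by exact: sqint_ae cY2 eY.
have z2' : sqint P (z s : Omega -> R^o) by exact: sqint_ae cY2' eY'.
have s1 := sqint_cst P (1 : R^o).
split => //.
  have e1 : {ae P, forall w, (fun=> 1 : R^o) w = (fun=> 1 : R^o) w} by exact: aeW.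
  rewrite (l2dot_ae z2 cY2 s1 s1 eY e1) (l2dotZl sS)// (double_wiener_mean BM tT' dY).
  by rewrite mulr0.
rewrite (l2dot_ae z2 cY2 z2' cY2' eY eY') (l2dotZl sS)// (l2dotZr sS)//.
rewrite (double_wiener_cov BM tT' sT' dY dY').
have -> : (cut_kernel s (rosenblatt_kernel H s) \o swap_pair : R * R -> R^o) = cut_kernel s (rosenblatt_kernel H s).
  by rewrite (cut_rosenblatt_kernel H_range); apply/funext => p /=; rewrite ekernel_swap.
rewrite l2dot_rosenblatt_kernel// -const_sqr -/c; ring.
Qed.

End rosenblatt_covariance.

(** * Wiener integrals with respect to the Rosenblatt process *)

Section cross_covariance.
Context {R : realType} {d : measure_display} {Omega : measurableType d}.
Variables (P : probability Omega R) (T : R) (J : set nat) (z : nat -> R -> {RV P >-> R}).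
Hypothesis indep : independent_classes P J
  (fun j => process_sigma_algebra T (fun t => z j t : Omega -> R)).

(** Independence factors the covariance into a product of means, and the first mean is 0. *)
Lemma cross_covariance j k t s : J j -> J k -> j != k -> 0 <= t <= T -> 0 <= s <= T ->
  sqint P (z j t : Omega -> R^o) -> sqint P (z k s : Omega -> R^o) ->
  l2dot P (z j t : Omega -> R^o) (fun=> 1 : R^o) = 0 ->
  l2dot P (z j t : Omega -> R^o) (z k s : Omega -> R^o) = 0.
Proof.
move=> Jj Jk jk tT sT zj2 zk2 mj.
pose zeta i : Omega -> R := if i == j then z j t else z k s.
have kj : (k == j) = false by rewrite eq_sym (negbTE jk).
pose J2 : set nat := [set i | i = j \/ i = k].
have mzeta i : measurable_fun setT (zeta i) by rewrite /zeta; case: ifP.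
have s1 := sqint_cst P (1 : R^o).
have sS : separable (R^o : hilbertType R) by exact: separable_scalars.
have ind2 (js : seq nat) (C : nat -> set R) : uniq js -> (forall i, i \in js -> J2 i) ->
    (forall i, measurable (C i)) ->
    P (\bigcap_(i in [set` js]) zeta i @^-1` C i) = (\prod_(i <- js) P (zeta i @^-1` C i))%E.
  move=> ujs jsJ mC; apply: indep => // i /jsJ [->|->].
    by split => //; apply: sub_sigma_algebra; exists t, (C j); rewrite /zeta eqxx.
  by split => //; apply: sub_sigma_algebra; exists s, (C k); rewrite /zeta kj.
have i1 X : sqint P (X : Omega -> R^o) -> P.-integrable setT (fun w => (X w)%:E).
  move=> X2; have := integrable_ip sS X2 s1.
  by under eq_fun do rewrite /ip/= mulr1.
have [|i iin|i|i iin|_] := @independent_product R d Omega P _ J2 zeta mzeta ind2 [:: j; k] (fun=> idfun).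
- by rewrite /= inE jk.
- by move: iin; rewrite !inE => /orP[/eqP->|/eqP->]; [left|right].
- exact: measurable_id.
- by move: iin; rewrite /zeta !inE => /orP[/eqP->|/eqP->]; rewrite ?eqxx ?kj; exact: i1.
rewrite 2!big_cons big_nil /=.
under eq_Rintegral do rewrite 2!big_cons big_nil /= mulr1 /zeta eqxx kj.
rewrite l2dot_scalarE => ->.
have -> : \int[P]_w zeta j w = 0.
  rewrite -[RHS]mj l2dot_scalarE; apply: eq_Rintegral => w _.
  by rewrite /zeta eqxx mulr1.
by rewrite mul0r.
Qed.

End cross_covariance.

(** * The bilinear form of the Riesz kernel *)

Section riesz_form.
Context {R : realType} {V : hilbertType R} (sepV : separable V).
Variables (a t : R).
Hypotheses (a01 : -1 < a < 0) (t0 : 0 <= t).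
Notation mu := (@lebesgue_measure R).
Local Notation m2 := (mu \x mu)%E.
Implicit Types f g h : R -> V.

(** A class that contains step functions and the semigroup orbits, is stable under linear
    combinations, and on which the integral defining the form converges absolutely. *)
Definition bounded_measurable f :=
  weakly_measurable (f : measurableTypeR R -> V) /\ exists M, forall s, `|f s| <= M.

Definition riesz_form f g : R :=
  fine (\int[m2]_(p in square t) (ip (f p.1) (g p.2) * riesz_kernel a p)%:E)%E.

Lemma bounded_measurableD f g : bounded_measurable f -> bounded_measurable g ->
  bounded_measurable (fun s => f s + g s).
Proof.
move=> [mf [M hM]] [mg [N hN]]; split; first exact: weakly_measurableD.
by exists (M + N) => s; apply: (le_trans (ler_normD _ _)); rewrite lerD.
Qed.

Lemma bounded_measurableZ c f : bounded_measurable f -> bounded_measurable (fun s => c *: f s).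
Proof.
move=> [mf [M hM]]; split; first exact: weakly_measurableZ.
by exists (`|c| * M) => s; rewrite normrZ ler_wpM2l.
Qed.

Lemma bounded_measurableB f g : bounded_measurable f -> bounded_measurable g ->
  bounded_measurable (fun s => f s - g s).
Proof.
move=> bf bg; have := bounded_measurableD bf (bounded_measurableZ (-1) bg).
by under eq_fun do rewrite scaleN1r.
Qed.

Lemma bounded_measurable_sum n (F : nat -> R -> V) :
  (forall i, bounded_measurable (F i)) -> bounded_measurable (fun s => \sum_(i < n) F i s).
Proof.
move=> bF; elim: n => [|n IH].
  split; first by under eq_fun do rewrite big_ord0; exact: weakly_measurable_cst.
  by exists 0 => s; rewrite big_ord0 normr0.
by under eq_fun do rewrite big_ord_recr; exact: bounded_measurableD.
Qed.

Lemma bounded_measurable_indic (A : set R) v : measurable A ->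
  bounded_measurable (fun s => (\1_A s : R) *: v).
Proof.
move=> mA; split; first by apply: weakly_measurable_scale; exact: measurable_indic.
by exists `|v| => s; rewrite normrZ ler_piMl// indicE; case: (_ \in _); rewrite ?normr1 ?normr0.
Qed.

Let pair_measurable f g : bounded_measurable f -> bounded_measurable g ->
  measurable_fun setT (fun p : measurableTypeR R * measurableTypeR R =>
    (ip (f p.1) (g p.2) * riesz_kernel a p)%:E).
Proof.
move=> [mf _] [mg _]; apply/measurable_EFinP; apply: measurable_funM; last exact: measurable_riesz_kernel.
apply: (measurable_ip sepV) => v.
  exact: (measurableT_comp (mf v) measurable_fst).
exact: (measurableT_comp (mg v) measurable_snd).
Qed.

Definition riesz_mass : R := fine (\int[m2]_(p in square t) (riesz_kernel a p)%:E)%E.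

Lemma riesz_mass_ge0 : 0 <= riesz_mass.
Proof. by apply: fine_ge0; apply: integral_ge0 => p _; rewrite lee_fin riesz_kernel_ge0. Qed.

Let riesz_massE : (\int[m2]_(p in square t) (riesz_kernel a p)%:E)%E = riesz_mass%:E.
Proof.
rewrite fineK// ge0_fin_numE; first exact: integral_riesz_square.
by apply: integral_ge0 => p _; rewrite lee_fin riesz_kernel_ge0.
Qed.

(* The bounds are only required off 0, which is not covered by the half-open
   intervals of a step function. *)
Lemma integral_riesz_bound f g M N : bounded_measurable f -> bounded_measurable g ->
  0 <= M -> 0 <= N ->
  (forall s, 0 < s <= t -> `|f s| <= M) -> (forall s, 0 < s <= t -> `|g s| <= N) ->
  (\int[m2]_(p in square t) `|(ip (f p.1) (g p.2) * riesz_kernel a p)%:E|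
    <= (M * N * riesz_mass)%:E)%E.
Proof.
move=> bf bg M0 N0 fM gN.
rewrite EFinM -riesz_massE -ge0_integralZl//; last 4 first.
- exact: measurable_square.
- by apply/measurable_EFinP; apply: measurable_funTS; exact: measurable_riesz_kernel.
- by move=> p _; rewrite lee_fin riesz_kernel_ge0.
- by rewrite lee_fin mulr_ge0.
apply: ae_ge0_le_integral => //.
- exact: measurable_square.
- by apply: measurableT_comp => //; apply: measurable_funTS; exact: pair_measurable.
- by move=> p _; rewrite -EFinM lee_fin !mulr_ge0 ?riesz_kernel_ge0.
- apply/measurable_EFinP; apply: measurable_funM => //.
  by apply: measurable_funTS; exact: measurable_riesz_kernel.
exists ([set 0] `*` setT `|` setT `*` [set 0] : set (R * R)); split.
- by apply: measurableU; apply: measurableX.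
- apply/eqP; rewrite -measure_le0; apply: (le_trans (measureU2 _ _ _)).
  + exact: measurableX.
  + exact: measurableX.
  + rewrite [X in (X + _)%E]product_measure1E// [X in (_ + X)%E]product_measure1E//.
    rewrite [X in (X * _ + _)%E](lebesgue_measure_set1 0) [X in (_ + _ * X)%E](lebesgue_measure_set1 0).
    by rewrite mul0e mule0 adde0.
move=> p /= np; apply: contrapT => /not_orP[p1 p2]; apply: np => /= -[].
rewrite /= !in_itv/= => /andP[u0 ut] /andP[v0 vt].
rewrite -EFinM lee_fin normrM [`|riesz_kernel _ _|]ger0_norm ?riesz_kernel_ge0//.
rewrite ler_wpM2r ?riesz_kernel_ge0//; apply: (le_trans (cauchy_schwarz _ _)).
apply: ler_pM => //.
  by apply: fM; rewrite ut andbT lt_neqAle u0 andbT; apply/eqP => e0; apply: p1; split.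
by apply: gN; rewrite vt andbT lt_neqAle v0 andbT; apply/eqP => e0; apply: p2; split.
Qed.

Lemma integrable_riesz_form f g : bounded_measurable f -> bounded_measurable g ->
  m2.-integrable (square t) (fun p => (ip (f p.1) (g p.2) * riesz_kernel a p)%:E).
Proof.
move=> bf bg; apply/integrableP; split; first by apply: measurable_funTS; exact: pair_measurable.
have [_ [M hM]] := bf; have [_ [N hN]] := bg.
have M0 : 0 <= M := le_trans (normr_ge0 _) (hM 0).
have N0 : 0 <= N := le_trans (normr_ge0 _) (hN 0).
by rewrite (le_lt_trans (integral_riesz_bound bf bg M0 N0 _ _)) ?ltry.
Qed.

Lemma riesz_formE f g : bounded_measurable f -> bounded_measurable g ->
  (\int[m2]_(p in square t) (ip (f p.1) (g p.2) * riesz_kernel a p)%:E)%E = (riesz_form f g)%:E.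
Proof.
move=> bf bg; rewrite /riesz_form fineK//.
by apply: integrable_fin_num; [exact: measurable_square|exact: integrable_riesz_form].
Qed.

Lemma riesz_form_le f g M N : bounded_measurable f -> bounded_measurable g ->
  0 <= M -> 0 <= N ->
  (forall s, 0 < s <= t -> `|f s| <= M) -> (forall s, 0 < s <= t -> `|g s| <= N) ->
  `|riesz_form f g| <= M * N * riesz_mass.
Proof.
move=> bf bg M0 N0 fM gN; rewrite -lee_fin -abse_EFin -riesz_formE//.
apply: le_trans (integral_riesz_bound bf bg M0 N0 fM gN).
apply: le_abse_integral; first exact: measurable_square.
by apply: measurable_funTS; exact: pair_measurable.
Qed.

Lemma riesz_formDl f g h : bounded_measurable f -> bounded_measurable g -> bounded_measurable h ->
  riesz_form (fun s => f s + g s) h = riesz_form f h + riesz_form g h.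
Proof.
move=> bf bg bh; rewrite {1}/riesz_form.
under eq_integral do rewrite ipDl mulrDl EFinD.
rewrite integralD//; first by rewrite !riesz_formE.
- exact: measurable_square.
- exact: integrable_riesz_form.
- exact: integrable_riesz_form.
Qed.

Lemma riesz_formDr f g h : bounded_measurable f -> bounded_measurable g -> bounded_measurable h ->
  riesz_form h (fun s => f s + g s) = riesz_form h f + riesz_form h g.
Proof.
move=> bf bg bh; rewrite {1}/riesz_form.
under eq_integral do rewrite ipDr mulrDl EFinD.
rewrite integralD//; first by rewrite !riesz_formE.
- exact: measurable_square.
- exact: integrable_riesz_form.
- exact: integrable_riesz_form.
Qed.

Lemma riesz_formZl c f g : bounded_measurable f -> bounded_measurable g ->
  riesz_form (fun s => c *: f s) g = c * riesz_form f g.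
Proof.
move=> bf bg; rewrite {1}/riesz_form.
under eq_integral do rewrite ipZl -mulrA EFinM.
rewrite integralZl//; first by rewrite riesz_formE.
- exact: measurable_square.
- exact: integrable_riesz_form.
Qed.

Lemma riesz_formZr c f g : bounded_measurable f -> bounded_measurable g ->
  riesz_form f (fun s => c *: g s) = c * riesz_form f g.
Proof.
move=> bf bg; rewrite {1}/riesz_form.
under eq_integral do rewrite ipZr -mulrA EFinM.
rewrite integralZl//; first by rewrite riesz_formE.
- exact: measurable_square.
- exact: integrable_riesz_form.
Qed.

Lemma riesz_formBl f g h : bounded_measurable f -> bounded_measurable g -> bounded_measurable h ->
  riesz_form (fun s => f s - g s) h = riesz_form f h - riesz_form g h.
Proof.
move=> bf bg bh; under eq_fun do rewrite -scaleN1r.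
rewrite riesz_formDl ?riesz_formZl ?mulN1r//; exact: bounded_measurableZ.
Qed.

Lemma riesz_formBr f g h : bounded_measurable f -> bounded_measurable g -> bounded_measurable h ->
  riesz_form h (fun s => f s - g s) = riesz_form h f - riesz_form h g.
Proof.
move=> bf bg bh; under eq_fun do rewrite -scaleN1r.
rewrite riesz_formDr ?riesz_formZr ?mulN1r//; exact: bounded_measurableZ.
Qed.

Lemma riesz_form_suml n (F : nat -> R -> V) g :
  (forall i, bounded_measurable (F i)) -> bounded_measurable g ->
  riesz_form (fun s => \sum_(i < n) F i s) g = \sum_(i < n) riesz_form (F i) g.
Proof.
move=> bF bg; elim: n => [|n IH].
  rewrite big_ord0 /riesz_form integral0_eq// => p _.
  by rewrite big_ord0 ip0l mul0r.
rewrite [RHS]big_ord_recr /= -IH -riesz_formDl//; last exact: bounded_measurable_sum.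
by congr riesz_form; apply/funext => s; rewrite big_ord_recr.
Qed.

Lemma riesz_form_sumr n (F : nat -> R -> V) g :
  (forall i, bounded_measurable (F i)) -> bounded_measurable g ->
  riesz_form g (fun s => \sum_(i < n) F i s) = \sum_(i < n) riesz_form g (F i).
Proof.
move=> bF bg; elim: n => [|n IH].
  rewrite big_ord0 /riesz_form integral0_eq// => p _.
  by rewrite big_ord0 ip0r mul0r.
rewrite [RHS]big_ord_recr /= -IH -riesz_formDr//; last exact: bounded_measurable_sum.
by congr riesz_form; apply/funext => s; rewrite big_ord_recr.
Qed.

End riesz_form.

Section scaled_vectors.
Context {R : realType} {V : hilbertType R} {d : measure_display} {T : measurableType d}.
Variable mu : {measure set T -> \bar R}.
Implicit Types X Y : T -> R^o.

Lemma sqint_scale X (v : V) : sqint mu X -> sqint mu (fun w => X w *: v).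
Proof.
move=> /sqint_scalarP[mX X2]; split; first exact: weakly_measurable_scale.
have -> : (fun w => (`|X w *: v| ^+ 2)%:E) = (fun w => (`|v| ^+ 2)%:E * (X w ^+ 2)%:E)%E.
  by apply/funext => w; rewrite normrZ exprMn real_normK ?num_real// mulrC EFinM.
rewrite ge0_integralZl_EFin//.
- by rewrite lte_mul_pinfty// lee_fin sqr_ge0.
- by move=> w _; rewrite lee_fin sqr_ge0.
- by apply/measurable_EFinP; exact: measurable_funX.
Qed.

Lemma l2dot_scale X Y (v u : V) : sqint mu X -> sqint mu Y ->
  l2dot mu (fun w => X w *: v) (fun w => Y w *: u) = ip v u * l2dot mu X Y.
Proof.
move=> X2 Y2; rewrite l2dot_scalarE -RintegralZl//.
  by apply: eq_Rintegral => w _; rewrite ipZl ipZr; ring.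
exact: (integrable_ip separable_scalars X2 Y2).
Qed.

End scaled_vectors.

Record step_data (R : realType) (V : hilbertType R) :=
  StepData { step_n : nat; step_a : nat -> R; step_b : nat -> R; step_v : nat -> V }.

Section steps.
Context {R : realType} {V : hilbertType R}.
Implicit Types (s : step_data V) (t : R).

Definition stepf s := step_fun (step_n s) (step_a s) (step_b s) (step_v s).

Definition step_within t s := forall i, (i < step_n s)%N ->
  0 <= step_a s i <= step_b s i /\ step_b s i <= t.

Definition stepI d (Omega : measurableType d) (z : R -> Omega -> R) s :=
  step_integral z (step_n s) (step_a s) (step_b s) (step_v s).

(** The point 0 is left out because step functions are built on intervals open at the left; the form
    does not see it. *)
Definition uniform_step_limit t (f : R -> V) := forall eps, 0 < eps ->
  exists2 s, step_within t s & forall u, 0 < u <= t -> `|f u - stepf s u| <= eps.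

Lemma bounded_measurable_stepf s : bounded_measurable (stepf s).
Proof.
apply: (bounded_measurable_sum (step_n s)
  (F := fun i u => (\1_(`]step_a s i, step_b s i]) u : R) *: step_v s i)) => i.
exact: bounded_measurable_indic.
Qed.

End steps.

Section wiener.
Context {R : realType} {d : measure_display} {Omega : measurableType d}.
Variables (P : probability Omega R) (H T : R) (J : set nat) (z : nat -> R -> {RV P >-> R}).
Hypotheses (H_range : 2^-1 < H < 1).
Hypothesis rz : forall j, J j -> rosenblatt_process H T (z j).
Hypothesis indep : independent_classes P J
  (fun j => process_sigma_algebra T (fun t => z j t : Omega -> R)).
Variable t : R.
Hypothesis tT : 0 <= t <= T.
Notation mu := (@lebesgue_measure R).
Local Notation m2 := (mu \x mu)%E.

Let t0 : 0 <= t. Proof. by case/andP: tT. Qed.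
Let T0 : 0 <= T. Proof. by case/andP: tT => /le_trans h /h. Qed.

Let a_range : -1 < 2 * H - 2 < 0.
Proof. by move: H_range => /andP[h1 h2]; apply/andP; split; lra. Qed.

Local Notation W := (riesz_form (2 * H - 2) t).
Local Notation zr j s := (z j s : Omega -> R^o).

Definition covariance_const : R := H * (2 * H - 1).
Local Notation kappa := covariance_const.

Lemma covariance_const_gt0 : 0 < kappa.
Proof. by move: H_range => /andP[h1 h2]; rewrite /kappa mulr_gt0; lra. Qed.

Let sS : separable (R^o : hilbertType R). Proof. exact: separable_scalars. Qed.

Lemma riesz_form_indic (A B : set R) : A `<=` `[0, t] -> B `<=` `[0, t] ->
  W (\1_A : R -> R^o) (\1_B : R -> R^o) = fine (riesz_energy H A B).
Proof.
move=> At Bt; rewrite /riesz_form /riesz_energy; congr fine.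
rewrite integral_mkcond [RHS]integral_mkcond; apply: eq_integral => p _.
rewrite !patchE /ip/= !indicE.
have -> : (p \in A `*` B) = (p.1 \in A) && (p.2 \in B).
  by apply/idP/andP => [|[]]; rewrite !inE.
case: ifPn => pt; first by case: (_ \in A); case: (_ \in B); rewrite /= ?mul1r ?mul0r.
case: ifPn => // /andP[]; rewrite !inE => /At pA /Bt pB.
by move: pt; rewrite notin_setE => -[]; split.
Qed.

Lemma riesz_form_indicZ (V : hilbertType R) (sepV : separable V) (A B : set R) (v u : V) : measurable A -> measurable B ->
  W (fun s => (\1_A s : R) *: v) (fun s => (\1_B s : R) *: u) =
  ip v u * W (\1_A : R -> R^o) (\1_B : R -> R^o).
Proof.
move=> mA mB.
have b (C : set R) : measurable C -> bounded_measurable (\1_C : R -> R^o).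
  move=> mC; have := bounded_measurable_indic (1 : R^o) mC.
  by congr bounded_measurable; apply/funext => s; rewrite /GRing.scale /= mulr1.
have bZ (C : set R) (x : V) : measurable C -> bounded_measurable (fun s => (\1_C s : R) *: x).
  exact: bounded_measurable_indic.
apply/EFin_inj; rewrite EFinM -(riesz_formE sS a_range t0 (b _ mA) (b _ mB)).
rewrite -integralZl//; last 2 first.
- exact: measurable_square.
- by apply: integrable_riesz_form => //; exact: b.
rewrite -(riesz_formE sepV a_range t0 (bZ _ v mA) (bZ _ u mB)).
by apply: eq_integral => p _; rewrite -EFinM ipZl ipZr /ip/=; congr EFin; ring.
Qed.

Let cov j s r : J j -> 0 <= s <= t -> 0 <= r <= t ->
  [/\ sqint P (zr j s), l2dot P (zr j s) (fun=> 1 : R^o) = 0 &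
   l2dot P (zr j s) (zr j r) = kappa * W (\1_`[0, s] : R -> R^o) (\1_`[0, r] : R -> R^o)].
Proof.
move=> Jj /andP[s0 st] /andP[r0 rt]; have [_ tT'] := andP tT.
have sT : 0 <= s <= T by rewrite s0 (le_trans st).
have rT : 0 <= r <= T by rewrite r0 (le_trans rt).
have [h1 h2 ->] := rosenblatt_covariance H_range T0 (rz Jj) sT rT.
have sub x : x <= t -> `[0, x] `<=` (`[0, t] : set R).
  by move=> xt y; rewrite /= !in_itv/= => /andP[-> /le_trans]; exact.
by rewrite riesz_form_indic//; exact: sub.
Qed.

Let z2 j s : J j -> 0 <= s <= t -> sqint P (zr j s).
Proof. by move=> Jj st; have [] := cov Jj st st. Qed.

Let within (a b : R) : 0 <= a <= b /\ b <= t -> 0 <= a <= t /\ 0 <= b <= t.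
Proof.
by move=> [/andP[a0 ab] bt]; rewrite a0 (le_trans ab)// bt (le_trans a0).
Qed.

Let increment2 j a b : J j -> 0 <= a <= b /\ b <= t -> sqint P (fun w => zr j b w - zr j a w).
Proof. by move=> Jj /within[aT bT]; apply: (sqintB sS); exact: z2. Qed.

(** The covariance at two times is the form of the indicators of [0, s] and [0, r]; bilinearity
    extends it to increments, as the indicator of ]a, b] is that of [0, b] minus that of [0, a]. *)
Lemma increment_covariance j a b a' b' : J j -> 0 <= a <= b /\ b <= t -> 0 <= a' <= b' /\ b' <= t ->
  l2dot P (fun w => zr j b w - zr j a w) (fun w => zr j b' w - zr j a' w) =
  kappa * W (\1_`]a, b] : R -> R^o) (\1_`]a', b'] : R -> R^o).
Proof.
move=> Jj ab ab'; have [aT bT] := within ab; have [aT' bT'] := within ab'.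
have [za zb za' zb'] : [/\ sqint P (zr j a), sqint P (zr j b), sqint P (zr j a') & sqint P (zr j b')].
  by split; exact: z2.
rewrite (l2dotBl sS)//; last exact: (sqintB sS).
rewrite !(l2dotBr sS)//.
have [_ _ ->] := cov Jj bT bT'; have [_ _ ->] := cov Jj bT aT'.
have [_ _ ->] := cov Jj aT bT'; have [_ _ ->] := cov Jj aT aT'.
have E (x y : R) : 0 <= x <= y -> (\1_`]x, y] : R -> R^o) = fun s => (\1_`[0%R, y] s : R^o) - (\1_`[0%R, x] s : R^o).
  move=> /andP[x0 xy]; apply/funext => s; rewrite !indicE !mem_setE !in_itv/=.
  have [s0|s0] := leP 0 s; last by rewrite ltNge (le_trans (ltW s0)) /= ?subrr.
  have [sx|xs] := leP s x; first by rewrite (le_trans sx)// subrr.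
  by rewrite subr0.
have b1 (x : R) : bounded_measurable (\1_`[0%R, x] : R -> R^o).
  have := bounded_measurable_indic (1 : R^o) (measurable_itv `[0, x]).
  by congr bounded_measurable; apply/funext => s; rewrite /GRing.scale /= mulr1.
rewrite (E _ _ ab.1) (E _ _ ab'.1) (riesz_formBl sS a_range t0)//; last exact: bounded_measurableB.
by rewrite !(riesz_formBr sS a_range t0)//; ring.
Qed.

Lemma cross_increment j k a b a' b' : J j -> J k -> j != k ->
  0 <= a <= b /\ b <= t -> 0 <= a' <= b' /\ b' <= t ->
  l2dot P (fun w => zr j b w - zr j a w) (fun w => zr k b' w - zr k a' w) = 0.
Proof.
move=> Jj Jk jk ab ab'; have [aT bT] := within ab; have [aT' bT'] := within ab'.
have c s r : 0 <= s <= t -> 0 <= r <= t -> l2dot P (zr j s) (zr k r) = 0.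
  move=> st rt; have [_ tT'] := andP tT.
  apply: (cross_covariance indep) => //.
  - by case/andP: st => -> /le_trans; apply.
  - by case/andP: rt => -> /le_trans; apply.
  - exact: z2.
  - exact: z2.
  - by have [] := cov Jj st st.
have [za zb za' zb'] : [/\ sqint P (zr j a), sqint P (zr j b), sqint P (zr k a') & sqint P (zr k b')].
  by split; exact: z2.
rewrite (l2dotBl sS)//; last exact: (sqintB sS).
by rewrite !(l2dotBr sS)// !c// !subrr.
Qed.

Variable V : hilbertType R.
Hypothesis sepV : separable V.
Implicit Types (s : step_data V) (f g : R -> V).

Local Notation zI j s := (stepI (fun r => z j r : Omega -> R) s).

Let term j s i w : V := (z j (step_b s i) w - z j (step_a s i) w) *: step_v s i.

Let term2 j s (i : 'I_(step_n s)) : J j -> step_within t s -> sqint P (term j s i).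
Proof.
by move=> Jj ws; apply: (sqint_scale (X := fun w => zr j _ w - zr j _ w)); apply: increment2 => //; exact: ws.
Qed.

Lemma sqint_stepI j s : J j -> step_within t s -> sqint P (zI j s).
Proof. by move=> Jj ws; apply: (sqint_sum sepV) => i _; exact: term2. Qed.

Lemma stepI_isometry j s s' : J j -> step_within t s -> step_within t s' ->
  l2dot P (zI j s) (zI j s') = kappa * W (stepf s) (stepf s').
Proof.
move=> Jj ws ws'; have I2 := sqint_stepI Jj ws'.
pose F r i u : V := (\1_(`]step_a r i, step_b r i]) u : R) *: step_v r i.
have bF r i : bounded_measurable (F r i) by exact: bounded_measurable_indic.
rewrite (l2dot_suml sepV _ (fun i (_ : true) => @term2 j s i Jj ws) I2).
rewrite (riesz_form_suml sepV a_range t0 (step_n s) (bF s)); last exact: bounded_measurable_stepf.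
rewrite mulr_sumr; apply: eq_bigr => i _.
rewrite (l2dot_sumr sepV _ (fun l (_ : true) => @term2 j s' l Jj ws') (@term2 j s i Jj ws)).
rewrite (riesz_form_sumr sepV a_range t0 (step_n s') (bF s')) ?bF// mulr_sumr.
apply: eq_bigr => k _.
rewrite (riesz_form_indicZ sepV)// mulrCA -(increment_covariance Jj (ws _ (ltn_ord i)) (ws' _ (ltn_ord k))).
by rewrite -l2dot_scale//; apply: increment2 => //; [exact: ws|exact: ws'].
Qed.

Lemma stepI_cross j k s s' : J j -> J k -> j != k -> step_within t s -> step_within t s' ->
  l2dot P (zI j s) (zI k s') = 0.
Proof.
move=> Jj Jk jk ws ws'; have I2 := sqint_stepI Jk ws'.
rewrite (l2dot_suml sepV _ (fun i (_ : true) => @term2 j s i Jj ws) I2).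
apply: big1 => i _.
rewrite (l2dot_sumr sepV _ (fun l (_ : true) => @term2 k s' l Jk ws') (@term2 j s i Jj ws)).
apply: big1 => l _.
rewrite (l2dot_scale (X := fun w => zr j _ w - zr j _ w) (Y := fun w => zr k _ w - zr k _ w)).
- by rewrite cross_increment ?mulr0//; [exact: ws|exact: ws'].
- by apply: increment2 => //; exact: ws.
- by apply: increment2 => //; exact: ws'.
Qed.

Let stepI2 := sqint_stepI.

Lemma riesz_form_perturb f g eps M : bounded_measurable f -> bounded_measurable g ->
  0 <= eps -> 0 <= M -> (forall u, 0 < u <= t -> `|f u| <= M) ->
  (forall u, 0 < u <= t -> `|f u - g u| <= eps) ->
  `|W g g - W f f| <= (eps * (2 * M + eps)) * riesz_mass (2 * H - 2) t.
Proof.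
move=> bf bg e0 M0 fM fg; have bd := bounded_measurableB bf bg.
set C := riesz_mass _ _.
pose D u := f u - g u.
have -> : W g g - W f f = W D D - W f D - W D f.
  rewrite /D !(riesz_formBl sepV a_range t0)// !(riesz_formBr sepV a_range t0)//; ring.
have h1 := riesz_form_le sepV a_range t0 bd bd e0 e0 fg fg.
have h2 := riesz_form_le sepV a_range t0 bf bd M0 e0 fM fg.
have h3 := riesz_form_le sepV a_range t0 bd bf e0 M0 fg fM.
apply: (le_trans (ler_normB _ _)); apply: le_trans (lerD (ler_normB _ _) (lexx _)) _.
apply: (le_trans (lerD (lerD h1 h2) h3)); rewrite -/C.
by rewrite le_eqVlt; apply/orP; left; apply/eqP; ring.
Qed.

Lemma stepI_combination j s s' c : J j -> step_within t s -> step_within t s' ->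
  kappa * W (fun u => stepf s u - c *: stepf s' u) (fun u => stepf s u - c *: stepf s' u) =
  l2dot P (fun w => zI j s w - c *: zI j s' w) (fun w => zI j s w - c *: zI j s' w).
Proof.
move=> Jj ws ws'; have [I2 I2'] := (stepI2 Jj ws, stepI2 Jj ws').
have cI2 := sqintZ sepV c I2'.
have [b b'] := (bounded_measurable_stepf s, bounded_measurable_stepf s').
have cb := bounded_measurableZ c b'.
rewrite (riesz_formBl sepV a_range t0)//; last exact: bounded_measurableB.
rewrite !(riesz_formBr sepV a_range t0)// !(riesz_formZl sepV a_range t0)// !(riesz_formZr sepV a_range t0)//.
rewrite (l2dotBl sepV)//; last exact: (sqintB sepV).
rewrite !(l2dotBr sepV)// !(l2dotZl sepV)// !(l2dotZr sepV)// !stepI_isometry//.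
ring.
Qed.

(* On step functions the form is a second moment; nonnegativity passes to uniform
   limits. *)
Lemma step_limit_pos j f s c : J j -> bounded_measurable f -> uniform_step_limit t f ->
  step_within t s -> 0 <= W (fun u => f u - c *: stepf s u) (fun u => f u - c *: stepf s u).
Proof.
move=> Jj bf lf ws.
have bs := bounded_measurable_stepf s.
have bg := bounded_measurableB bf (bounded_measurableZ c bs).
set g := (fun u => _) in bg *; have [_ [M hM]] := bg.
have M0 : 0 <= M := le_trans (normr_ge0 _) (hM 0).
have C0 := riesz_mass_ge0 (2 * H - 2) t; set C := riesz_mass _ _ in C0.
have K e : 0 < e <= 1 -> - W g g <= e * ((2 * M + 1) * C).
  move=> /andP[e0 e1]; have [r wr hr] := lf _ e0.
  have br := bounded_measurable_stepf r.
  pose h u := stepf r u - c *: stepf s u.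
  have bh : bounded_measurable h by exact: bounded_measurableB br (bounded_measurableZ c bs).
  have gh u : 0 < u <= t -> `|g u - h u| <= e.
    by move=> /hr; congr (`|_| <= _); rewrite /g /h; rewrite opprB addrC addrA subrK addrC.
  have h0 : 0 <= W h h.
    by rewrite -(pmulr_rge0 _ covariance_const_gt0) (stepI_combination c Jj)// l2dot_ge0.
  have := riesz_form_perturb bg bh (ltW e0) M0 (fun u _ => hM u) gh; rewrite -/C => le1.
  have : W h h - W g g <= e * (2 * M + e) * C by apply: le_trans le1; exact: ler_norm.
  have : e * (2 * M + e) * C <= e * ((2 * M + 1) * C).
    by rewrite -mulrA; apply: ler_wpM2l; [exact: ltW|]; apply: ler_wpM2r => //; lra.
  lra.
have K0 : 0 <= (2 * M + 1) * C by apply: mulr_ge0 => //; lra.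
move: ((2 * M + 1) * C) K K0 => Q K K0; rewrite leNgt; apply/negP => n0.
move: (W g g) n0 K => x n0 K.
(* For a negative value x of the form, an error e with eQ <= -x/2 contradicts -x <= eQ. *)
have e0 : 0 < - x / (2 * (Q + 1)) by apply: divr_gt0; lra.
have := K (Num.min 1 (- x / (2 * (Q + 1)))); rewrite lt_min ltr01 e0 ge_min lexx /=.
move=> /(_ isT); have : Num.min 1 (- x / (2 * (Q + 1))) * Q <= - x / 2.
  apply: (@le_trans _ _ (- x / (2 * (Q + 1)) * Q)).
    by apply: ler_wpM2r => //; rewrite ge_min lexx orbT.
  have -> : - x / (2 * (Q + 1)) * Q = - x / 2 * (Q / (Q + 1)) by field; lra.
  by apply: ler_piMr; [lra|rewrite ler_pdivrMr; lra].
lra.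
Qed.

(* Parallelogram law: the forms of [f - 2 s] and [f - s / 2] are nonnegative. *)
Lemma step_form_le j f s : J j -> bounded_measurable f -> uniform_step_limit t f ->
  step_within t s ->
  W f f <= 2 * W (stepf s) (stepf s) + 2 * W (fun u => f u - stepf s u) (fun u => f u - stepf s u) /\
  W (stepf s) (stepf s) <= 2 * W f f + 2 * W (fun u => f u - stepf s u) (fun u => f u - stepf s u).
Proof.
move=> Jj bf lf ws; have bs := bounded_measurable_stepf s.
have := step_limit_pos 2 Jj bf lf ws; have := step_limit_pos 2^-1 Jj bf lf ws.
have b1 := bounded_measurableZ 2 bs; have b2 := bounded_measurableZ 2^-1 bs.
do 3![rewrite (riesz_formBl sepV a_range t0)//; last exact: bounded_measurableB].
rewrite !(riesz_formBr sepV a_range t0)// !(riesz_formZl sepV a_range t0)// !(riesz_formZr sepV a_range t0)//.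
by move=> h1 h2; split; lra.
Qed.

Lemma wiener_norm2E f : bounded_measurable f -> wiener_norm2 H t f = (kappa * W f f)%:E.
Proof. by move=> bf; rewrite EFinM -(riesz_formE sepV a_range t0 bf bf). Qed.

Lemma L2_rvP (Y : Omega -> V) : L2_rv P Y <-> sqint P Y.
Proof. by split => -[h1 h2]; split => //; apply/(borel_weakly_measurable sepV). Qed.

Local Notation wI j := (wiener_integral P H (fun r => z j r : Omega -> R) t).

Lemma wiener_integralP j f Y : J j -> bounded_measurable f -> wI j f Y ->
  sqint P Y /\ exists s : nat -> step_data V,
  [/\ forall k, step_within t (s k),
      kappa * W (fun u => f u - stepf (s k) u) (fun u => f u - stepf (s k) u) @[k --> \oo] --> (0 : R) &
      l2to P (fun k => zI j (s k)) Y].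
Proof.
move=> Jj bf [_ /L2_rvP Y2 [n [a [b [v [wab cf cY]]]]]]; split => //.
pose s k := StepData (n k) (a k) (b k) (v k); exists s.
have ws k : step_within t (s k) by move=> i; exact: wab.
split => //.
  have bfs k := bounded_measurableB bf (bounded_measurable_stepf (s k)).
  move: cf; rewrite (_ : (fun k => _) = (fun k => (kappa * W (fun u => f u - stepf (s k) u) (fun u => f u - stepf (s k) u))%:E)).
    by move=> /fine_cvgP[].
  by apply/funext => k; rewrite -wiener_norm2E.
by apply/(l2toP sepV) => // k; exact: stepI2.
Qed.

(** The approximating steps converge to f only in the form, while their integrals converge in L^2.
    [step_form_le] links the two limits at the price of a factor 2. *)
Lemma wiener_integral_energy j f Y : J j -> bounded_measurable f -> uniform_step_limit t f ->
  wI j f Y -> kappa * W f f <= 2 * l2dot P Y Y /\ l2dot P Y Y <= 2 * (kappa * W f f).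
Proof.
move=> Jj bf lf /(wiener_integralP Jj bf)[Y2 [s [ws cf cY]]].
have cn := l2to_norm_cvg sepV (fun k => stepI2 Jj (ws k)) Y2 cY.
pose D k := kappa * W (fun u => f u - stepf (s k) u) (fun u => f u - stepf (s k) u).
have k0 := ltW covariance_const_gt0.
split.
- have c : 2 * l2dot P (zI j (s k)) (zI j (s k)) + 2 * D k @[k --> \oo] --> 2 * l2dot P Y Y + 2 * 0.
    by apply: cvgD; apply: cvgMr.
  rewrite mulr0 addr0 in c.
  apply: ler_cvg_to (cvg_cst _) c _; apply: nearW => k.
  rewrite stepI_isometry// /D mulrCA [in leRHS](mulrCA 2) -mulrDr; apply: ler_wpM2l => //.
  exact: (step_form_le Jj bf lf (ws k)).1.
- have c : 2 * (kappa * W f f) + 2 * D k @[k --> \oo] --> 2 * (kappa * W f f) + 2 * 0.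
    by apply: cvgD; [exact: cvg_cst|apply: cvgMr].
  rewrite mulr0 addr0 in c.
  apply: ler_cvg_to cn c _; apply: nearW => k.
  rewrite stepI_isometry// /D mulrCA [in leRHS](mulrCA 2) -mulrDr; apply: ler_wpM2l => //.
  exact: (step_form_le Jj bf lf (ws k)).2.
Qed.

Lemma wiener_integral_orthogonal j k f g Y Y' : J j -> J k -> j != k ->
  bounded_measurable f -> bounded_measurable g ->
  wI j f Y -> wI k g Y' -> l2dot P Y Y' = 0.
Proof.
move=> Jj Jk jk bf bg /(wiener_integralP Jj bf)[Y2 [s [ws _ cY]]].
move=> /(wiener_integralP Jk bg)[Y2' [s' [ws' _ cY']]].
have c := l2dot_cvg sepV (fun i => stepI2 Jj (ws i)) (fun i => stepI2 Jk (ws' i)) Y2 Y2' cY cY'.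
move: c; rewrite (_ : (fun i => _) = cst 0) => [c|].
  by apply: (cvg_unique _ c); [exact: Rhausdorff|exact: cvg_cst].
by apply/funext => i; rewrite stepI_cross.
Qed.

Lemma bounded_wiener_integrand f : bounded_measurable f -> wiener_integrand H t f.
Proof.
move=> bf; have [mf [M hM]] := bf; split.
  apply: measurable_funTS; exact/(borel_weakly_measurable sepV).
have M0 : 0 <= M := le_trans (normr_ge0 _) (hM 0).
pose v0 : R -> R^o := fun u => `|f u|.
have bv : bounded_measurable v0.
  split; last by exists M => u; rewrite /v0 normr_id.
  by move=> v; apply: measurable_funM => //; exact: (measurable_norm sepV mf).
have := integrable_riesz_form sS a_range t0 bv bv => /integrableP[_].
congr (_ < +oo)%E; apply: eq_integral => p _.
by rewrite abse_EFin ger0_norm// /ip/= /v0 !mulr_ge0 ?riesz_kernel_ge0.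
Qed.

Lemma wiener_integral_exists j f : J j -> bounded_measurable f -> uniform_step_limit t f ->
  exists2 Y, sqint P Y & wI j f Y.
Proof.
move=> Jj bf lf.
have /choice[s hs] : forall k : nat, exists s : step_data V, step_within t s /\
    forall u, 0 < u <= t -> `|f u - stepf s u| <= k.+1%:R^-1.
  by move=> k; have [|s ? ?] := lf k.+1%:R^-1; [rewrite invr_gt0|exists s].
have ws k : step_within t (s k) := (hs k).1.
have C0 := riesz_mass_ge0 (2 * H - 2) t; set C := riesz_mass _ _ in C0.
have k0 := ltW covariance_const_gt0.
have bs k := bounded_measurable_stepf (s k).
have I2 k := stepI2 Jj (ws k).
have cau (e : R) : 0 < e -> exists N, forall m n, (N <= m)%N -> (N <= n)%N ->
    l2dot P (fun w => zI j (s n) w - zI j (s m) w) (fun w => zI j (s n) w - zI j (s m) w) <= e.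
  (* Two steps within p of f differ by at most 2p, so their integrals have squared distance at most
     4 kappa C p^2; p <= 1 and pQ <= e bring this below e. *)
  move=> e0; pose Q := 4 * (kappa * C) + 1.
  have Q0 : 0 < Q by have := mulr_ge0 k0 C0; rewrite /Q; lra.
  have [N hN] : exists N : nat, N.+1%:R^-1 <= Num.min 1 (e / Q).
    exists (Num.truncn (Num.min 1 (e / Q))^-1).
    rewrite invf_ple ?posrE ?ltr0n//; last by rewrite lt_min ltr01 divr_gt0.
    by apply: ltW; exact: truncnS_gt.
  exists N => m n Nm Nn.
  have := stepI_combination 1 Jj (ws n) (ws m).
  under [in RHS]eq_fun do rewrite scale1r.
  under [in LHS]eq_fun do rewrite scale1r.
  move=> <-.
  set p := N.+1%:R^-1 in hN; have p0 : 0 < p by rewrite invr_gt0.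
  have pN k : (N <= k)%N -> k.+1%:R^-1 <= p by move=> Nk; rewrite lef_pV2 ?posrE// ler_nat.
  have b u : 0 < u <= t -> `|stepf (s n) u - stepf (s m) u| <= 2 * p.
    move=> ut; have -> : stepf (s n) u - stepf (s m) u = (f u - stepf (s m) u) - (f u - stepf (s n) u).
      by rewrite opprB [RHS]addrC addrA subrK.
    apply: (le_trans (ler_normB _ _)); rewrite mulr_natl mulr2n; apply: lerD.
      exact: le_trans ((hs m).2 _ ut) (pN _ Nm).
    exact: le_trans ((hs n).2 _ ut) (pN _ Nn).
  have bd := bounded_measurableB (bs n) (bs m).
  have p20 : 0 <= 2 * p by rewrite mulr_ge0// ltW.
  have := riesz_form_le sepV a_range t0 bd bd p20 p20 b b; rewrite -/C.
  move=> /(le_trans (ler_norm _)) /(ler_wpM2l k0) /le_trans; apply.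
  have -> : kappa * (2 * p * (2 * p) * C) = p * p * (Q - 1) by rewrite /Q; ring.
  move: hN; rewrite le_min => /andP[p1 pe].
  apply: (@le_trans _ _ (p * Q)).
    by rewrite -mulrA; apply: ler_wpM2l; [exact: ltW|]; apply: (@le_trans _ _ (Q - 1)); [apply: ler_piMl => //; have := mulr_ge0 k0 C0; rewrite /Q; lra|lra].
  by rewrite -ler_pdivlMr.
have [Y Y2 cY] := l2_complete sepV I2 cau.
exists Y => //; split; [exact: bounded_wiener_integrand|exact/L2_rvP|].
exists (fun k => step_n (s k)), (fun k => step_a (s k)), (fun k => step_b (s k)), (fun k => step_v (s k)).
split; [by move=> k i; exact: ws| |exact/(l2toP sepV)].
have bfs k := bounded_measurableB bf (bs k).
rewrite (_ : (fun k => _) = (fun k => (kappa * W (fun u => f u - stepf (s k) u) (fun u => f u - stepf (s k) u))%:E)).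
  apply: cvg_EFin; first exact: nearW.
  have c0 : kappa * (k.+1%:R^-1 * k.+1%:R^-1 * C) @[k --> \oo] --> kappa * (0 * 0 * C).
    apply: cvgMr; apply: cvgMl; apply: cvgM; exact: cvg_harmonic.
  rewrite !mul0r mulr0 in c0.
  apply/norm_cvg0P; apply: squeeze_cvgr c0; last exact: cvg_cst.
  apply: nearW => k; rewrite normr_ge0 /= normrM ger0_norm//; apply: ler_wpM2l => //.
  have i0 : 0 <= k.+1%:R^-1 :> R by rewrite invr_ge0.
  exact: (riesz_form_le sepV a_range t0 (bfs k) (bfs k) i0 i0 (hs k).2 (hs k).2).
by apply/funext => k; rewrite -wiener_norm2E.
Qed.

End wiener.

(** * Mild solutions *)

Section orthogonal_series.
Context {R : realType} {V : hilbertType R} (sepV : separable V).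
Context {d : measure_display} {T : measurableType d} (mu : {measure set T -> \bar R}).
Variable Y : nat -> T -> V.
Hypothesis Y2 : forall j, sqint mu (Y j).
Hypothesis orthY : forall j k, j != k -> l2dot mu (Y j) (Y k) = 0.

Local Notation psum n := (fun w => \sum_(0 <= j < n) Y j w).

Let psum2 n : sqint mu (psum n).
Proof. exact: (sqint_sum sepV). Qed.

Lemma l2dot_orthogonal_sum m n :
  l2dot mu (fun w => \sum_(m <= j < n) Y j w) (fun w => \sum_(m <= j < n) Y j w) =
  \sum_(m <= j < n) l2dot mu (Y j) (Y j).
Proof.
rewrite (l2dot_suml sepV _ (fun j _ => Y2 j)); last exact: (sqint_sum sepV).
rewrite big_seq [RHS]big_seq; apply: eq_bigr => j jmn.
rewrite (l2dot_sumr sepV _ (fun j _ => Y2 j))// (bigD1_seq j) ?iota_uniq//=.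
by rewrite big1 ?addr0// => k kj; rewrite orthY// eq_sym.
Qed.

Lemma orthogonal_series_bound S n : sqint mu S -> l2to mu (fun n => psum n) S ->
  \sum_(0 <= j < n) l2dot mu (Y j) (Y j) <= l2dot mu S S.
Proof.
move=> S2 cS; have cn := l2to_norm_cvg sepV psum2 S2 cS.
apply: ler_cvg_to (cvg_cst _) cn _; exists n => // m /= nm.
rewrite l2dot_orthogonal_sum (big_cat_nat (leq0n _) nm)//= lerDl.
by apply: sumr_ge0 => j _; exact: l2dot_ge0.
Qed.

(** By orthogonality the squared distance of two partial sums is the increment of a bounded
    nondecreasing real sequence. *)
Lemma orthogonal_series_cvg (C : R) : (forall n, \sum_(0 <= j < n) l2dot mu (Y j) (Y j) <= C) ->
  exists2 S, sqint mu S & l2to mu (fun n => psum n) S.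
Proof.
move=> hC; apply: (l2_complete sepV) => // e e0.
pose u n := \sum_(0 <= j < n) l2dot mu (Y j) (Y j).
have ui m n : (m <= n)%N -> u m <= u n.
  move=> mn; rewrite /u (big_cat_nat (leq0n _) mn)//= lerDl.
  by apply: sumr_ge0 => j _; exact: l2dot_ge0.
have : cvgn u.
  apply: nondecreasing_is_cvgn; first by move=> m n; exact: ui.
  by exists C => _ [n _ <-]; exact: hC.
move=> /cvgrPdist_le/(_ (e / 2))[|N _ hN]; first by rewrite divr_gt0.
exists N => m n Nm Nn.
wlog mn : m n Nm Nn / (m <= n)%N => [W|].
  have [/W|/ltnW/W] := leqP m n; first exact.
  move=> /(_ Nn Nm); congr (_ <= _); apply: eq_Rintegral => w _.
  by rewrite -[in LHS]opprB ipNl ipNr opprK.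
have -> : (fun w => \sum_(0 <= j < n) Y j w - \sum_(0 <= j < m) Y j w) =
    fun w => \sum_(m <= j < n) Y j w.
  by apply/funext => w; rewrite (big_cat_nat (leq0n _) mn)//= [LHS]addrC addKr.
rewrite l2dot_orthogonal_sum; have -> : \sum_(m <= j < n) l2dot mu (Y j) (Y j) = u n - u m.
  by rewrite /u (big_cat_nat (leq0n _) mn)//= [RHS]addrC addKr.
have := hN _ Nm; have := hN _ Nn; rewrite /= !ler_norml => /andP[h1 h2] /andP[h3 h4].
move: (limn u) h1 h2 h3 h4 => l; move: (u n) (u m) => x y; lra.
Qed.

End orthogonal_series.

(** * The semigroup as an integrand *)

Section semigroup_integrand.
Context {R : realType} {V : hilbertType R} (sepV : separable V).
Variable S : R -> {linear V -> V}.
Hypothesis S_c0 : c0_semigroup S.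
Variables (t : R) (x : V).
Hypothesis t0 : 0 <= t.

(** The semigroup laws hold only for nonnegative times. Clamping s to [0, t] extends the orbit to a
    bounded, uniformly continuous function on the whole line. *)
Definition clamp (s : R) := Num.min (Num.max s 0) t.

Lemma clamp_id s : 0 <= s <= t -> clamp s = s.
Proof. by move=> /andP[s0 st]; rewrite /clamp max_l// min_l. Qed.

Lemma clamp_range s : 0 <= t - clamp s <= t.
Proof.
rewrite /clamp subr_ge0 ge_min lexx orbT /= lerBlDr lerDl le_min t0 andbT.
by rewrite le_max lexx orbT.
Qed.

Lemma clamp_dist s r : `|clamp s - clamp r| <= `|s - r|.
Proof.
wlog sr : s r / r <= s => [W|].
  by have [/W//|/ltW/W] := leP r s; rewrite distrC => /le_trans; apply; rewrite distrC.
rewrite [leRHS]ger0_norm ?subr_ge0// /clamp.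
have [s0|s0] := leP s 0; have [r0|r0] := leP r 0.
- by rewrite subrr normr0 subr_ge0.
- by move: (lt_le_trans r0 (le_trans sr s0)); rewrite ltxx.
- rewrite [X in _ - X]min_l// subr0; have [st|st] := leP s t.
    by rewrite ger0_norm ?(ltW s0)//; lra.
  by rewrite ger0_norm//; lra.
have [st|st] := leP s t; have [rt|rt] := leP r t.
- by rewrite ger0_norm; lra.
- lra.
- by rewrite ger0_norm; lra.
- by rewrite subrr normr0; lra.
Qed.

Definition semigroup_integrand (s : R) : V := S (t - clamp s) x.

Lemma semigroup_integrand_unif (e : R) : 0 < e -> exists2 r : R, 0 < r &
  forall u v, `|u - v| < r -> `|semigroup_integrand u - semigroup_integrand v| <= e.
Proof.
move=> e0; have [r r0 hr] := c0_semigroup_unif S_c0 t x e0; exists r => // u v uv.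
apply: hr; [exact: clamp_range|exact: clamp_range|].
apply: le_lt_trans uv; apply: le_trans (clamp_dist u v).
by rewrite opprB addrC addrA subrK distrC.
Qed.

Lemma bounded_semigroup_integrand : bounded_measurable semigroup_integrand.
Proof.
split; last first.
  have [M M0 hM] := c0_semigroup_bound S_c0 t; exists (M * `|x|) => s.
  exact/hM/clamp_range.
move=> v; suff : continuous (fun s => ip (semigroup_integrand s) v).
  exact: continuous_measurable_fun.
move=> s; apply: cvg_ip; last exact: cvg_cst.
apply/cvgrPdist_le => e e0; have [r r0 hr] := semigroup_integrand_unif e0.
near=> u; apply: hr; near: u.
by exists r => // u /=.
Unshelve. all: by end_near. Qed.

Lemma semigroup_integrand_step_limit : uniform_step_limit t semigroup_integrand.
Proof.
move=> e e0; have [r r0 hr] := semigroup_integrand_unif e0.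
pose N := (Num.truncn (t / r)).+1.
have N0 : 0 < N%:R :> R by rewrite ltr0n.
have tN : t / N%:R < r.
  by rewrite ltr_pdivrMr// mulrC -ltr_pdivrMr//; exact: truncnS_gt.
pose c (i : nat) := i%:R * (t / N%:R).
have c0 i : 0 <= c i by rewrite /c mulr_ge0// divr_ge0// ltW.
have cS i : c i <= c i.+1 by rewrite /c ler_wpM2r ?ler_nat// divr_ge0// ltW.
have cN i : (i < N)%N -> c i.+1 <= t.
  by move=> iN; rewrite /c mulrCA ler_piMr// ler_pdivrMr// mul1r ler_nat.
exists (StepData N c (fun i => c i.+1) (fun i => semigroup_integrand (c i.+1))).
  by move=> i iN /=; rewrite c0 cS cN.
move=> u /andP[u0 ut]; rewrite /stepf /step_fun /=.
(* The half-open cells partition ]0, t]: each indicator is a difference of two consecutive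
   comparisons, and the sum telescopes. *)
have one : \sum_(i < N) (\1_(`]c i, c i.+1]) u : R) = 1.
  have E i (v : R) : (\1_(`]c i, c i.+1]) v : R) = (v <= c i.+1)%R%:R - (v <= c i)%R%:R.
    rewrite indicE mem_setE in_itv/= ltNge.
    have [vc|vc] := leP v (c i); first by rewrite (le_trans vc (cS i)) subrr.
    by rewrite subr0.
  under eq_bigr do rewrite E.
  rewrite -(big_mkord xpredT (fun i => (u <= c i.+1)%R%:R - (u <= c i)%R%:R)) telescope_sumr//.
  have -> : c N = t by rewrite /c mulrC divfK// gt_eqF.
  by rewrite ut /c mul0r [(u <= 0)%R]leNgt u0 subr0.
have -> : semigroup_integrand u - \sum_(i < N) (\1_(`]c i, c i.+1]) u : R) *: semigroup_integrand (c i.+1) =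
    \sum_(i < N) (\1_(`]c i, c i.+1]) u : R) *: (semigroup_integrand u - semigroup_integrand (c i.+1)).
  under [RHS]eq_bigr do rewrite scalerBr.
  by rewrite sumrB -scaler_suml one scale1r.
apply: (le_trans (ler_norm_sum _ _ _)).
rewrite -[leRHS]mul1r -one mulr_suml; apply: ler_sum => i _.
rewrite normrZ indicE; case: (boolP (u \in _)); rewrite ?normr0 ?mul0r//.
rewrite mem_setE in_itv/= => /andP[cu uc]; rewrite normr1 !mul1r; apply: hr.
rewrite distrC ger0_norm ?subr_ge0//; apply: le_lt_trans tN.
by rewrite lerBlDr -lerBlDl (le_trans _ (ltW cu))// /c -natr1 mulrDl mul1r addrK.
Qed.

Lemma semigroup_integrandE s : 0 <= s <= t -> semigroup_integrand s = S (t - s) x.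
Proof. by move=> st; rewrite /semigroup_integrand clamp_id. Qed.

End semigroup_integrand.

(** Used to pass between the orbit s -> S(t - s)Phi(e_j) of the statement and its clamped
    extension. *)
Lemma eq_wiener_integral {R : realType} {d : measure_display} {Omega : measurableType d}
    (P : probability Omega R) (V : hilbertType R) (H t : R) (z : R -> Omega -> R)
    (f g : R -> V) Y : (forall s, 0 <= s <= t -> f s = g s) ->
  wiener_integral P H z t f Y -> wiener_integral P H z t g Y.
Proof.
move=> fg [[mf If] Y2 [n [a [b [v [wab cf cY]]]]]].
have sq (p : R * R) : p \in square t -> f p.1 = g p.1 /\ f p.2 = g p.2.
  by rewrite inE => -[/=]; rewrite !in_itv/= => h1 h2; rewrite !fg.
split => //.
  split.
    by apply: eq_measurable_fun mf => s; rewrite inE/= in_itv/= => /fg.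
  by move: If; congr (_ < _)%E; apply: eq_integral => p /sq[-> ->].
exists n, a, b, v; split => //.
move: cf; rewrite (_ : (fun k => _) = (fun k => wiener_norm2 H t (fun s => g s - step_fun (n k) (a k) (b k) (v k) s)))//.
apply/funext => k; congr (_ * _)%E; apply: eq_integral => p /sq[h1 h2].
by rewrite h1 h2.
Qed.

Section exp_riesz_joint.
Context {R : realType}.
Variables a t : R.
Notation leb := (@lebesgue_measure R).
Local Notation m2 := (leb \x leb)%E.

Lemma measurable_exp_riesz_joint :
  measurable_fun setT (fun q : (measurableTypeR R * measurableTypeR R) * R => exp_riesz a q.2 t q.1).
Proof.
apply: measurable_funM.
  apply: measurableT_comp => //; apply: measurableT_comp => //; apply: measurable_funM => //.
  apply: measurable_funB; last exact: measurableT_comp.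
  by apply: measurable_funB => //; exact: measurableT_comp.
by apply: measurableT_comp measurable_fst; exact: measurable_riesz_kernel.
Qed.

Lemma measurable_integral_exp_riesz :
  measurable_fun setT (fun l : R => \int[m2]_(p in square t) (exp_riesz a l t p)%:E)%E.
Proof.
apply: (@measurable_integral_section R _ _ R _ (sigma_product leb leb) (square t)
  (fun q : R * (measurableTypeR R * measurableTypeR R) => (exp_riesz a q.1 t q.2)%:E)).
- exact: measurable_square.
- apply/measurable_EFinP.
  have ms : measurable_fun setT (fun q : R * (measurableTypeR R * measurableTypeR R) => (q.2, q.1)).
    by apply: measurable_fun_pair.
  exact: (measurableT_comp measurable_exp_riesz_joint ms).
- by move=> q; rewrite lee_fin exp_riesz_ge0.
Qed.

End exp_riesz_joint.

(** * Energies of orbits through the spectral measure *)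

Section semigroup_energy.
Context {R : realType} {V : hilbertType R} (sepV : separable V).
Variables (D : set V) (A : V -> V).
Hypotheses (A_sa : self_adjoint D A) (A_neg : negative_op D A).
Variable S : R -> {linear V -> V}.
Hypotheses (S_c0 : c0_semigroup S) (S_gen : generated_by S D A).
Variable E : set R -> V -> V.
Hypothesis E_spec : spectral_measure D (fun v => - A v) E.
Notation leb := (@lebesgue_measure R).
Local Notation m2 := (leb \x leb)%E.
Local Notation mu := (spectral_meas (spectral_measure_pvm E_spec)).

Let nonneg := (`[0, +oo[%classic : set R).

Lemma spectral_meas_nonneg x (f : R -> R) : measurable_fun setT f -> (forall l, 0 <= f l) ->
  (\int[mu x]_l (f l)%:E = \int[mu x]_(l in nonneg) (f l)%:E)%E.
Proof.
move=> mf f0; have mn : measurable nonneg by exact: measurable_itv.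
rewrite (@ge0_negligible_integral _ _ _ _ setT (~` nonneg))//.
- by rewrite setTD setCK.
- exact: measurableC.
- exact/measurable_EFinP.
- by move=> l _; rewrite lee_fin.
have pvm := spectral_measure_pvm E_spec; case: (pvm) => _ _ EI _.
apply: etrans (spectral_measE pvm x (measurableC mn)) _.
rewrite -(pvm_nonneg A_neg E_spec x) -EI//; last exact: measurableC.
by rewrite setICl -(spectral_measE pvm x measurable0) measure0.
Qed.

Variables (a t : R).
Hypotheses (a01 : -1 < a < 0) (t0 : 0 <= t).

(** [semigroup_ip] at the times t - u and t - v writes the integrand as an integral over the
    spectrum; Tonelli then puts the integral over the square inside. *)
Lemma semigroup_energy x :
  ((riesz_form a t (semigroup_integrand S t x) (semigroup_integrand S t x))%:E =
   \int[mu x]_(l in nonneg) \int[m2]_(p in square t) (exp_riesz a l t p)%:E)%E.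
Proof.
have bf := bounded_semigroup_integrand S_c0 x t0.
rewrite -(riesz_formE sepV a01 t0 bf bf).
have mE := measurable_exp_riesz_joint a t.
(* Indicators encode both domains, so that Tonelli is applied on the full product. *)
pose F (q : (measurableTypeR R * measurableTypeR R) * R) : \bar R :=
  ((exp_riesz a q.2 t q.1)%:E * (\1_(square t) q.1)%:E * (\1_nonneg q.2)%:E)%E.
have F0 q : (0 <= F q)%E by rewrite /F !mule_ge0// lee_fin ?exp_riesz_ge0// indicE.
have mF : measurable_fun setT F.
  apply: emeasurable_funM.
    apply: emeasurable_funM; first exact/measurable_EFinP.
    apply/measurable_EFinP; apply: measurableT_comp measurable_fst.
    by apply: measurable_indic; exact: measurable_square.
  apply/measurable_EFinP; apply: measurableT_comp measurable_snd.
  by apply: measurable_indic; exact: measurable_itv.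
have := @fubini_tonelli _ _ _ _ R (sigma_product leb leb) (mu x) F mF F0.
have -> : (\int[m2]_p \int[mu x]_l F (p, l) =
    \int[m2]_(p in square t) (ip (semigroup_integrand S t x p.1) (semigroup_integrand S t x p.2) * riesz_kernel a p)%:E)%E.
  rewrite [RHS]integral_mkcond; apply: eq_integral => p _.
  rewrite patchE; case: ifPn => pt; last first.
    by apply: integral0_eq => l _; rewrite /F /= indicE (negbTE pt) mule0 mul0e.
  move: (pt); rewrite inE => -[/=]; rewrite !in_itv/= => p1 p2.
  rewrite !semigroup_integrandE// EFinM.
  rewrite (semigroup_ip A_sa A_neg S_c0 S_gen E_spec) ?subr_ge0//; [|by case/andP: p1|by case/andP: p2].
  rewrite muleC -ge0_integralZl_EFin//; last 2 first.
  - apply/measurable_EFinP; apply: measurableT_comp => //; exact: measurableT_comp.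
  - exact: riesz_kernel_ge0.
  rewrite [RHS]integral_mkcond; apply: eq_integral => l _.
  rewrite patchE /F /= !indicE pt mule1; case: ifPn => _ /=; last by rewrite mule0.
  by rewrite mule1 -EFinM /exp_riesz; congr EFin; rewrite mulrC; congr (_ * expR _); ring.
move=> ->; rewrite [RHS]integral_mkcond; apply: eq_integral => l _.
rewrite patchE; case: ifPn => ln; last first.
  by apply: integral0_eq => p _; rewrite /F /= [X in (_ * (X%:E))%E]indicE (negbTE ln) mule0.
rewrite [RHS]integral_mkcond; apply: eq_integral => p _.
rewrite patchE /F /= !indicE ln mule1.
by case: ifPn => _; rewrite /= ?mule1 ?mule0.
Qed.

End semigroup_energy.

Section mild.
Context {R : realType} {d : measure_display} {Omega : measurableType d}.
Variables (P : probability Omega R) (H T : R).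
Hypotheses (H_range : 2^-1 < H < 1).
Variables (U V : hilbertType R) (sepV : separable V) (J : set nat) (e : nat -> U).
Variable z : nat -> R -> {RV P >-> R}.
Hypothesis rz : forall j, J j -> rosenblatt_process H T (z j).
Hypothesis indep : independent_classes P J
  (fun j => process_sigma_algebra T (fun t => z j t : Omega -> R)).
Variables (Phi : {linear U -> V}) (bounded_Phi : continuous (Phi : U -> V)).
Variables (D : set V) (A : V -> V).
Hypotheses (A_sa : self_adjoint D A) (A_neg : negative_op D A).
Variable S : R -> {linear V -> V}.
Hypotheses (S_c0 : c0_semigroup S) (S_gen : generated_by S D A).
Variable E : set R -> V -> V.
Hypothesis E_spec : spectral_measure D (fun v => - A v) E.

Local Notation T0 := (fun u : U => adjoint Phi (spectral_integral E (G_ H) (Phi u))).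
Local Notation f_ t j := (semigroup_integrand S t (Phi (e j))).
Local Notation energy t j := (covariance_const H * riesz_form (2 * H - 2) t (f_ t j) (f_ t j)).

Let a_range : -1 < 2 * H - 2 < 0.
Proof. by move: H_range => /andP[h1 h2]; apply/andP; split; lra. Qed.

Let GE l : G_ H l = Num.max l 1 `^ (- (2 * H - 2 + 2)).
Proof. by rewrite subrK. Qed.

Lemma G_range (l : R) : 0 <= G_ H l <= 1.
Proof.
rewrite powR_ge0 /= /G_ -[leRHS](powRr0 (Num.max l 1)) ler_powR//.
  by rewrite le_max lexx orbT.
by case/andP: H_range => h _; lra.
Qed.

Lemma measurable_G : measurable_fun setT (G_ H : R -> R).
Proof. by apply: measurable_powR_comp; exact: measurable_maxr. Qed.

Lemma sandwich_trace_term j :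
  ((ip (T0 (e j)) (e j))%:E =
   \int[spectral_meas (spectral_measure_pvm E_spec) (Phi (e j))]_(l in `[0%R, +oo[) (G_ H l)%:E)%E.
Proof.
rewrite (sandwich_diag (spectral_measure_pvm E_spec) bounded_Phi measurable_G G_range).
by rewrite (spectral_meas_nonneg A_neg)//; [exact: measurable_G|move=> l; case/andP: (G_range l)].
Qed.

Lemma energy_upper : 0 <= T -> exists2 C : R, 0 <= C &
  forall t j, 0 <= t <= T -> energy t j <= C * ip (T0 (e j)) (e j).
Proof.
move=> T_ge0; have [C C0 hC] := integral_exp_riesz_upper a_range T_ge0.
have k0 := ltW (covariance_const_gt0 H_range).
exists (covariance_const H * C) => [|t j tT]; first exact: mulr_ge0.
have [t0 _] := andP tT.
rewrite -mulrA; apply: ler_wpM2l => //.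
rewrite -lee_fin EFinM sandwich_trace_term (semigroup_energy sepV A_sa A_neg S_c0 S_gen E_spec a_range t0).
rewrite -ge0_integralZl_EFin//; last 2 first.
- by move=> l _; rewrite lee_fin; case/andP: (G_range l).
- by apply/measurable_EFinP; apply: measurable_funTS; exact: measurable_G.
apply: ge0_le_integral => //.
- by move=> l _; apply: integral_ge0 => p _; rewrite lee_fin exp_riesz_ge0.
- by apply: measurable_funTS; exact: measurable_integral_exp_riesz.
- by apply: measurable_funeM; apply/measurable_EFinP; apply: measurable_funTS; exact: measurable_G.
- move=> l; rewrite /= in_itv/= andbT => l0.
  by rewrite -EFinM GE; exact: hC.
Qed.

(** The bound is claimed at the final time only: its constant comes from a box at the corner (T, T),
    and a mild solution exists in particular at T. *)
Lemma energy_lower : 0 < T -> exists2 c : R, 0 < c &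
  forall j, c * ip (T0 (e j)) (e j) <= energy T j.
Proof.
move=> T_gt0; have [c c0 hc] := integral_exp_riesz_lower a_range T_gt0.
have k0 := covariance_const_gt0 H_range.
exists (covariance_const H * c) => [|j]; first exact: mulr_gt0.
rewrite -mulrA ler_pM2l//.
rewrite -lee_fin EFinM sandwich_trace_term
  (semigroup_energy sepV A_sa A_neg S_c0 S_gen E_spec a_range (ltW T_gt0)).
rewrite -ge0_integralZl_EFin//; last 3 first.
- by move=> l _; rewrite lee_fin; case/andP: (G_range l).
- by apply/measurable_EFinP; apply: measurable_funTS; exact: measurable_G.
- exact: ltW.
apply: ge0_le_integral => //.
- by move=> l _; rewrite -EFinM lee_fin mulr_ge0 ?(ltW c0)//; case/andP: (G_range l).
- by apply: measurable_funeM; apply/measurable_EFinP; apply: measurable_funTS; exact: measurable_G.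
- by apply: measurable_funTS; exact: measurable_integral_exp_riesz.
- move=> l; rewrite /= in_itv/= andbT => l0.
  by rewrite -EFinM GE; exact: hc.
Qed.

Local Notation b_ := (basis_ext J e).

Lemma basis_ext_term j : ip (T0 (b_ j)) (b_ j) = if j \in J then ip (T0 (e j)) (e j) else 0.
Proof. by rewrite /basis_ext; case: ifP => // _; rewrite ip0r. Qed.

(** The same padding as in [basis_ext], so that the terms form an orthogonal sequence over nat. *)
Definition extend_by0 (Y : nat -> Omega -> V) j w : V := if j \in J then Y j w else 0.

Section fixed_time.
Variable t : R.
Hypothesis tT : 0 <= t <= T.
Variable Y : nat -> Omega -> V.
Hypothesis wY : forall j, J j ->
  wiener_integral P H (fun r => z j r : Omega -> R) t (fun s => S (t - s) (Phi (e j))) (Y j).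

Let t0 : 0 <= t. Proof. by case/andP: tT. Qed.

Let wY' j : J j -> wiener_integral P H (fun r => z j r : Omega -> R) t (f_ t j) (Y j).
Proof.
move=> Jj; apply: eq_wiener_integral (wY Jj) => s st.
by rewrite semigroup_integrandE.
Qed.

Lemma sqint_extend_by0 j : sqint P (extend_by0 Y j).
Proof.
rewrite /extend_by0; case: (boolP (j \in J)) => [/set_mem Jj|_]; last exact: sqint0.
by have [_ /(L2_rvP P sepV)] := wY Jj.
Qed.

Lemma extend_by0_orthogonal j k : j != k -> l2dot P (extend_by0 Y j) (extend_by0 Y k) = 0.
Proof.
move=> jk; rewrite /extend_by0; case: (boolP (j \in J)) => [/set_mem Jj|_]; last by rewrite l2dot0l.
case: (boolP (k \in J)) => [/set_mem Jk|_]; last by rewrite l2dotC l2dot0l.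
by apply: (wiener_integral_orthogonal H_range rz indep tT sepV Jj Jk jk _ _ (wY' Jj) (wY' Jk));
  exact: bounded_semigroup_integrand.
Qed.

Lemma extend_by0_energy j : J j ->
  energy t j <= 2 * l2dot P (extend_by0 Y j) (extend_by0 Y j) /\
  l2dot P (extend_by0 Y j) (extend_by0 Y j) <= 2 * energy t j.
Proof.
move=> Jj; rewrite /extend_by0 mem_set//.
by apply: (wiener_integral_energy H_range rz tT sepV Jj _ _ (wY' Jj));
  [exact: bounded_semigroup_integrand|exact: semigroup_integrand_step_limit].
Qed.

Lemma extend_by0_sum n w : \sum_(0 <= j < n | j \in J) Y j w = \sum_(0 <= j < n) extend_by0 Y j w.
Proof. by rewrite big_mkcond. Qed.

End fixed_time.

Lemma mild_solution_trace_bound x X : 0 < T ->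
  mild_solution P H T J e (fun j t => z j t : Omega -> R) (fun t => S t : V -> V) Phi x X ->
  exists C, forall n, \sum_(0 <= j < n) ip (T0 (b_ j)) (b_ j) <= C.
Proof.
move=> T_gt0 /(_ T)[|S_ [S2 [Y [wY cY]]] _]; first by rewrite ltW/=.
have TT : 0 <= T <= T by rewrite ltW/=.
have [c c0 hc] := energy_lower T_gt0.
have y2 := sqint_extend_by0 wY; have yo := extend_by0_orthogonal TT wY.
move: S2 => /(L2_rvP P sepV) S2.
have cS : l2to P (fun n w => \sum_(0 <= j < n) extend_by0 Y j w) S_.
  apply/(l2toP sepV) => //; first by move=> n; exact: (sqint_sum sepV).
  rewrite [X in X @ _](_ : _ = fun n => \int[P]_w (`|\sum_(0 <= j < n | j \in J) Y j w - S_ w| ^+ 2)%:E)%E//.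
  by apply/funext => n; apply: eq_integral => w _; rewrite extend_by0_sum.
(* c times the j-th trace term is at most the j-th energy, hence at most twice the second moment of
   the j-th integral; those moments sum to at most that of S_. *)
exists (c^-1 * (2 * l2dot P S_ S_)) => n.
rewrite -ler_pdivrMl ?invr_gt0// invrK.
apply: (@le_trans _ _ (2 * \sum_(0 <= j < n) l2dot P (extend_by0 Y j) (extend_by0 Y j))).
  rewrite !mulr_sumr; apply: ler_sum => j _; rewrite basis_ext_term.
  case: ifPn => [/set_mem Jj|_]; last by rewrite mulr0 mulr_ge0// l2dot_ge0.
  exact: le_trans (hc j) (extend_by0_energy TT wY Jj).1.
by rewrite ler_pM2l//; exact: (orthogonal_series_bound sepV y2 yo n S2 cS).
Qed.

Lemma stochastic_integral_exists C t : 0 <= t <= T ->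
  (forall n, \sum_(0 <= j < n) ip (T0 (b_ j)) (b_ j) <= C) ->
  exists Y, stochastic_integral P H J e (fun j t => z j t : Omega -> R) t
    (fun s u => S (t - s) (Phi u)) Y.
Proof.
move=> tT hC; have [t0 tT'] := andP tT; have T_ge0 := le_trans t0 tT'.
have [K K0 hK] := energy_upper T_ge0.
have /choice[Y wY] : forall j, exists Y : Omega -> V, J j ->
    wiener_integral P H (fun r => z j r : Omega -> R) t (fun s => S (t - s) (Phi (e j))) Y.
  move=> j; have [Jj|nJ] := pselect (J j); last by exists (fun=> 0).
  have bf := bounded_semigroup_integrand S_c0 (Phi (e j)) t0.
  have lf : uniform_step_limit t (f_ t j) by exact: semigroup_integrand_step_limit.
  have [Y _ wY] := wiener_integral_exists H_range rz tT sepV Jj bf lf.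
  exists Y => _; apply: eq_wiener_integral wY => s st.
  by rewrite semigroup_integrandE.
have y2 := sqint_extend_by0 wY; have yo := extend_by0_orthogonal tT wY.
(* The 2 is the loss between second moment and energy, K the loss between energy and trace term. *)
have [n|S_ S2 cS] := orthogonal_series_cvg sepV y2 yo (C := 2 * K * C).
  apply: (@le_trans _ _ (2 * K * \sum_(0 <= j < n) ip (T0 (b_ j)) (b_ j))); last first.
    by apply: ler_wpM2l => //; rewrite mulr_ge0.
  rewrite mulr_sumr; apply: ler_sum => j _; rewrite basis_ext_term.
  case: ifPn => [/set_mem Jj|nJ]; last by rewrite mulr0 /extend_by0 (negbTE nJ) l2dot0l.
  apply: le_trans (extend_by0_energy tT wY Jj).2 _.
  by rewrite -mulrA ler_pM2l//; exact: hK.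
exists S_; split; first exact/(L2_rvP P sepV).
exists Y; split => //; move: cS => /(l2toP sepV); rewrite /L2_cvg => /(_ _ S2) h.
rewrite (_ : (fun n => _) = fun n => (\int[P]_w (`|\sum_(0 <= j < n) extend_by0 Y j w - S_ w| ^+ 2)%:E)%E).
  by apply: h => n; exact: (sqint_sum sepV).
by apply/funext => n; apply: eq_integral => w _; rewrite extend_by0_sum.
Qed.

End mild.

Theorem theorem1 (R : realType) (d : measure_display)
  (Omega : measurableType d) (P : probability Omega R)
  (H T : R) (H_range : 2^-1 < H < 1) (T_gt0 : 0 < T)
  (U V : hilbertType R) (sepU : separable U) (sepV : separable V)
  (* the infinite dimensional Rosenblatt process Z = \sum_j z_j e_j *)
  (J : set nat) (e : nat -> U) (basis_e : orthonormal_basis J e)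
  (z : nat -> R -> {RV P >-> R})
  (rosenblatt_z : forall j, J j -> rosenblatt_process H T (z j))
  (independent_z : independent_classes P J
     (fun j => process_sigma_algebra T (fun t => z j t : Omega -> R)))
  (Phi : {linear U -> V}) (bounded_Phi : continuous (Phi : U -> V))
  (* the operator A, with domain D *)
  (D : set V) (A : V -> V) (A_sa : self_adjoint D A) (A_neg : negative_op D A)
  (* the semigroup generated by A *)
  (S : R -> {linear V -> V}) (S_c0 : c0_semigroup S)
  (S_gen : generated_by S D A)
  (* the spectral measure of -A, through which G_H(-A) is defined *)
  (E : set R -> V -> V) (E_spec : spectral_measure D (fun v => - A v) E)
  (x : V) :
  (exists X : R -> Omega -> V,
     mild_solution P H T J e (fun j t => z j t : Omega -> R)
       (fun t => S t : V -> V) Phi x X)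
  <->
  trace_class (fun u : U => adjoint Phi (spectral_integral E (G_ H) (Phi u))).
Proof.
have pvm := spectral_measure_pvm E_spec.
have psdT := sandwich_psd pvm bounded_Phi (measurable_G H) (G_range H_range).
split=> [[X mX]|/(trace_class_bounded_trace basis_e)[C hC]].
  have [C hC] := mild_solution_trace_bound H_range sepV rosenblatt_z independent_z
    bounded_Phi A_sa A_neg S_c0 S_gen E_spec T_gt0 mX.
  exact: (trace_class_psd basis_e psdT hC).
(* The integrals are chosen time by time, since a mild solution constrains each X(t) separately;
   outside [0, T] the value is arbitrary. *)
have /choice[Y sY] : forall t, exists Y : Omega -> V, 0 <= t <= T ->
    stochastic_integral P H J e (fun j t => z j t : Omega -> R) t
      (fun s u => S (t - s) (Phi u)) Y.
  move=> t; have [tT|nT] := pselect (0 <= t <= T); last by exists (fun=> 0).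
  have [Y sY] := stochastic_integral_exists H_range sepV rosenblatt_z independent_z
    bounded_Phi A_sa A_neg S_c0 S_gen E_spec tT hC.
  by exists Y.
exists (fun t w => S t x + Y t w) => t tT; exists (Y t); first exact: sY.
exact: aeW.
Qed.
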